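(* Let $(\Omega_\delta)_{\delta\in(0,1]}$ be a thin domain in $\mathbb R^N$ with $d$ thin directions and limit set $\Omega\subset\mathbb R^{N-d}$, and let $A_\delta$, $A_0$, $\mathcal H_\delta$, $\mathcal H_0$, $\mathcal E_\delta$ be as defined in the context. Let $\omega(\delta)>0$ be a function with $\omega(\delta)\to0$ as $\delta\to0^+$ and $$\|A_\delta^{-1}\mathcal E_\delta f_0-\mathcal E_\delta A_0^{-1}f_0\|_{\mathcal H_\delta}\le\omega(\delta)\|f_0\|_{\mathcal H_0}\quad\text{for all }f_0\in\mathcal H_0 .$$ Let $\lambda_0\in\sigma(A_0)$ be an eigenvalue of multiplicity $m\ge1$ and let $\lambda_\delta^i\in\sigma(A_\delta)$, $i=1,\dots,m$ (counted with multiplicity), be such that $\lambda_\delta^i\to\lambda_0$ as $\delta\to0^+$. Let $\gamma$ be a closed Jordan curve in $\mathbb C$ containing in its interior $\lambda_0$ and $\lambda_\delta^i$, $i=1,\dots,m$, but no other point of $\sigma(A_0)\cup\sigma(A_\delta)$ (for all sufficiently small $\delta$), and let $P_\gamma^0:=\frac1{2\pi i}\int_\gamma(A_0-z)^{-1}dz$. Then there is a constant $C>0$ independent of $\delta$ such that, for all sufficiently small $\delta>0$, $$\sum_{i=1}^m|\lambda_\delta^i-\lambda_0|\le C\,\omega(\delta)\,|\lambda_0|\,\sup_{\delta'}\Big[\|\mathcal E_{\delta'}P_\gamma^0\|^{-1}\sum_{i=1}^m\big(1+|\lambda_{\delta'}^i|+|\lambda_{\delta'}^i|\,\|A_{\delta'}^{-1}\|\big)\Big],$$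 where the supremum is over all sufficiently small $\delta'>0$ and norms are operator norms.
   Context: Thin domain. $N\ge2$, $d\in\{1,\dots,N-1\}$, $\Omega$ is a smooth bounded open set in $\mathbb R^{N-d}$, $B=B_d(0,1)$ is the unit ball of $\mathbb R^d$. $\Omega_1=\{(x,y)\in\mathbb R^{N-d}\times\mathbb R^d:x\in\Omega,\ y\in\Omega_1^{II}(x)\}$, where for each $x\in\Omega$ there is a bi-Lipschitz homeomorphism $L_x:B\to\Omega_1^{II}(x)$, and the map $L:\Omega\times B\to\Omega_1$, $L(x,y)=(x,L_x(y))$, is also a bi-Lipschitz homeomorphism. For $\delta\in(0,1]$, $\Omega_\delta=\{(x,\delta y):(x,y)\in\Omega_1\}$, with sections $\Omega_\delta^{II}(x)=\delta\,\Omega_1^{II}(x)$. $g(x)=|\Omega_1^{II}(x)|$ is the $d$-dimensional Lebesgue measure of the section; $g$ is assumed Lipschitz with $g\ge c_0>0$. Averaging operator: $(\mathcal M_\delta f)(x)=\frac1{|\Omega_\delta^{II}(x)|}\int_{\Omega_\delta^{II}(x)}f(x,y)\,dy$. Spaces (complexified for the contour integrals). $\mathcal H_0=L^2(\Omega;g\,dx)^{N-d+1}$; $\mathcal H_\delta=L^2(\Omega_\delta;\delta^{-d}dxdy)^{N-d}\times\delta L^2_0(\Omega_\delta;\delta^{-d}dxdy)^d\times L^2(\Omega_\delta;\delta^{-d}dxdy)$, where $L^2_0$ means zero average $\mathcal M_\delta U=0$ on sections, with norm $\|U\|_{\mathcal H_\delta}=\|U\|_{L^2(\Omega_\delta;\delta^{-d}dxdy)^{N+1}}$.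 Connecting operators: $(\mathcal E_\delta u_0)(x,y)=(u_0^1,\dots,u_0^{N-d},0,\dots,0,u_0^{N-d+1})(x)$ with $d$ zeros. Parameters. $t>0$, $E>0$, $k>0$ and $\sigma\in(-\frac1{N-1},1)$ are fixed. $\varepsilon(\eta)=\frac12(D\eta+D\eta^T)$ is the symmetric gradient. $\sigma(A)$ (applied to an operator) denotes the spectrum. Operator $A_\delta$: the self-adjoint operator in $L^2(\Omega_\delta;\delta^{-d}dxdy)^{N+1}$ associated with the form on $H^1(\Omega_\delta)^N\times H^1(\Omega_\delta)$ $$\int_{\Omega_\delta}\Big\{\tfrac{E}{12(1-\sigma^2)}\big[(1-\sigma)\varepsilon(\beta):\varepsilon(\eta)+\sigma\,\mathrm{div}\beta\,\mathrm{div}\eta\big]+\tfrac{Ek}{2(1+\sigma)t^2}(\nabla w-\beta)\cdot(\nabla v-\eta)+\tfrac{t^2}{12}\beta\cdot\eta+wv\Big\}\delta^{-d}dxdy .$$ Operator $A_0$: the self-adjoint operator in $L^2(\Omega;g\,dx)^{N-d+1}$ associated with the form on $H^1(\Omega)^{N-d}\times H^1(\Omega)$ $$\int_\Omega\Big\{\tfrac{E}{12(1-\sigma^2)}\big[(1-\sigma)\varepsilon(\beta):\varepsilon(\Psi)+\tfrac{(1-\sigma)\sigma}{(1-\sigma)+d\sigma}\mathrm{div}\beta\,\mathrm{div}\Psi\big]+\tfrac{Ek}{2(1+\sigma)t^2}(\nabla w-\beta)\cdot(\nabla v-\Psi)+\tfrac{t^2}{12}\beta\cdot\Psi+wv\Big\}g\,dx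 .$$ *)

(* Defs.v *)
From HB Require Import structures.
From mathcomp Require Import all_boot all_order all_algebra.
From mathcomp Require Import all_classical all_reals all_analysis.
From mathcomp Require Import complex.
Set Implicit Arguments.
Unset Strict Implicit.
Unset Printing Implicit Defensive.
Import Order.TTheory GRing.Theory Num.Theory.
Import numFieldNormedType.Exports.
Local Open Scope classical_set_scope.
Local Open Scope ring_scope.

(* 'rV[T]_n carries the product sigma-algebra, generated by the entries; for
   T = R this is the Borel sigma-algebra of R^n. *)
Section measurable_row.
Context {d : measure_display} {T : measurableType d}.
Variable n : nat.

Let entry (i : 'I_n) (v : 'rV[T]_n) : T := v ord0 i.

Let row_set0 : g_sigma_preimage entry set0.
Proof. exact: sigma_algebra0. Qed.

Let row_setC A : g_sigma_preimage entry A -> g_sigma_preimage entry (~` A).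
Proof. exact: sigma_algebraC. Qed.

Let row_bigcup (F : (set 'rV[T]_n)^nat) :
  (forall i, g_sigma_preimage entry (F i)) ->
  g_sigma_preimage entry (\bigcup_i F i).
Proof. exact: sigma_algebra_bigcup. Qed.

HB.instance Definition _ := @isMeasurable.Build (measure_tuple_display d)
  'rV[T]_n (g_sigma_preimage entry) row_set0 row_setC row_bigcup.

Lemma measurable_entry (i : 'I_n) :
  measurable_fun setT (fun v : 'rV[T]_n => v ord0 i).
Proof.
move=> _ Y mY; rewrite setTI; apply: sub_sigma_algebra => /=.
rewrite -bigcup_seq/=; exists i => /=; first by rewrite mem_index_enum.
by exists Y => //; rewrite setTI.
Qed.

Lemma measurable_fun_row d' (S : measurableType d') (f : S -> 'rV[T]_n) :
  (forall i, measurable_fun setT (fun s => f s ord0 i)) ->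
  measurable_fun setT f.
Proof.
move=> mf _ A mA; rewrite setTI.
have : preimage_set_system setT f (g_sigma_preimage entry) `<=` measurable.
  rewrite -g_sigma_preimage_comp; apply: smallest_sub.
    exact: sigma_algebra_measurable.
  rewrite -bigcup_seq; apply: bigcup_sub => i _ B [C mC <-].
  by apply: mf.
by apply; exists A => //; rewrite setTI.
Qed.

End measurable_row.

Section lebesgue_row.
Context {R : realType}.

Definition row_cons n (p : R * 'rV[R]_n) : 'rV[R]_n.+1 :=
  row_mx (const_mx p.1 : 'rV_1) p.2.

Definition row_uncons n (v : 'rV[R]_n.+1) : R * 'rV[R]_n :=
  (v ord0 ord0, rsubmx (v : 'rV_(1 + n))).

Lemma row_consK n : cancel (@row_cons n) (@row_uncons n).
Proof.
case=> x v; rewrite /row_uncons /row_cons /= row_mxKr; congr pair.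
have -> : (ord0 : 'I_n.+1) = lshift n (ord0 : 'I_1) by exact: val_inj.
exact: etrans (@row_mxEl _ _ _ _ (const_mx x : 'rV_1) v _ _) (mxE _ _ _ _).
Qed.

Lemma measurable_row_cons n : measurable_fun setT (@row_cons n).
Proof.
apply: measurable_fun_row => i; rewrite /row_cons.
case: (split_ordP (i : 'I_(1 + n))) => j ->.
  rewrite (_ : (fun _ => _) = fst) //.
  apply/funext => p.
  exact: etrans (@row_mxEl _ _ _ _ (const_mx p.1 : 'rV_1) p.2 _ _) (mxE _ _ _ _).
rewrite (_ : (fun _ => _) = (fun v : 'rV[R]_n => v ord0 j) \o snd).
  exact: (measurableT_comp (@measurable_entry _ _ _ j)).
apply/funext => p.
exact: (@row_mxEr _ _ _ _ (const_mx p.1 : 'rV_1) p.2).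
Qed.

Lemma measurable_row_uncons n : measurable_fun setT (@row_uncons n).
Proof.
apply/measurable_fun_pairP; split; first exact: measurable_entry.
apply: measurable_fun_row => i /=.
rewrite (_ : (fun _ => _) =
  (fun v : 'rV[R]_n.+1 => v ord0 (rshift 1 i : 'I_n.+1))).
  exact: measurable_entry.
by apply/funext => v; rewrite mxE.
Qed.

HB.instance Definition _ n :=
  isMeasurableFun.Build _ _ _ _ (@row_cons n) (@measurable_row_cons n).

Section row_measure.
Variables (n : nat) (mu : {sigma_finite_measure set 'rV[R]_n -> \bar R}).

Definition row_measure : set 'rV[R]_n.+1 -> \bar R :=
  pushforward (lebesgue_measure \x mu)%E (@row_cons n).


Let row_measure0 : row_measure set0 = 0%E.
Proof. by rewrite /row_measure /pushforward preimage_set0 measure0. Qed.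

Let row_measure_ge0 A : (0 <= row_measure A)%E.
Proof. by rewrite /row_measure /pushforward measure_ge0. Qed.

Let row_measure_sigma_additive : semi_sigma_additive row_measure.
Proof.
have mf := @measurable_row_cons n.
exact: (@measure_semi_sigma_additive _ _ _
  (measure_function_pushforward__canonical__measure_function_Measure
     (lebesgue_measure \x mu)%E mf)).
Qed.

HB.instance Definition _ := isMeasure.Build _ _ _ row_measure
  row_measure0 row_measure_ge0 row_measure_sigma_additive.

Let row_measure_sigma_finite : sigma_finite setT row_measure.
Proof.
have /sigma_finiteP[F [TF ndF Foo]] :=
  sigma_finiteT (@lebesgue_measure R : {sigma_finite_measure set _ -> \bar R}).
have /sigma_finiteP[G [TG ndG Goo]] := sigma_finiteT mu.
exists (fun k => @row_uncons n @^-1` (F k `*` G k)).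
  rewrite -preimage_bigcup -[LHS](preimage_setT (@row_uncons n)).
  congr (_ @^-1` _); rewrite -setXTT TF TG predeqE => -[x y]; split.
    move=> [/= [i _ Fix] [j _ Gjy]]; exists (maxn i j) => //; split.
    - by move: x Fix; exact/subsetPset/ndF/leq_maxl.
    - by move: y Gjy; exact/subsetPset/ndG/leq_maxr.
  by move=> [i _ []/= ? ?]; split; exists i.
move=> k; have [? ?] := Foo k; have [? ?] := Goo k; split.
  rewrite -[X in measurable X]setTI; apply: measurable_row_uncons => //.
  exact: measurableX.
rewrite /row_measure /pushforward -comp_preimage.
rewrite (_ : _ \o _ = id); last by apply/funext => p /=; exact: row_consK.
by rewrite preimage_id product_measure1E// lte_mul_pinfty// ge0_fin_numE.
Qed.

HB.instance Definition _ := Measure_isSigmaFinite.Build _ _ _ row_measure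
  row_measure_sigma_finite.

End row_measure.

(* The Lebesgue measure of R^n, as the n-fold product of that of R, carried by
   (x, v) |-> row_mx x v from R * R^n to R^(n+1). *)
Fixpoint lebesgue_row n : {sigma_finite_measure set 'rV[R]_n -> \bar R} :=
  if n is n'.+1 then row_measure (lebesgue_row n')
  else @dirac _ 'rV[R]_0 0 R.

End lebesgue_row.

Local Notation unit_row i := (delta_mx ord0 i).

Section spaces.
Context {R : realType}.

Fixpoint is_Ck k q (f : 'rV[R]_q -> R) : Prop :=
  continuous f /\
  if k is k'.+1 then forall i : 'I_q,
    (forall x, derivable f x (unit_row i)) /\ is_Ck k' ('D_(unit_row i) f)
  else True.

Definition is_smooth q (f : 'rV[R]_q -> R) := forall k, is_Ck k f.

(* Near each boundary point, Omega is the negativity set of a smooth function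
   with nonvanishing gradient. *)
Definition smooth_bounded_open q (Omega : set 'rV[R]_q) :=
  [/\ open Omega, bounded_set Omega &
    forall x, closure Omega x -> ~ Omega x ->
      exists phi : 'rV[R]_q -> R,
        [/\ is_smooth phi, (exists i, 'D_(unit_row i) phi x != 0) &
            \forall y \near x, Omega y <-> phi y < 0]].

Definition test_function q (D : set 'rV[R]_q) (phi : 'rV[R]_q -> R) :=
  let supp := closure [set x | phi x != 0] in
  [/\ is_smooth phi, compact supp & supp `<=` D].

Definition square_integrable q (D : set 'rV[R]_q) (rho u : 'rV[R]_q -> R) :=
  measurable_fun D u /\
  (\int[lebesgue_row q]_(x in D) (u x ^+ 2 * rho x)%:E < +oo)%E.

Definition weak_partial q (D : set 'rV[R]_q) (u : 'rV[R]_q -> R) (i : 'I_q)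
    (h : 'rV[R]_q -> R) :=
  square_integrable D (cst 1) h /\
  forall phi, test_function D phi ->
    \int[lebesgue_row q]_(x in D) (u x * 'D_(unit_row i) phi x) =
    - \int[lebesgue_row q]_(x in D) (h x * phi x).

Definition H1 q (D : set 'rV[R]_q) (u : 'rV[R]_q -> R) :=
  square_integrable D (cst 1) u /\ forall i, exists h, weak_partial D u i h.

(* A representative of the weak derivative, unique up to a null set; the zero
   function if there is no weak derivative. *)
Definition wderiv q (D : set 'rV[R]_q) (i : 'I_q) (u : 'rV[R]_q -> R)
  : 'rV[R]_q -> R := xget (cst 0) (weak_partial D u i).

Definition coord q k (U : 'rV[R]_q -> 'rV[R]_k) (i : 'I_k) : 'rV[R]_q -> R :=
  fun x => U x ord0 i.

Definition L2_real q k (D : set 'rV[R]_q) (rho : 'rV[R]_q -> R)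
    (U : 'rV[R]_q -> 'rV[R]_k) :=
  forall i, square_integrable D rho (coord U i).

Definition L2_dot q k (D : set 'rV[R]_q) (rho : 'rV[R]_q -> R)
    (U V : 'rV[R]_q -> 'rV[R]_k) : R :=
  \int[lebesgue_row q]_(x in D) ((\sum_i coord U i x * coord V i x) * rho x).

Definition re_part q k (U : 'rV[R]_q -> 'rV[R[i]]_k) : 'rV[R]_q -> 'rV[R]_k :=
  fun x => map_mx (@complex.Re R) (U x).
Definition im_part q k (U : 'rV[R]_q -> 'rV[R[i]]_k) : 'rV[R]_q -> 'rV[R]_k :=
  fun x => map_mx (@complex.Im R) (U x).

End spaces.

(* A Hilbert space of classes of functions is represented by its set of
   representatives [carrier] inside a vector space of functions; two
   representatives at distance 0 denote the same element. *)
Record hspace (R : realType) (V : lmodType R[i]) :=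
  HSpace { carrier : set V ; hnorm : V -> R }.

Section operators.
Context {R : realType} {V : lmodType R[i]}.
Implicit Types (H : hspace V) (A : V -> V -> Prop) (z : R[i]).

(* [A u f] reads: u is in the domain of A, and A u = f. Thus [resolves A z f u]
   reads (A - z) u = f. *)
Definition resolves A z (f u : V) := A u (f + z *: u).

(* The estimate applied to f = 0 gives the injectivity of A - z. *)
Definition resolvent_set H A : set R[i] :=
  [set z | (forall f, carrier H f -> exists u, resolves A z f u) /\
     exists M : R, forall f u, carrier H f -> resolves A z f u ->
       hnorm H u <= M * hnorm H f].

Definition spectrum H A : set R[i] := ~` resolvent_set H A.

(* the eigenspace of A at lam has complex dimension m *)
Definition has_multiplicity H A (lam : R[i]) (m : nat) :=
  exists e : 'I_m -> V,
    [/\ forall i, A (e i) (lam *: e i),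
        forall c : 'I_m -> R[i],
          hnorm H (\sum_i c i *: e i) = 0 -> forall i, c i = 0 &
        forall u, A u (lam *: u) ->
          exists c : 'I_m -> R[i], hnorm H (u - \sum_i c i *: e i) = 0].

Definition jordan_curve (gam : R -> R[i]) :=
  [/\ {within `[0, 1], continuous (fun s => complex.Re (gam s))},
      {within `[0, 1], continuous (fun s => complex.Im (gam s))},
      gam 0 = gam 1 & {in `[0, 1[ &, injective gam}].

Definition curve_image (gam : R -> R[i]) : set R[i] := gam @` `[0, 1].

(* the points whose component in the complement of the curve is bounded;
   the plane is R * R *)
Definition inside (gam : R -> R[i]) : set R[i] :=
  [set z | ~ curve_image gam z /\
     bounded_set (connected_component
       [set p : R * R | ~ curve_image gam (Complex p.1 p.2)]
       (complex.Re z, complex.Im z))].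

Definition tagged_partition (n : nat) (s xi : nat -> R) (eta : R) :=
  [/\ s 0%N = 0, s n = 1 & forall j, (j < n)%N ->
    [/\ s j <= xi j, xi j <= s j.+1 & s j.+1 - s j < eta]].

(* P = 1/(2 pi i) times the integral of (A - z)^-1 dz along gam, as a limit in
   operator norm of Riemann-Stieltjes sums; [r j] is the value at f of the
   resolvent at gam (xi j). *)
Definition is_resolvent_integral H A (gam : R -> R[i]) (P : V -> V) :=
  [/\ curve_image gam `<=` resolvent_set H A,
      forall f, carrier H f -> carrier H (P f) &
      forall eps : R, 0 < eps -> exists2 eta : R, 0 < eta &
        forall n s xi, tagged_partition n s xi eta ->
        forall f (r : nat -> V), carrier H f ->
          (forall j, (j < n)%N -> resolves A (gam (xi j)) f (r j)) ->
          hnorm H ((Complex 0 (2 * pi))^-1 *: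
                     (\sum_(j < n) (gam (s j.+1) - gam (s j)) *: r j) - P f)
            <= eps * hnorm H f].

End operators.

Definition opnorm (R : realType) (V W : lmodType R[i]) (X : hspace V)
    (Y : hspace W) (T : V -> W -> Prop) : \bar R :=
  ereal_sup [set r | exists v w, [/\ carrier X v, carrier Y w, T v w,
    hnorm X v <= 1 & r = (hnorm Y w)%:E]].

Section complexification.
Context {R : realType}.

Definition L2 q k (D : set 'rV[R]_q) (rho : 'rV[R]_q -> R)
  : hspace ('rV[R]_q -> 'rV[R[i]]_k) :=
  HSpace
    [set U | L2_real D rho (re_part U) /\ L2_real D rho (im_part U)]
    (fun U => Num.sqrt (L2_dot D rho (re_part U) (re_part U) +
                        L2_dot D rho (im_part U) (im_part U))).

Definition complexified q k
    (A : ('rV[R]_q -> 'rV[R]_k) -> ('rV[R]_q -> 'rV[R]_k) -> Prop)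
    (U F : 'rV[R]_q -> 'rV[R[i]]_k) :=
  A (re_part U) (re_part F) /\ A (im_part U) (im_part F).

End complexification.

Section reissner_mindlin.
Context {R : realType}.
Variables (t E k sigma kappa : R).
Context {q : nat}.
Variables (D : set 'rV[R]_q) (rho : 'rV[R]_q -> R).

(* The unknown U = (beta, w) has the q components of beta first. *)
Implicit Types U V F : 'rV[R]_q -> 'rV[R]_(q + 1).

Definition rot U (i : 'I_q) : 'rV[R]_q -> R := coord U (lshift 1 i).
Definition defl U : 'rV[R]_q -> R := coord U (rshift q ord0).

Definition strain U (i j : 'I_q) (x : 'rV[R]_q) : R :=
  2^-1 * (wderiv D j (rot U i) x + wderiv D i (rot U j) x).

Definition divergence U (x : 'rV[R]_q) : R := \sum_i wderiv D i (rot U i) x.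

Definition shear U (i : 'I_q) (x : 'rV[R]_q) : R :=
  wderiv D i (defl U) x - rot U i x.

Definition rm_form U V : R :=
  \int[lebesgue_row q]_(x in D)
    ((E / (12 * (1 - sigma ^+ 2)) *
        ((1 - sigma) * (\sum_i \sum_j strain U i j x * strain V i j x) +
         kappa * (divergence U x * divergence V x)) +
      E * k / (2 * (1 + sigma) * t ^+ 2) *
        (\sum_i shear U i x * shear V i x) +
      t ^+ 2 / 12 * (\sum_i rot U i x * rot V i x) +
      defl U x * defl V x) * rho x).

(* The operator associated with rm_form on (H^1)^(q+1) in L^2(D; rho dx), in
   the sense of the representation theorem for closed quadratic forms: its
   domain consists of the U in (H^1)^(q+1) for which V |-> rm_form U V is
   represented by some F in L^2. *)
Definition rm_operator U F :=
  [/\ forall i, H1 D (coord U i), L2_real D rho F &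
      forall V, (forall i, H1 D (coord V i)) -> rm_form U V = L2_dot D rho F V].

End reissner_mindlin.

Section thin_domains.
Context {R : realType} {n d : nat}.
Implicit Types (Omega : set 'rV[R]_n).

(* The point (x, y) of R^n * R^d is row_mx x y. *)

(* The norms are the library's max norms; they are equivalent to the Euclidean
   ones, which does not affect the bi-Lipschitz property. *)
Definition bilipschitz p q (A : set 'rV[R]_p) (B : set 'rV[R]_q)
    (f : 'rV[R]_p -> 'rV[R]_q) :=
  f @` A = B /\ exists K : R, K.-lipschitz_A f /\
    forall x y, A x -> A y -> `|x - y| <= K * `|f x - f y|.

Definition unit_ball : set 'rV[R]_d := [set y | \sum_i y ord0 i ^+ 2 < 1].

Definition slice (D : set 'rV[R]_(n + d)) (x : 'rV[R]_n) : set 'rV[R]_d :=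
  [set y | D (row_mx x y)].

Definition slice_volume (D : set 'rV[R]_(n + d)) (x : 'rV[R]_n) : R :=
  fine (lebesgue_row d (slice D x)).

Definition thin_domain Omega (Omega1 : set 'rV[R]_(n + d)) :=
  [/\ smooth_bounded_open Omega,
      exists L : 'rV[R]_n -> 'rV[R]_d -> 'rV[R]_d,
        (forall x, Omega x -> bilipschitz unit_ball (slice Omega1 x) (L x)) /\
        bilipschitz [set z | Omega (lsubmx z) /\ unit_ball (rsubmx z)] Omega1
          (fun z => row_mx (lsubmx z) (L (lsubmx z) (rsubmx z))),
      [lipschitz (slice_volume Omega1 x : R^o) | x in Omega] &
      exists2 c0 : R, 0 < c0 & forall x, Omega x -> c0 <= slice_volume Omega1 x].

Definition Omega_ (Omega1 : set 'rV[R]_(n + d)) (delta : R)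
  : set 'rV[R]_(n + d) :=
  [set row_mx (lsubmx z) (delta *: rsubmx z) | z in Omega1].

Definition average (D : set 'rV[R]_(n + d)) (f : 'rV[R]_(n + d) -> R)
    (x : 'rV[R]_n) : R :=
  (slice_volume D x)^-1 *
    \int[lebesgue_row d]_(y in slice D x) f (row_mx x y).

Definition zero_average Omega (D : set 'rV[R]_(n + d))
    (f : 'rV[R]_(n + d) -> R) :=
  {ae lebesgue_row n, forall x, Omega x -> average D f x = 0}.

Definition H_0 Omega (Omega1 : set 'rV[R]_(n + d))
  : hspace ('rV[R]_n -> 'rV[R[i]]_(n + 1)) :=
  L2 _ Omega (slice_volume Omega1).

Definition L2_delta (Omega1 : set 'rV[R]_(n + d)) (delta : R)
  : hspace ('rV[R]_(n + d) -> 'rV[R[i]]_(n + d + 1)) :=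
  L2 _ (Omega_ Omega1 delta) (cst (delta ^- d)).

(* L^2_0 is closed under scaling, so the factor delta in delta L^2_0 changes
   neither the space nor the norm, which is that of L^2. *)
Definition H_delta Omega (Omega1 : set 'rV[R]_(n + d)) (delta : R)
  : hspace ('rV[R]_(n + d) -> 'rV[R[i]]_(n + d + 1)) :=
  let zero U := forall j : 'I_d,
    zero_average Omega (Omega_ Omega1 delta)
      (fun z => delta^-1 * coord U (lshift 1 (rshift n j)) z) in
  HSpace [set U | [/\ carrier (L2_delta Omega1 delta) U,
                      zero (re_part U) & zero (im_part U)]]
         (hnorm (L2_delta Omega1 delta)).

(* The div-div coefficient is sigma on the thin domain and
   (1 - sigma) sigma / ((1 - sigma) + d sigma) in the limit. *)
Definition A_delta (t E k sigma : R) (Omega1 : set 'rV[R]_(n + d))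
    (delta : R) :=
  complexified
    (rm_operator t E k sigma sigma (Omega_ Omega1 delta) (cst (delta ^- d))).

Definition A_0 (t E k sigma : R) Omega (Omega1 : set 'rV[R]_(n + d)) :=
  complexified
    (rm_operator t E k sigma ((1 - sigma) * sigma / ((1 - sigma) + d%:R * sigma))
       Omega (slice_volume Omega1)).

Definition connecting (u : 'rV[R]_n -> 'rV[R[i]]_(n + 1))
  : 'rV[R]_(n + d) -> 'rV[R[i]]_(n + d + 1) :=
  fun z => row_mx (row_mx (lsubmx (u (lsubmx z))) 0) (rsubmx (u (lsubmx z))).

End thin_domains.

(* Main.v *)
(* Write B = A_delta^-1. If f0 lies in the lambda_0-eigenspace of A_0, the
   hypothesis on omega says that B (E f0) is within omega |f0| of
   lambda_0^-1 E f0, and E is an isometry. Fix i. The eigenvalues different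
   from lambda_i, counted with multiplicity, number less than m, so some f0 <> 0
   in the m-dimensional lambda_0-eigenspace makes E f0 orthogonal to all their
   eigenvectors. On the orthogonal complement of these eigenvectors, lambda_i^-1
   is the point of the spectrum of B closest to lambda_0^-1, hence
   |lambda_i^-1 - lambda_0^-1| <= omega and |lambda_i - lambda_0| <= 2
   lambda_0^2 omega. The supremum is bounded away from 0 because P is bounded
   and E is an isometry.

   The spectral theorem is replaced by an elementary argument: if B - mu is
   bounded below for every |mu| < h, the best constant s in
   s |u|^2 <= |B u|^2 is at least h^2. *)
Require Import Defs.
From HB Require Import structures.
From mathcomp Require Import all_boot all_order all_algebra.
From mathcomp Require Import all_classical all_reals all_analysis.
From mathcomp Require Import complex.
From mathcomp Require Import measurable_realfun.
From mathcomp Require Import ring lra.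
Set Implicit Arguments.
Unset Strict Implicit.
Unset Printing Implicit Defensive.
Import Order.TTheory GRing.Theory Num.Theory.
Import numFieldNormedType.Exports.
Import ComplexField.Normc.
Local Open Scope classical_set_scope.
Local Open Scope ring_scope.

Local Notation coord := Defs.coord.
Local Notation rot := Defs.rot.

(** * Symmetric operators *)

(** The operators are relations between representatives, given by their forms alone. No
    representation theorem is applied to the forms: self-adjointness and invertibility both follow
    from symmetry, coercivity and one real point of the resolvent set. The curve supplies that
    point, because its interior contains a real interval around lambda_0 in which only finitely many
    points can be spectral.

    The obstacle lies in the restriction to an orthogonal complement. The lower bounds for B - mu
    come from resolvents on the whole space and fail at the removed eigenvalues mu_j, so an isolated
    spectral point must be shown to disappear on the complement of its eigenspace. With D = B - mu_j
    and D - x bounded below for 0 < |x| < e, the best-constant argument is applied to D^2 - e^2/2: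
    the window of radius e^2/2 around this centre avoids the value 0, and the outcome is a gap e on
    the range of D.

    The forms have real coefficients and the eigenvalues are real, so the Hilbert space arguments
    run in real spaces modulo null functions. Complex scalars matter only in the choice of f0 and in
    P. *)

Lemma discriminant_le (R : realFieldType) (p q r : R) : 0 <= r ->
  (forall a, 0 <= p + 2 * a * q + a ^+ 2 * r) -> q ^+ 2 <= p * r.
Proof.
move=> r0 H.
have [r00|rn0] := eqVneq r 0.
  have [->|q0] := eqVneq q 0; first by rewrite r00 expr0n mulr0.
  (* For [r = 0] the polynomial is affine in [a], and it takes the value -1 at this point. *)
  have := H (- (p + 1) / (2 * q)); rewrite r00.
  have -> : p + 2 * (- (p + 1) / (2 * q)) * q +
    (- (p + 1) / (2 * q)) ^+ 2 * 0 = -1 by field.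
  by lra.
have rp : 0 < r by rewrite lt_def rn0.
have := H (- q / r).
have -> : p + 2 * (- q / r) * q + (- q / r) ^+ 2 * r = (p * r - q ^+ 2) / r.
  by field.
by rewrite pmulr_lge0 ?invr_gt0// subr_ge0.
Qed.

Section symmetric_operators.
Variables (R : realType) (T : lmodType R) (ip : T -> T -> R).
Hypothesis ipC : forall u v, ip u v = ip v u.
Hypothesis ipDl : forall u v w, ip (u + v) w = ip u w + ip v w.
Hypothesis ipZl : forall a u w, ip (a *: u) w = a * ip u w.
Hypothesis ip_ge0 : forall u, 0 <= ip u u.
Hypothesis ip_eq0 : forall u, ip u u = 0 -> u = 0.

Local Notation sq u := (ip u u).

Lemma ipDr u v w : ip u (v + w) = ip u v + ip u w.
Proof. by rewrite ipC ipDl !(ipC u). Qed.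

Lemma ipZr a u w : ip u (a *: w) = a * ip u w.
Proof. by rewrite ipC ipZl ipC. Qed.

Lemma ipNl u w : ip (- u) w = - ip u w.
Proof. by rewrite -scaleN1r ipZl mulN1r. Qed.

Lemma ipNr u w : ip u (- w) = - ip u w.
Proof. by rewrite -scaleN1r ipZr mulN1r. Qed.

Definition ipE := (ipDl, ipDr, ipZl, ipZr, ipNl, ipNr).

Lemma ip0l w : ip 0 w = 0.
Proof. by rewrite -(scale0r 0) ipZl mul0r. Qed.

Lemma ip_ext u v : (forall w, ip u w = ip v w) -> u = v.
Proof.
move=> uv; apply/eqP; rewrite -subr_eq0; apply/eqP/ip_eq0.
by rewrite ipDl ipNl uv subrr.
Qed.

Lemma cauchy_schwarz u v : ip u v ^+ 2 <= sq u * sq v.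
Proof.
apply: discriminant_le => // a.
rewrite (_ : _ + _ = sq (u + a *: v)) ?ip_ge0// !ipE (ipC v u).
by rewrite expr2; ring.
Qed.

Lemma sq_add u v : sq (u + v) <= 2 * sq u + 2 * sq v.
Proof.
have := ip_ge0 (u - v); rewrite !ipE (ipC v u); lra.
Qed.

(** Symmetry of an everywhere defined map. Since [ip] is definite, it forces linearity, as the next
    lemmas show. The constants in [bounded_by] and [bounded_below] refer to squared norms. *)
Definition self_adjoint (G : T -> T) := forall u v, ip (G u) v = ip u (G v).
Definition bounded_by (N : R) (G : T -> T) := forall u, sq (G u) <= N * sq u.

Lemma self_adjointD G u v : self_adjoint G -> G (u + v) = G u + G v.
Proof. by move=> sG; apply: ip_ext => w; rewrite sG !ipDl !sG. Qed.

Lemma self_adjointZ G a u : self_adjoint G -> G (a *: u) = a *: G u.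
Proof. by move=> sG; apply: ip_ext => w; rewrite sG !ipZl !sG. Qed.

Lemma self_adjointN G u : self_adjoint G -> G (- u) = - G u.
Proof. by move=> sG; rewrite -scaleN1r self_adjointZ// scaleN1r. Qed.

Lemma self_adjointB G u v : self_adjoint G -> G (u - v) = G u - G v.
Proof. by move=> sG; rewrite self_adjointD// self_adjointN. Qed.

Lemma self_adjoint0 G : self_adjoint G -> G 0 = 0.
Proof. by move=> sG; rewrite -(scale0r 0) self_adjointZ// !scale0r. Qed.

Lemma self_adjoint_shift G x : self_adjoint G -> self_adjoint (fun u => G u - x *: u).
Proof. by move=> sG u v; rewrite !ipE sG. Qed.

Lemma self_adjoint_sq G : self_adjoint G -> self_adjoint (G \o G).
Proof. by move=> sG u v /=; rewrite !sG. Qed.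

Lemma bounded_shift N G x : bounded_by N G ->
  bounded_by (2 * N + 2 * x ^+ 2) (fun u => G u - x *: u).
Proof.
move=> bG u; apply: (le_trans (sq_add _ _)); rewrite !ipE.
by have := bG u; rewrite expr2; nra.
Qed.

Lemma bounded_sq N G : 0 <= N -> bounded_by N G -> bounded_by (N ^+ 2) (G \o G).
Proof.
move=> N0 bG u /=; apply: (le_trans (bG _)).
by rewrite expr2 -mulrA ler_wpM2l.
Qed.

Definition submodule (K : set T) :=
  forall a u v, K u -> K v -> K (u + a *: v).

Definition bounded_below (K : set T) (G : T -> T) :=
  exists2 kappa : R, 0 < kappa & forall u, K u -> kappa * sq u <= sq (G u).

(** The operator factors as (G - r)(G + r); since [K] is stable under the second factor, the two
    lower bounds multiply. *)
Lemma bounded_below_factor (K : set T) (G : T -> T) r :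
  submodule K -> (forall u, K u -> K (G u)) -> self_adjoint G ->
  bounded_below K (fun u => G u - r *: u) ->
  bounded_below K (fun u => G u - (- r) *: u) ->
  bounded_below K (fun u => G (G u) - r ^+ 2 *: u).
Proof.
move=> Kmod KG sG [k1 k10 H1] [k2 k20 H2].
exists (k1 * k2) => [|u Ku]; first exact: mulr_gt0.
have KGr : K (G u - (- r) *: u).
  by rewrite -scaleNr; apply: Kmod => //; exact: KG.
have := H1 _ KGr.
have -> : G (G u - - r *: u) - r *: (G u - - r *: u) = G (G u) - r ^+ 2 *: u.
  rewrite (self_adjointB _ _ sG) (self_adjointZ _ _ sG) scalerBr scalerA
    mulrN -expr2 !scaleNr !opprK.
  by rewrite opprD addrA -(addrA _ (r *: G u)) subrr addr0.
by apply: le_trans; rewrite -mulrA ler_pM2l//; exact: H2.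
Qed.

(* If the best constant [s] were less than [h ^+ 2], [M := G^2 - s] would be
   nonnegative and bounded below, and Cauchy-Schwarz for the form <M u, v> would
   bound <M u, u> from below, so that [s] could be increased. *)
Lemma spectral_gap (K : set T) (G : T -> T) (N h : R) :
  submodule K -> (forall u, K u -> K (G u)) ->
  self_adjoint G -> bounded_by N G -> 0 <= h ->
  (forall x, `|x| < h -> bounded_below K (fun u => G u - x *: u)) ->
  forall u, K u -> h ^+ 2 * sq u <= sq (G u).
Proof.
move=> Kmod KG sG bG h0 bel.
(* A nonzero vector is needed to bound the set [A] below from above. *)
have [[u0 [Ku0 u00]]|noK] := pselect (exists u, K u /\ u <> 0); last first.
  move=> u Ku; have -> : u = 0 by apply: contrapT => u0; apply: noK; exists u.
  by rewrite self_adjoint0// ip0l mulr0.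
have sq0 : 0 < sq u0.
  by rewrite lt_def ip_ge0 andbT; apply/eqP => /ip_eq0.
have N0 : 0 <= N.
  by have := bG u0; have := ip_ge0 (G u0); nra.
pose A := [set s : R | forall u, K u -> s * sq u <= sq (G u)].
have A0 : A 0 by move=> u _; rewrite mul0r.
have hA : has_sup A.
  split; first by exists 0.
  exists N => s /(_ _ Ku0) H; have := bG u0; nra.
pose s := sup A.
have s0 : 0 <= s by apply: ub_le_sup => //; exact: hA.2.
have As : A s.
  move=> u Ku; have [->|un0] := eqVneq u 0; first by rewrite ip0l mulr0.
  have squ : 0 < sq u.
    by rewrite lt_def ip_ge0 andbT; apply: contra_neq un0 => /ip_eq0.
  rewrite -ler_pdivlMr//; apply: ge_sup; first by exists 0.
  by move=> x Ax; rewrite ler_pdivlMr//; apply: Ax.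
suff hs : h ^+ 2 <= s.
  move=> u Ku; apply: le_trans (As _ Ku); exact: ler_wpM2r.
rewrite leNgt; apply/negP => sh.
pose r := Num.sqrt s.
have rr : r ^+ 2 = s by rewrite sqr_sqrtr.
have r0 : 0 <= r by exact: sqrtr_ge0.
have rh : r < h.
  by rewrite -(ltr_pXn2r (n := 2)) ?nnegrE// rr.
have [k k0 Hk] := bounded_below_factor Kmod KG sG
  (bel r ltac:(by rewrite ger0_norm)) (bel (- r) ltac:(by rewrite normrN ger0_norm)).
have [M ME] : {M : T -> T | forall u, M u = G (G u) - s *: u} by eexists.
have sM : self_adjoint M.
  by move=> u v; rewrite !ME; exact: (self_adjoint_shift s (self_adjoint_sq sG)).
have KM u : K u -> K (M u).
  move=> Ku; rewrite ME -scaleNr; apply: Kmod => //; exact/KG/KG.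
have Mbel u : K u -> k * sq u <= sq (M u).
  by move=> Ku; have := Hk _ Ku; rewrite rr -ME.
have Mpos u : K u -> 0 <= ip (M u) u.
  by move=> Ku; rewrite ME !ipE sG subr_ge0; apply: As.
have Mup u : K u -> ip (M u) u <= N * sq u.
  move=> Ku; rewrite ME !ipE sG; have := bG u; have := ip_ge0 u; nra.
have Mcs u : K u -> sq (M u) <= N * ip (M u) u.
  move=> Ku.
  have : sq (M u) ^+ 2 <= ip (M u) u * ip (M (M u)) (M u).
    apply: discriminant_le; first by apply: Mpos; exact: KM.
    move=> a.
    rewrite (_ : _ + _ = ip (M (u + a *: M u)) (u + a *: M u)).
      by apply: Mpos; apply: Kmod => //; exact: KM.
    rewrite (self_adjointD _ _ sM) (self_adjointZ _ _ sM) !ipE (sM (M u) u) expr2; ring.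
  have := Mup _ (KM _ Ku); have := Mpos _ Ku; have := ip_ge0 (M u).
  set x := sq (M u); set y := ip (M u) u; set z := ip _ (M u).
  move=> x0 y0 zx xyz.
  have [x00|xp] := leP x 0; first by nra.
  rewrite -(ler_pM2l xp); rewrite expr2 in xyz.
  apply: (le_trans xyz); rewrite (mulrC y) mulrA (mulrC x N).
  exact: ler_wpM2r.
have Np : 0 < N + 1 by lra.
(* The increment comes from k |u|^2 <= |M u|^2 <= N <M u, u>; adding 1 keeps the denominator
   positive when [N] is 0. *)
pose e := k / (N + 1).
have ep : 0 < e by rewrite divr_gt0.
have : A (s + e).
  move=> u Ku.
  have h1 := Mbel _ Ku; have h2 := Mcs _ Ku; have h3 := Mpos _ Ku.
  have h4 : e * sq u <= ip (M u) u.
    rewrite /e mulrAC ler_pdivrMr//; apply: (le_trans h1); nra.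
  rewrite mulrDl -lerBrDl; apply: (le_trans h4).
  by rewrite ME !ipE sG.
move=> /(ub_le_sup hA.2); rewrite -/s; lra.
Qed.

(** Completeness is asked only for geometrically decreasing squared increments. Gradient descent
    produces such sequences, and the rate allows a pointwise limit in L2 without extraction of
    subsequences. *)
Hypothesis ip_complete : forall (w : nat -> T) (C q : R), 0 <= q < 1 ->
  (forall n, sq (w n.+1 - w n) <= C * q ^+ n) ->
  exists x, (fun n => sq (w n - x)) @ \oo --> (0 : R).

Lemma cvg_ip0 (e : nat -> T) v : (fun n => sq (e n)) @ \oo --> (0 : R) ->
  (fun n => ip v (e n)) @ \oo --> (0 : R).
Proof.
move=> e0; apply/norm_cvg0P.
have s0 : (fun n => Num.sqrt (sq v * sq (e n))) @ \oo --> (0 : R).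
  rewrite -(sqrtr0 R); apply: (@cvg_comp _ _ _ _ Num.sqrt _ (nbhs (0 : R))).
    by rewrite -(mulr0 (sq v)); apply: cvgMl_tmp.
  exact: sqrt_continuous.
apply: (squeeze_cvgr _ (@cvg_cst _ (0 : R) _ _ _) s0).
apply: nearW => n; rewrite normr_ge0/= -sqrtr_sqr ler_sqrt ?cauchy_schwarz//.
exact: mulr_ge0.
Qed.

(* [w] is the projection of [u] onto the closure of the range of [D], reached by
   gradient descent for |u - D x|^2. *)
Lemma range_projection (N c : R) (D : T -> T) :
  self_adjoint D -> bounded_by N D -> 0 < c ->
  (forall v, c * sq (D v) <= sq (D (D v))) ->
  forall u, exists w, D w = D u /\
    exists (x : nat -> T) (C q : R),
     [/\ 0 <= q < 1, forall n, sq (D (x n.+1 - x n)) <= C * q ^+ n &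
         (fun n => sq (D (x n) - w)) @ \oo --> (0 : R)].
Proof.
move=> sD bD c0 Dc u.
(* Enlarging [N] ensures c <= N', so that the contraction factor 1 - c / N' below lies in [0, 1) for
   the step size 1 / N'. *)
pose N' := `|N| + c.
have N'c : c <= N' by rewrite lerDr.
have N'0 : 0 < N' by exact: lt_le_trans N'c.
have bD' : bounded_by N' D.
  move=> v; apply: (le_trans (bD v)); apply: ler_wpM2r => //.
  by rewrite (le_trans (ler_norm N))// lerDl ltW.
pose a := N'^-1.
have a0 : 0 < a by rewrite invr_gt0.
have sE := self_adjoint_sq sD.
pose q := 1 - a * c.
have q01 : 0 <= q < 1.
  rewrite /q subr_ge0 mulrC ler_pdivrMr// mul1r N'c /=.
  by rewrite ltrBlDr ltrDl mulr_gt0.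
pose x := fix x n := if n is n'.+1 then x n' + a *: D (u - D (x n')) else 0.
pose d n := u - D (x n).
have xS n : x n.+1 - x n = a *: D (d n) by rewrite /= addrC addKr.
have dS n : d n.+1 = d n - a *: D (D (d n)).
  rewrite {1}/d (_ : x n.+1 = x n + a *: D (d n)) //.
  by rewrite (self_adjointD (x n) _ sD) (self_adjointZ _ _ sD) opprD addrA.
(* Up to the factor [a] this vector is the increment of [D (x n)]. With y = D (d n), expanding the
   square gives at most |D y|^2 - a |D D y|^2, since a |D z|^2 <= |z|^2; then [Dc y] applies. *)
have step n : sq (D (D (d n.+1))) <= q * sq (D (D (d n))).
  rewrite dS (self_adjointB _ _ sD) (self_adjointB _ _ sD) !(self_adjointZ _ _ sD).
  set y := D (d n).
  have h1 := Dc y; have h2 := bD' (D (D y)).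
  rewrite !ipE [ip (D y) (D (D (D y)))]ipC [ip (D (D (D y))) _]sD.
  have h3 : a ^+ 2 * sq (D (D (D y))) <= a * sq (D (D y)).
    rewrite expr2 -mulrA ler_pM2l// /a mulrC ler_pdivrMr// mulrC; exact: h2.
  have : a * c * sq (D y) <= a * sq (D (D y)) by rewrite -mulrA ler_pM2l.
  rewrite /q; move: h3; rewrite expr2; lra.
have geo n : sq (D (D (d n))) <= sq (D (D (d 0%N))) * q ^+ n.
  elim: n => [|n IH]; first by rewrite expr0 mulr1.
  apply: (le_trans (step n)); rewrite exprS mulrCA ler_wpM2l//; lra.
pose C := a ^+ 2 * sq (D (D (d 0%N))).
have geox n : sq (D (x n.+1 - x n)) <= C * q ^+ n.
  rewrite xS (self_adjointZ _ _ sD) !ipE mulrA -expr2 /C -mulrA.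
  by rewrite ler_wpM2l// ?sqr_ge0.
have geow n : sq (D (x n.+1) - D (x n)) <= C * q ^+ n.
  by rewrite -(self_adjointB _ _ sD).
have [w Hw] := ip_complete q01 geow.
have cvgd : (fun n => sq (D (D (d n)))) @ \oo --> (0 : R).
  have H0 := @cvg_geometric R (sq (D (D (d 0%N)))) q ltac:(rewrite ger0_norm; lra).
  apply: (squeeze_cvgr _ (@cvg_cst _ (0 : R) _ _ _) H0).
  by apply: nearW => n; rewrite ip_ge0 geo.
exists w; split; last by exists x, C, q.
have EW : sq (D (D (u - w))) = 0.
  apply/eqP; rewrite eq_le ip_ge0 andbT.
  have : (fun n => 2 * sq (D (D (d n))) + 2 * (N' * (N' * sq (D (x n) - w))))
      @ \oo --> (0 : R).
    rewrite -[in X in _ --> X](addr0 0) -[in X in _ --> X](mulr0 2).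
    apply: cvgD; first exact: cvgMl_tmp.
    apply: cvgMl_tmp.
    rewrite -(mulr0 N'); apply: cvgMl_tmp.
    by rewrite -[in X in _ --> X](mulr0 N'); apply: cvgMl_tmp.
  move=> /(ler_cvg_to (@cvg_cst _ (sq (D (D (u - w)))) _ _ _)); apply.
  apply: nearW => n.
  have -> : u - w = d n + (D (x n) - w) by rewrite /d addrA subrK.
  rewrite 2!(self_adjointD _ _ sD); apply: (le_trans (sq_add _ _)).
  rewrite lerD2l ler_pM2l//; apply: (le_trans (bD' _)); rewrite ler_pM2l//.
have DW : sq (D (u - w)) = 0.
  by rewrite sD; move/ip_eq0: EW => ->; rewrite ipC ip0l.
by move/ip_eq0: DW; rewrite (self_adjointB _ _ sD) => /eqP; rewrite subr_eq0 => /eqP.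
Qed.

(** Injectivity identifies the projection [w] with [f]. The lower bound then transfers the geometric
    rate from [D (x n)] to [x n], whose limit is a preimage. *)
Lemma bounded_below_surjective (N : R) (D : T -> T) :
  self_adjoint D -> bounded_by N D -> bounded_below setT D ->
  forall f, exists u, D u = f.
Proof.
move=> sD bD [c c0 Hc] f.
have [w [Dw [x [C [q [q01 geo xw]]]]]] :=
  range_projection sD bD c0 (fun v => Hc (D v) I) f.
have wf : w = f.
  apply/eqP; rewrite -subr_eq0; apply/eqP/ip_eq0.
  have := Hc (w - f) I.
  rewrite (self_adjointB _ _ sD) Dw subrr ip0l pmulr_rle0// => le0.
  by apply/eqP; rewrite eq_le le0 ip_ge0.
have geo' n : sq (x n.+1 - x n) <= (c^-1 * C) * q ^+ n.
  rewrite -mulrA ler_pdivlMl//; exact: le_trans (Hc _ I) (geo n).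
have [u xu] := ip_complete q01 geo'.
exists u; apply/eqP; rewrite -subr_eq0; apply/eqP/ip_eq0/eqP.
rewrite eq_le ip_ge0 andbT.
have : (fun n => 2 * (N * sq (x n - u)) + 2 * sq (D (x n) - w)) @ \oo --> (0 : R).
  rewrite -[in X in _ --> X](addr0 0) -[in X in _ --> X](mulr0 2).
  apply: cvgD; last exact: cvgMl_tmp.
  apply: cvgMl_tmp.
  by rewrite -(mulr0 N); apply: cvgMl_tmp.
move=> /(ler_cvg_to (@cvg_cst _ (sq (D u - f)) _ _ _)); apply.
apply: nearW => n.
have -> : D u - f = D (u - x n) + (D (x n) - w).
  by rewrite (self_adjointB _ _ sD) wf addrA subrK.
apply: (le_trans (sq_add _ _)); rewrite lerD2r ler_pM2l//.
by apply: (le_trans (bD _)); rewrite -(opprB u) ipNl ipNr opprK.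
Qed.

(** For 0 < y < e^2 the operator D^2 - y factors through the square roots of y, so [spectral_gap]
    applies to D^2 - e^2/2 with radius e^2/2. Expanding the resulting inequality cancels the terms
    in |v|^2 and leaves e^2 |D v|^2 <= |D^2 v|^2, the claim on the range of [D]. A vector orthogonal
    to the kernel is a limit of vectors of the range. *)
Lemma isolated_eigenvalue (N e : R) (D : T -> T) :
  self_adjoint D -> 0 <= N -> bounded_by N D -> 0 < e ->
  (forall x, 0 < `|x| < e -> bounded_below setT (fun u => D u - x *: u)) ->
  forall u, (forall v, D v = 0 -> ip u v = 0) -> e ^+ 2 * sq u <= sq (D u).
Proof.
move=> sD N0 bD e0 bel u ku.
have e20 : 0 < e ^+ 2 by rewrite exprn_gt0.
have Dc v : e ^+ 2 * sq (D v) <= sq (D (D v)).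
  have sE := self_adjoint_sq sD.
  have := @spectral_gap setT (fun u => (D \o D) u - (e ^+ 2 / 2) *: u) _ (e ^+ 2 / 2)
    (fun _ _ _ _ _ => I) (fun _ _ => I) (self_adjoint_shift _ sE)
    (bounded_shift _ (bounded_sq N0 bD)) ltac:(lra).
  move=> /(_ _ v I) /=; rewrite !ipE.
  have -> : ip v (D (D v)) = sq (D v) by rewrite sD.
  have -> : ip (D (D v)) v = sq (D v) by rewrite sD.
  move=> H.
  have /H : forall x, `|x| < e ^+ 2 / 2 -> bounded_below setT
      (fun u => D (D u) - (e ^+ 2 / 2) *: u - x *: u).
    move=> x xe.
    pose y := e ^+ 2 / 2 + x.
    have y0 : 0 < y by rewrite /y; move: xe; rewrite ltr_norml; lra.
    have ye : y < e ^+ 2 by rewrite /y; move: xe; rewrite ltr_norml; lra.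
    have r0 : 0 < Num.sqrt y by rewrite sqrtr_gt0.
    have re : Num.sqrt y < e.
      by rewrite -(ltr_pXn2r (n := 2)) ?nnegrE ?ltW// sqr_sqrtr// ltW.
    have [k k0 Hk] := @bounded_below_factor setT D (Num.sqrt y)
      (fun _ _ _ _ _ => I) (fun _ _ => I) sD
      (bel (Num.sqrt y) ltac:(by rewrite gtr0_norm// r0))
      (bel (- Num.sqrt y) ltac:(by rewrite normrN gtr0_norm// r0)).
    exists k => // z _.
    rewrite (_ : D (D z) - _ - _ = D (D z) - y *: z); last first.
      by rewrite -addrA -opprD -scalerDl.
    by have := Hk z I; rewrite sqr_sqrtr// ltW.
  nra.
have [w [Dw [x [C [q [q01 geo xw]]]]]] := range_projection sD bD e20 Dc u.
have Dd : D (u - w) = 0 by rewrite (self_adjointB _ _ sD) Dw subrr.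
have ipwd : ip w (u - w) = 0.
  have : (fun n => ip (u - w) (D (x n) - w)) @ \oo --> (0 : R) by exact: cvg_ip0.
  have -> : (fun n => ip (u - w) (D (x n) - w)) = cst (- ip w (u - w)).
    apply/funext => n /=; rewrite ipDr ipNr -sD Dd ip0l add0r.
    by rewrite ipC.
  move=> /(cvg_lim (@Rhausdorff R)); rewrite lim_cst// => /eqP.
  by rewrite oppr_eq0 => /eqP.
(* The vector [u - w] lies in the kernel, so it is orthogonal to [u] by hypothesis and to [w] as a
   limit of the range. *)
have uw : u = w.
  apply/eqP; rewrite -subr_eq0; apply/eqP/ip_eq0.
  by rewrite {1}ipDl ipNl ipwd ku// subr0.
subst w.
(* Both sides of the inequality at [D (x n)] are expanded around [u], so that only terms in
   [D (x n) - u] have to tend to 0. *)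
have L : (fun n => e ^+ 2 * (sq u + (2 * ip u (D (x n) - u) + sq (D (x n) - u))))
    @ \oo --> e ^+ 2 * sq u.
  apply: cvgMl_tmp; rewrite -[in X in _ --> X](addr0 (sq u)).
  apply: cvgD; first exact: cvg_cst.
  rewrite -[in X in _ --> X](addr0 0); apply: cvgD => //.
  by rewrite -(mulr0 2); apply: cvgMl_tmp; exact: cvg_ip0.
have U : (fun n => sq (D u) + (2 * ip (D (D u)) (D (x n) - u) + N * sq (D (x n) - u)))
    @ \oo --> sq (D u).
  rewrite -[in X in _ --> X](addr0 (sq (D u))).
  apply: cvgD; first exact: cvg_cst.
  rewrite -[in X in _ --> X](addr0 0); apply: cvgD => //.
    by rewrite -(mulr0 2); apply: cvgMl_tmp; exact: cvg_ip0.
  by rewrite -[in X in _ --> X](mulr0 N); apply: cvgMl_tmp.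
apply: (ler_cvg_to L U); apply: nearW => n.
have := Dc (x n); have [z zE] : {z | z = D (x n) - u} by eexists.
rewrite -zE (_ : D (x n) = u + z); last by rewrite zE addrC subrK.
rewrite (self_adjointD _ _ sD) !ipE (ipC z u) (ipC (D z) (D u)) -(sD (D u) z).
by have := bD z; lra.
Qed.

(** [spectral_gap] for B - mu0 on the space [K] of vectors orthogonal to the eigenvectors with
    eigenvalue different from [mu i], with radius the distance from [mu i] to [mu0]. A point closer
    to [mu0] is either no [mu j], where [bel] applies, or some [mu j] different from [mu i], where
    [isolated_eigenvalue] applies. *)
Lemma eigenvalue_distance (N h0 mu0 : R) (m : nat) (mu : 'I_m -> R) (B : T -> T)
    (i : 'I_m) (w : T) :
  self_adjoint B -> bounded_by N B ->
  (forall x, `|x - mu0| < h0 -> (forall j, x != mu j) ->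
     bounded_below setT (fun u => B u - x *: u)) ->
  `|mu i - mu0| < h0 ->
  (forall j v, mu j != mu i -> B v = mu j *: v -> ip w v = 0) ->
  `|mu i - mu0| ^+ 2 * sq w <= sq (B w - mu0 *: w).
Proof.
move=> sB bB bel mui hw.
pose K := [set u | forall j v, mu j != mu i -> B v = mu j *: v -> ip u v = 0].
have Kmod : submodule K.
  by move=> a u v Ku Kv j z ji Bz; rewrite !ipE (Ku j)// (Kv j)// mulr0 addr0.
have KB u : K u -> K (B u).
  by move=> Ku j z ji Bz; rewrite sB Bz ipZr (Ku j)// mulr0.
have Kw : K w by [].
move: w {hw} Kw.
apply: (spectral_gap (G := fun u => B u - mu0 *: u) Kmod _ (self_adjoint_shift _ sB)
  (bounded_shift mu0 bB)); [|by []|].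
  by move=> u Ku; rewrite -scaleNr; apply: Kmod => //; exact: KB.
move=> x xh.
have shiftE u : B u - mu0 *: u - x *: u = B u - (mu0 + x) *: u.
  by rewrite scalerDl opprD addrA.
have xh0 : `|mu0 + x - mu0| < h0 by rewrite addrC addKr (lt_trans xh).
have [[j jx]|nj] := pselect (exists j, mu0 + x = mu j); last first.
  have [|k k0 Hk] := bel (mu0 + x) xh0.
    by move=> j; apply/eqP => jx; apply: nj; exists j.
  by exists k => // u _; rewrite shiftE; apply: Hk.
have ji : mu j != mu i.
  by apply: contraTneq xh => ji; rewrite -ji -jx addrC addKr ltxx.
rewrite jx in xh0.
(* The punctured interval of radius [e] around [mu j] stays in the window of [bel] and meets no
   other [mu k]. *)
pose e := \big[Num.min/(h0 - `|mu j - mu0|)]_(k < m | mu k != mu j) `|mu k - mu j|.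
have e0 : 0 < e.
  apply: lt_bigmin => [|k kj]; first by rewrite subr_gt0.
  by rewrite normr_gt0 subr_eq0.
have N0 : 0 <= 2 * `|N| + 2 * mu j ^+ 2 by have := sqr_ge0 (mu j); have := normr_ge0 N; lra.
have bB' : bounded_by `|N| B.
  by move=> u; apply: (le_trans (bB u)); apply: ler_wpM2r => //; exact: ler_norm.
have bel' y : 0 < `|y| < e ->
    bounded_below setT (fun u => (B u - mu j *: u) - y *: u).
  move=> /andP[y0 ye].
  have [|k|k k0 Hk] := bel (mu j + y).
  - rewrite addrAC; apply: (le_lt_trans (ler_normD _ _)).
    by rewrite -ltrBrDl; apply: (lt_le_trans ye); exact: bigmin_le_id.
  - apply/eqP => yk; move: ye; apply/negP; rewrite -leNgt.
    have {1}-> : y = mu k - mu j by rewrite -yk addrC addKr.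
    apply: bigmin_le_cond; apply: contraTneq y0 => kj.
    have -> : y = 0 by apply: (addrI (mu j)); rewrite yk kj addr0.
    by rewrite normr0 ltxx.
  - by exists k => // u _; rewrite -addrA -opprD -scalerDl; apply: Hk.
exists (e ^+ 2); first by rewrite exprn_gt0.
move=> u Ku; rewrite shiftE jx.
apply: (isolated_eigenvalue (self_adjoint_shift _ sB) N0 (bounded_shift _ bB') e0 bel').
move=> v /eqP; rewrite subr_eq0 => /eqP; exact: Ku.
Qed.

End symmetric_operators.

(** * Semi-inner products and symmetric relations *)

(** The form may vanish on nonzero vectors, as L2 products do on null functions. Symmetry and
    positivity hold for all arguments, as they do for integrals with default values; linearity is
    limited to [dom], where integrability is available. *)
Record semi_hilbert (R : realType) (X : lmodType R) := SemiHilbert {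
  dom : set X;
  form : X -> X -> R;
  dom0 : dom 0;
  domP : forall a u v, dom u -> dom v -> dom (u + a *: v);
  formC : forall u v, form u v = form v u;
  formP : forall a u v w, dom u -> dom v -> dom w ->
    form (u + a *: v) w = form u w + a * form v w;
  form_ge0 : forall u, 0 <= form u u;
  form_complete : forall (w : nat -> X) (C q : R), (forall n, dom (w n)) ->
    0 <= q < 1 ->
    (forall n, form (w n.+1 - w n) (w n.+1 - w n) <= C * q ^+ n) ->
    exists2 x, dom x & (fun n => form (w n - x) (w n - x)) @ \oo --> (0 : R)
}.

(** * The inner product space of classes modulo null vectors *)

Section quotient.
Variables (R : realType) (X : lmodType R) (S : semi_hilbert X).
Local Notation H := (dom S).
Local Notation f := (form S).

Lemma domD u v : H u -> H v -> H (u + v).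
Proof. by move=> Hu Hv; rewrite -(scale1r v); apply: domP. Qed.

Lemma domZ a u : H u -> H (a *: u).
Proof. by move=> Hu; rewrite -[_ *: _]add0r; apply: domP => //; exact: dom0. Qed.

Lemma domB u v : H u -> H v -> H (u - v).
Proof. by move=> Hu Hv; rewrite -scaleN1r; apply: domP. Qed.

(* The class of [u] modulo vectors of norm 0 is encoded by the functional
   <u, ->, cut off to 0 outside the domain. *)
Definition functional (u : X) : X -> R^o := fun v => if `[< H v >] then f u v else 0.

Definition functionals : {pred (X -> R^o)} :=
  fun y => `[< exists2 u, H u & y = functional u >].

Lemma functionalP a u v : H u -> H v ->
  functional (u + a *: v) = functional u + a *: functional v.
Proof.
move=> Hu Hv; apply/funext => w; rewrite /functional !fctE.
by case: asboolP => Hw; [rewrite formP|rewrite scaler0 addr0].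
Qed.

Lemma functional0 : functional 0 = 0.
Proof.
have := functionalP (-1) (dom0 S) (dom0 S).
by rewrite scaler0 addr0 scaleN1r subrr.
Qed.

Lemma functionals_closed : GRing.submod_closed functionals.
Proof.
split=> [|a y z /asboolP[u Hu ->] /asboolP[v Hv ->]]; apply/asboolP.
  by exists 0; [exact: dom0|rewrite functional0].
by exists (v + a *: u); [exact: domP|rewrite functionalP// addrC].
Qed.

HB.instance Definition _ :=
  GRing.isSubmodClosed.Build R (X -> R^o) functionals functionals_closed.

Record quot := Quot { qval : X -> R^o; _ : qval \in functionals }.
HB.instance Definition _ := [isSub for qval].
HB.instance Definition _ := [Choice of quot by <:].
HB.instance Definition _ := [SubChoice_isSubLmodule of quot by <:].

Definition cls (u : X) : quot := insubd 0 (functional u).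

Lemma cls_val u : H u -> \val (cls u) = functional u.
Proof. by move=> Hu; rewrite insubdK//; apply/asboolP; exists u. Qed.

Lemma clsP a u v : H u -> H v -> cls (u + a *: v) = cls u + a *: cls v.
Proof.
move=> Hu Hv; apply: val_inj.
rewrite (cls_val (domP _ Hu Hv)) functionalP// -(cls_val Hu) -(cls_val Hv).
by rewrite linearD linearZ.
Qed.

Lemma clsD u v : H u -> H v -> cls (u + v) = cls u + cls v.
Proof. by move=> Hu Hv; rewrite -{1}(scale1r v) clsP// scale1r. Qed.

Lemma clsB u v : H u -> H v -> cls (u - v) = cls u - cls v.
Proof. by move=> Hu Hv; rewrite -{1}scaleN1r clsP// scaleN1r. Qed.

Lemma cls0 : cls 0 = 0.
Proof. by rewrite -(subrr 0) clsB ?subrr//; exact: dom0. Qed.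

Lemma clsZ a u : H u -> cls (a *: u) = a *: cls u.
Proof. by move=> Hu; rewrite -{1}[_ *: _]add0r clsP ?cls0 ?add0r//; exact: dom0. Qed.

Lemma cls_surj y : exists u, H u /\ cls u = y.
Proof.
have /asboolP[u Hu yu] : \val y \in functionals := valP y.
by exists u; split => //; apply: val_inj; rewrite cls_val.
Qed.

Definition rep y := sval (cid (cls_surj y)).

Lemma repP y : H (rep y).
Proof. by have [] := svalP (cid (cls_surj y)). Qed.

Lemma repK y : cls (rep y) = y.
Proof. by have [] := svalP (cid (cls_surj y)). Qed.

Definition ip y z := f (rep y) (rep z).

Lemma ip_cls u v : H u -> H v -> ip (cls u) (cls v) = f u v.
Proof.
have repE x w : H x -> H w -> f (rep (cls x)) w = f x w.
  move=> Hx Hw; have := congr1 (fun g => g w) (cls_val (repP (cls x))).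
  by rewrite repK (cls_val Hx) /functional asboolT.
move=> Hu Hv; rewrite /ip repE//; last exact: repP.
by rewrite formC repE// formC.
Qed.

Lemma ip_clsr y u : H u -> ip y (cls u) = f (rep y) u.
Proof. by move=> Hu; rewrite -{1}(repK y) ip_cls//; exact: repP. Qed.

Lemma ip_clsl y u : H u -> ip (cls u) y = f u (rep y).
Proof. by move=> Hu; rewrite /ip formC -/(ip y _) ip_clsr// formC. Qed.

Lemma form0 u : H u -> f 0 u = 0.
Proof.
move=> Hu; have := formP (-1) (dom0 S) (dom0 S) Hu.
by rewrite scaler0 addr0 mulN1r subrr.
Qed.

Lemma form_cauchy_schwarz u v : H u -> H v -> f u v ^+ 2 <= f u u * f v v.
Proof.
move=> Hu Hv; apply: discriminant_le => [|a]; first exact: form_ge0.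
have Huv : H (u + a *: v) by exact: domP.
rewrite (_ : _ + _ = f (u + a *: v) (u + a *: v)) ?form_ge0//.
rewrite formP// [f u (_ + _)]formC [f v (_ + _)]formC !formP// [f v u]formC expr2; ring.
Qed.

Lemma ip_sym y z : ip y z = ip z y.
Proof. by rewrite /ip formC. Qed.

Lemma ip_addl y z w : ip (y + z) w = ip y w + ip z w.
Proof.
rewrite -(repK y) -(repK z) -(repK w) -clsD; do ?exact: repP.
rewrite !ip_cls; do ?exact: repP; last by apply: domD; exact: repP.
by rewrite -{1}(scale1r (rep z)) formP ?mul1r//; exact: repP.
Qed.

Lemma ip_scalel a y w : ip (a *: y) w = a * ip y w.
Proof.
rewrite -(repK y) -(repK w) -clsZ; do ?exact: repP.
rewrite !ip_cls; do ?exact: repP; last by apply: domZ; exact: repP.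
rewrite -[_ *: _]add0r formP ?form0 ?add0r//; do ?exact: repP; exact: dom0.
Qed.

Lemma ip_nonneg y : 0 <= ip y y.
Proof. exact: form_ge0. Qed.

Lemma ip_definite y : ip y y = 0 -> y = 0.
Proof.
move=> yy0; rewrite -(repK y) -cls0; apply: val_inj.
rewrite !cls_val; [|exact: dom0|exact: repP].
apply/funext => w; rewrite /functional; case: asboolP => // Hw.
rewrite form0//; apply/eqP; rewrite -sqrf_eq0 eq_le sqr_ge0 andbT.
apply: (le_trans (form_cauchy_schwarz (repP y) Hw)).
by rewrite [f _ _]yy0 mul0r.
Qed.

Lemma cls_eqP u v : H u -> H v -> cls u = cls v <-> f (u - v) (u - v) = 0.
Proof.
move=> Hu Hv; rewrite -ip_cls ?clsB//; do ?exact: domB.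
split=> [->|/ip_definite/eqP]; first by rewrite subrr -cls0 ip_cls ?form0//; exact: dom0.
by rewrite subr_eq0 => /eqP.
Qed.

Lemma quot_complete (w : nat -> quot) (C q : R) : 0 <= q < 1 ->
  (forall n, ip (w n.+1 - w n) (w n.+1 - w n) <= C * q ^+ n) ->
  exists x, (fun n => ip (w n - x) (w n - x)) @ \oo --> (0 : R).
Proof.
move=> q01 geo.
have ipB y u : H u -> ip (y - cls u) (y - cls u) = f (rep y - u) (rep y - u).
  move=> Hu; rewrite -{1 2}(repK y) -clsB ?ip_cls//; do ?exact: repP;
  by apply: domB => //; exact: repP.
have [n|x Hx wx] := @form_complete _ _ S (rep \o w) C q (fun n => repP (w n)) q01.
  by rewrite /= -ipB ?repK//; exact: repP.
by exists (cls x); under eq_fun do rewrite ipB//.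
Qed.

End quotient.

(** * Coercive symmetric relations and their inverses *)

Section symmetric_relation.
Variables (R : realType) (X : lmodType R) (S : semi_hilbert X).
Local Notation H := (dom S).
Local Notation f := (form S).
Variables (A : X -> X -> Prop) (c : R).
Hypothesis c0 : 0 < c.
Hypothesis A_dom : forall u v, A u v -> H u /\ H v.
Hypothesis A_sym : forall u v u' v', A u v -> A u' v' -> f v u' = f u v'.
Hypothesis A_coercive : forall u v, A u v -> c * f u u <= f v u.
Hypothesis A_null : forall u v v', A u v -> H v' -> f (v - v') (v - v') = 0 -> A u v'.

(** The real counterpart of [resolvent_set], with the bound on squared norms. *)
Definition regular (z : R) :=
  (forall g, H g -> exists u, A u (g + z *: u)) /\
  exists M, forall g u, H g -> A u (g + z *: u) -> f u u <= M * f g g.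

Lemma form_lin u v w a : H u -> H v -> H w -> f (u + a *: v) w = f u w + a * f v w.
Proof. exact: formP. Qed.

Lemma form_linr u v w a : H u -> H v -> H w -> f w (u + a *: v) = f w u + a * f w v.
Proof. by move=> *; rewrite formC formP// !(formC S w). Qed.

(** A symmetric relation with a real regular point is self-adjoint. If [x] is in the domain of the
    adjoint with value [g], solve (A - z) u = g - z x: then u - x is orthogonal to the range of A -
    z, which is everything, so [u] and [x] have the same class. *)
Lemma adjoint_relation z x g : regular z -> H x -> H g ->
  (forall u v, A u v -> f x v = f g u) ->
  exists2 u, A u g & f (u - x) (u - x) = 0.
Proof.
move=> [surj _] Hx Hg xg.
have Hg1 : H (g + (- z) *: x) by exact: domP.
have [u Au] := surj _ Hg1.
have [Hu Hgu] := A_dom Au.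
have ux : cls S u = cls S x.
  apply: (ip_ext (@ip_addl _ _ S) (@ip_scalel _ _ S) (@ip_definite _ _ S)) => y.
  rewrite -(repK y); have Hh := repP y; set h := rep y in Hh *.
  rewrite !ip_cls//.
  have [v Av] := surj h Hh; have [Hv Hhv] := A_dom Av.
  have := A_sym Au Av; have := xg _ _ Av.
  rewrite !form_linr// !form_lin//; lra.
exists u; last by apply/cls_eqP.
apply: (A_null Au) => //; apply/cls_eqP => //.
by rewrite !clsP// ux -addrA scaleNr addNr addr0.
Qed.

Lemma coercive_sq u v : A u v -> c ^+ 2 * f u u <= f v v.
Proof.
move=> Auv; have [Hu Hv] := A_dom Auv.
have := A_coercive Auv; have := form_cauchy_schwarz Hv Hu.
have := form_ge0 S u; have := form_ge0 S v.
set x := f u u; set y := f v v; set z := f v u => y0 x0 zz cx.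
have [x00|xp] := leP x 0.
  by rewrite (_ : x = 0) ?mulr0//; apply/eqP; rewrite eq_le x00.
rewrite -(ler_pM2r xp); apply: le_trans zz.
have cx0 : 0 <= c * x by rewrite mulr_ge0// ltW.
by rewrite -mulrA -expr2 -exprMn lerXn2r// nnegrE (le_trans cx0).
Qed.

(** The operator D = A (A - z)^-1 = 1 + z (A - z)^-1 is bounded and self-adjoint. It is bounded
    below because y = D y - z s, where s = (A - z)^-1 y satisfies A s = D y and coercivity gives |s|
    <= |D y| / c. Hence [D] is onto, and so is [A]. *)
Lemma regular_surjective z : regular z -> forall g, H g -> exists u, A u g.
Proof.
move=> [surj [M HM]] g Hg.
have surj' (y : quot S) : exists u, A u (rep y + z *: u) by apply: surj; exact: repP.
pose s y := sval (cid (surj' y)).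
have sP y : A (s y) (rep y + z *: s y) := svalP (cid (surj' y)).
have Hs y : H (s y) by have [] := A_dom (sP y).
have Hv y : H (rep y + z *: s y) by have [] := A_dom (sP y).
pose D (y : quot S) := cls S (rep y + z *: s y).
have Hr := @repP _ _ S.
have sD : self_adjoint (@ip _ _ S) D.
  move=> y y'; rewrite /D ip_clsl// ip_clsr//.
  have := A_sym (sP y) (sP y').
  by rewrite !form_lin// !form_linr// => /addIr ->.
have M0 y : ip (cls S (s y)) (cls S (s y)) <= M * ip y y.
  by rewrite ip_cls//; apply: HM => //; exact: sP.
have bD : bounded_by (@ip _ _ S) (2 + 2 * (z ^+ 2 * M)) D.
  move=> y; rewrite /D clsP// repK.
  apply: (le_trans (sq_add (@ip_sym _ _ S) (@ip_addl _ _ S) (@ip_scalel _ _ S)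
    (@ip_nonneg _ _ S) _ _)).
  rewrite [leRHS]mulrDl lerD2l -[leRHS]mulrA ler_pM2l// ip_scalel ip_sym ip_scalel mulrA.
  by rewrite -expr2 -[leRHS]mulrA ler_wpM2l// sqr_ge0.
have k0 : 0 < 2 + 2 * (z ^+ 2 / c ^+ 2).
  by rewrite ltr_wpDr// mulr_ge0// divr_ge0// sqr_ge0.
have blD : bounded_below (@ip _ _ S) setT D.
  exists (2 + 2 * (z ^+ 2 / c ^+ 2))^-1; first by rewrite invr_gt0.
  move=> y _; rewrite ler_pdivrMl//.
  have -> : ip y y = ip (D y + (- z) *: cls S (s y)) (D y + (- z) *: cls S (s y)).
    by rewrite /D clsP// repK scaleNr addrK.
  apply: (le_trans (sq_add (@ip_sym _ _ S) (@ip_addl _ _ S) (@ip_scalel _ _ S)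
    (@ip_nonneg _ _ S) _ _)).
  rewrite [leRHS]mulrDl lerD2l -[leRHS]mulrA ler_pM2l// ip_scalel ip_sym ip_scalel mulrA.
  rewrite mulrNN -expr2 -[leRHS]mulrA ler_wpM2l ?sqr_ge0// ler_pdivlMl ?exprn_gt0//.
  by rewrite /D !ip_cls//; apply: coercive_sq; exact: sP.
have [y Dy] := bounded_below_surjective (@ip_sym _ _ S) (@ip_addl _ _ S)
  (@ip_scalel _ _ S) (@ip_nonneg _ _ S) (@ip_definite _ _ S)
  (@quot_complete _ _ S) sD bD blD (cls S g).
exists (s y); apply: (A_null (sP y)) => //.
by apply/cls_eqP.
Qed.

(** By symmetry, the products of [u] with the range of [A] depend only on the class of [v], and the
    range is everything. This makes the inverse well defined on classes. *)
Lemma relation_inj u u' v v' : (forall g, H g -> exists u, A u g) ->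
  A u v -> A u' v' -> cls S v = cls S v' -> cls S u = cls S u'.
Proof.
move=> surj Auv Auv' vv'.
have [Hu Hv] := A_dom Auv; have [Hu' Hv'] := A_dom Auv'.
apply: (ip_ext (@ip_addl _ _ S) (@ip_scalel _ _ S) (@ip_definite _ _ S)) => y.
have [x Axy] := surj _ (repP y); have [Hx _] := A_dom Axy.
rewrite -(repK y) !ip_cls//; do ?exact: repP.
by rewrite -(A_sym Auv Axy) -(A_sym Auv' Axy) -!ip_cls// vv'.
Qed.

(** [eigenvalue_distance] for the bounded inverse [B] of [A] on classes, where [U] represents the
    image of [w]. The condition on [h0] makes inversion send the window around 1/lam0 into the
    interval around lam0 where the resolvent of [A] is controlled. *)
Lemma eigenvalue_estimate (m : nat) (lam : 'I_m -> R) (lam0 rho h0 : R) (i : 'I_m)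
    (w U : X) :
  (forall g, H g -> exists u, A u g) -> (forall j, 0 < lam j) ->
  (forall z, `|z - lam0| < rho -> (forall j, z != lam j) -> regular z) ->
  (forall x, `|x - lam0^-1| < h0 -> 0 < x /\ `|x^-1 - lam0| < rho) ->
  `|(lam i)^-1 - lam0^-1| < h0 ->
  (forall j v, lam j != lam i -> A v (lam j *: v) -> f w v = 0) ->
  A U w ->
  `|(lam i)^-1 - lam0^-1| ^+ 2 * f w w <= f (U - lam0^-1 *: w) (U - lam0^-1 *: w).
Proof.
move=> surj lam_gt0 reg h0P hi wv AU.
have [HU Hw] := A_dom AU.
have surj' (y : quot S) : exists u, A u (rep y) by apply: surj; exact: repP.
pose b y := sval (cid (surj' y)).
have bP y : A (b y) (rep y) := svalP (cid (surj' y)).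
have Hb y : H (b y) by have [] := A_dom (bP y).
have Hr := @repP _ _ S.
pose B y := cls S (b y).
have BE : B (cls S w) = cls S U.
  by apply: (relation_inj surj (bP _) AU); rewrite repK.
have sB : self_adjoint (@ip _ _ S) B.
  by move=> y y'; rewrite /B ip_clsl// ip_clsr// -(A_sym (bP y) (bP y')).
have bB : bounded_by (@ip _ _ S) (c ^+ 2)^-1 B.
  move=> y; rewrite ler_pdivlMl ?exprn_gt0// /B ip_cls//.
  exact: coercive_sq (bP y).
have sqD := sq_add (@ip_sym _ _ S) (@ip_addl _ _ S) (@ip_scalel _ _ S) (@ip_nonneg _ _ S).
have sqZ a (y : quot S) : ip (a *: y) (a *: y) = a ^+ 2 * ip y y.
  by rewrite ip_scalel ip_sym ip_scalel mulrA.
have bel x : `|x - lam0^-1| < h0 -> (forall j, x != (lam j)^-1) ->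
    bounded_below (@ip _ _ S) setT (fun u => B u - x *: u).
  move=> xh xl; have [x0 xr] := h0P _ xh.
  have xn0 : x != 0 by rewrite gt_eqF.
  have [|_ [M HM]] := reg _ xr.
    by move=> j; apply: contraNneq (xl j) => <-; rewrite invrK.
  pose z := x^-1.
  have z0 : 0 < z ^+ 2 by rewrite exprn_gt0// invr_gt0.
  (* With G = B y - x y and z = 1/x, one has (A - z) B y = - z G, so the resolvent bound controls B
     y by G; then y = - z G + z B y gives |y|^2 <= k |G|^2. *)
  pose k := 2 * (z ^+ 2 * (`|M| * z ^+ 2)) + 2 * z ^+ 2.
  have k0 : 0 < k.
    apply: ltr_wpDl; last by rewrite mulr_gt0.
    by apply: mulr_ge0 => //; apply: mulr_ge0; [exact: ltW|rewrite mulr_ge0// ltW].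
  exists k^-1; first by rewrite invr_gt0.
  move=> y _; rewrite ler_pdivrMl//.
  pose G := b y + (- x) *: rep y.
  have HG : H G by exact: domP.
  have Gy : B y - x *: y = cls S G by rewrite /G clsP// repK scaleNr.
  have yE : rep y = (- z) *: G + z *: b y.
    by rewrite /G scalerDr scalerA mulrNN mulVf// scale1r addrAC scaleNr addNr add0r.
  have h1 : ip (B y) (B y) <= M * (z ^+ 2 * ip (cls S G) (cls S G)).
    rewrite -[z ^+ 2]sqrrN -sqZ -clsZ// /B !ip_cls//; try exact: domZ.
    by apply: HM; [exact: domZ|rewrite -yE].
  rewrite Gy -{1 2}(repK y) {1 2}yE clsP ?clsZ//; last exact: domZ.
  apply: (le_trans (sqD _ _)); rewrite !sqZ sqrrN addrC [leRHS]mulrDl -!(mulrA 2).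
  rewrite lerD2r ler_pM2l// -(mulrA (z ^+ 2)) ler_pM2l//.
  apply: (le_trans h1); rewrite mulrA ler_wpM2r ?ip_nonneg// ler_pM2r//.
  exact: ler_norm.
have ortho j v : (lam j)^-1 != (lam i)^-1 -> B v = (lam j)^-1 *: v ->
    ip (cls S w) v = 0.
  move=> ji Bv.
  have lj0 : lam j != 0 by rewrite gt_eqF.
  have vE : v = lam j *: B v by rewrite Bv scalerA divff// scale1r.
  rewrite vE ip_sym ip_scalel ip_sym ip_cls// (wv j) ?mulr0//.
    by apply: contra_neq ji => ->.
  (* An eigenvector class of [B] yields an eigenvector of [A] only after its image is replaced by
     another representative. *)
  apply: (A_null (bP v)); first exact: domZ.
  by apply/cls_eqP => //; [exact: domZ|rewrite repK clsZ].
have := eigenvalue_distance (@ip_sym _ _ S) (@ip_addl _ _ S) (@ip_scalel _ _ S)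
  (@ip_nonneg _ _ S) (@ip_definite _ _ S) (@quot_complete _ _ S) sB bB bel hi ortho.
rewrite BE -clsZ// -clsB//; last exact: domZ.
by rewrite !ip_cls//; apply: domB => //; exact: domZ.
Qed.

End symmetric_relation.

(** * Completeness of weighted L2 *)

(** With k = s / (1 - p), the sequences a n - k p^n and a n + k p^n are monotone in opposite
    directions, because s p^n = k (p^n - p^(n+1)). They enclose the limit, which gives the explicit
    error bound. *)
Lemma geometric_limit (R : realType) (a : nat -> R) (s p : R) : 0 < p < 1 ->
  (forall n, `|a n.+1 - a n| <= s * p ^+ n) ->
  exists l, a @ \oo --> l /\ forall n, `|l - a n| <= s / (1 - p) * p ^+ n.
Proof.
move=> /andP[p0 p1] H.
have p1' : 0 < 1 - p by rewrite subr_gt0.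
have pn0 n : 0 < p ^+ n by rewrite exprn_gt0.
pose k := s / (1 - p).
have sk : s = k * (1 - p) by rewrite /k divfK// gt_eqF.
have k0 : 0 <= k.
  have := H 0%N; rewrite expr0 mulr1 => h.
  by apply: divr_ge0; [exact: le_trans (normr_ge0 _) h|exact: ltW].
have bm : {homo (fun n => a n - k * p ^+ n) : n m / (n <= m)%N >-> n <= m}.
  apply/nondecreasing_seqP => n.
  have := H n; rewrite sk exprS ler_norml; nra.
have cm : {homo (fun n => a n + k * p ^+ n) : n m / (n <= m)%N >-> m <= n}.
  apply/nonincreasing_seqP => n.
  have := H n; rewrite sk exprS ler_norml; nra.
have bc n m : a n - k * p ^+ n <= a m + k * p ^+ m.
  have h1 := bm _ _ (leq_maxl n m); have h2 := cm _ _ (leq_maxr n m).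
  apply: (le_trans h1); apply: le_trans h2.
  by have := mulr_ge0 k0 (ltW (pn0 (maxn n m))); lra.
have ub : has_ubound (range (fun n => a n - k * p ^+ n)).
  by exists (a 0%N + k * p ^+ 0) => _ [n _ <-]; exact: bc.
have bl := nondecreasing_cvgn bm ub.
set l := sup _ in bl.
exists l; split=> [|n].
  have -> : a = (fun n => (a n - k * p ^+ n) + geometric k p n).
    by apply/funext => n; rewrite subrK.
  rewrite -[in X in _ --> X](addr0 l); apply: cvgD => //.
  by apply: cvg_geometric; rewrite ger0_norm// ltW.
have h1 : a n - k * p ^+ n <= l by apply: ub_le_sup => //; exists n.
have h2 : l <= a n + k * p ^+ n.
  by apply: ge_sup; [exists (a 0%N - k * p ^+ 0), 0%N|move=> _ [m _ <-]; exact: bc].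
by rewrite -/k ler_norml; lra.
Qed.

Section weighted_L2.
Context d (T : measurableType d) (R : realType) (mu : {measure set T -> \bar R}).
Variables (D : set T) (rho : T -> R).
Hypothesis mD : measurable D.
Hypothesis mrho : measurable_fun D rho.
Hypothesis rho_gt0 : forall x, D x -> 0 < rho x.

(** For an arbitrary measure; [square_integrable] is convertible to the instance at
    [lebesgue_row]. *)
Definition sqint (u : T -> R) :=
  measurable_fun D u /\ (\int[mu]_(x in D) (u x ^+ 2 * rho x)%:E < +oo)%E.

Lemma measurable_sq (u : T -> R) : measurable_fun D u ->
  measurable_fun D (fun x => (u x ^+ 2 * rho x)%:E : \bar R).
Proof.
move=> mu'; apply/measurable_EFinP; apply: measurable_funM => //.
exact: measurable_funX.
Qed.

Lemma sq_ge0 (u : T -> R) x : D x -> (0 <= (u x ^+ 2 * rho x)%:E)%E.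
Proof. by move=> Dx; rewrite lee_fin mulr_ge0 ?sqr_ge0// ltW// rho_gt0. Qed.

Lemma sqint_integrable u : sqint u ->
  mu.-integrable D (fun x => (u x ^+ 2 * rho x)%:E : \bar R).
Proof.
move=> [mu' u2]; apply/integrableP; split; first exact: measurable_sq.
by under eq_integral => x /[!inE] Dx do rewrite gee0_abs ?sq_ge0//.
Qed.

Lemma mul_integrable u v : sqint u -> sqint v ->
  mu.-integrable D (EFin \o (fun x => u x * v x * rho x)).
Proof.
move=> su sv.
have := integrableD mD (sqint_integrable su) (sqint_integrable sv).
apply: le_integrable => //.
  apply/measurable_EFinP; apply: measurable_funM => //.
  by apply: measurable_funM; [exact: su.1|exact: sv.1].
move=> x Dx /=; rewrite lee_fin -mulrDl !normrM.
rewrite ler_wpM2r// -normrM.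
rewrite (ger0_norm (addr_ge0 (sqr_ge0 _) (sqr_ge0 _))) ler_norml.
have := sqr_ge0 (u x + v x); have := sqr_ge0 (u x - v x).
have := sqr_ge0 (u x); have := sqr_ge0 (v x).
by rewrite sqrrB sqrrD !mulr2n; lra.
Qed.

Lemma sqint0 : sqint (fun=> 0).
Proof.
split; first exact: measurable_cst.
by under eq_integral do rewrite expr0n mul0r; rewrite integral0.
Qed.

Lemma sqintP a u v : sqint u -> sqint v -> sqint (fun x => u x + a * v x).
Proof.
move=> su sv.
have m : measurable_fun D (fun x => u x + a * v x).
  apply: measurable_funD; first exact: su.1.
  apply: measurable_funM; [exact: measurable_cst|exact: sv.1].
split=> //.
have iu := integrableZl mD 2 (sqint_integrable su).
have iv := integrableZl mD (2 * a ^+ 2) (sqint_integrable sv).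
have /integrableP[_] := integrableD mD iu iv.
apply: le_lt_trans; apply: ge0_le_integral => //.
- by move=> x Dx; exact: (sq_ge0 (fun x => u x + a * v x)).
- exact: (measurable_sq m).
- exact: (measurableT_comp _ (measurable_int mu (integrableD mD iu iv))).
move=> x Dx /=; rewrite lee_fin ger0_norm; last first.
  have := sq_ge0 u Dx; have := sq_ge0 v Dx; rewrite !lee_fin => hv hu.
  by have ha := sqr_ge0 a; apply: addr_ge0; apply: mulr_ge0 => //; apply: mulr_ge0.
rewrite (_ : 2 * _ + _ = (2 * u x ^+ 2 + 2 * a ^+ 2 * v x ^+ 2) * rho x); last by ring.
rewrite ler_wpM2r ?(ltW (rho_gt0 Dx))//.
by have := sqr_ge0 (u x - a * v x); nra.
Qed.

(** The argument of Riesz and Fischer with a rate. For q < r < 1, the sum S of the squared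
    increments weighted by r^-n and [rho] has a finite integral, bounded by a geometric series of
    ratio q / r. Where S is finite the increments are at most sqrt (S / rho) times sqrt r ^ n, so
    [geometric_limit] bounds the squared pointwise error by a multiple of S r^n / rho, and
    integration concludes. *)
Lemma sqint_complete (w : nat -> T -> R) (C q : R) : 0 <= q < 1 ->
  (forall n, measurable_fun D (w n)) ->
  (forall n, (\int[mu]_(x in D) ((w n.+1 x - w n x) ^+ 2 * rho x)%:E
              <= (C * q ^+ n)%:E)%E) ->
  exists2 u : T -> R, measurable_fun D u & exists C' : R,
    forall n, (\int[mu]_(x in D) ((w n x - u x) ^+ 2 * rho x)%:E <=
      (C' * ((1 + q) / 2) ^+ n)%:E)%E.
Proof.
move=> /andP[q0 q1] mw geo.
(* This choice is strictly between q and 1, and positive even when q is 0. *)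
have [r rE] : {r | r = (1 + q) / 2} by eexists.
rewrite -rE.
have r01 : 0 < r < 1 by rewrite rE; lra.
have [r0 r1] := andP r01.
pose p := Num.sqrt r.
have p2 : p ^+ 2 = r by rewrite sqr_sqrtr// ltW.
have p01 : 0 < p < 1.
  rewrite sqrtr_gt0 r0/= -(ltr_pXn2r (n := 2)) ?nnegrE ?sqrtr_ge0//.
  by rewrite p2 expr1n.
have [p0 p1] := andP p01.
pose s n x := (w n.+1 x - w n x) ^+ 2 * rho x.
pose g n x : \bar R := ((r ^+ n)^-1 * s n x)%:E.
have s0 n x : D x -> 0 <= s n x.
  by move=> Dx; rewrite mulr_ge0 ?sqr_ge0// ltW// rho_gt0.
have g0 n x : D x -> (0 <= g n x)%E.
  by move=> Dx; rewrite lee_fin mulr_ge0 ?s0// invr_ge0 exprn_ge0// ltW.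
have ms n : measurable_fun D (fun x => (s n x)%:E : \bar R).
  by apply: (@measurable_sq (fun x => w n.+1 x - w n x)); apply: measurable_funB.
have mg n : measurable_fun D (g n).
  rewrite (_ : g n = fun x => (((r ^+ n)^-1)%:E * (s n x)%:E)%E).
    exact: measurable_funeM.
  by apply/funext => x; rewrite -EFinM.
pose S x : \bar R := (\sum_(0 <= n <oo) g n x)%E.
have S0 x : D x -> (0 <= S x)%E.
  by move=> Dx; apply: nneseries_ge0 => n _ _; exact: g0.
have mS : measurable_fun D S.
  by apply: ge0_emeasurable_sum => // n x Dx _; exact: g0.
have IS : (\int[mu]_(x in D) S x <= (`|C| / (1 - q / r))%:E)%E.
  rewrite integral_nneseries//.
  have qr : 0 <= q / r < 1.
    by rewrite divr_ge0 ?(ltW r0)//= ltr_pdivrMr// mul1r rE; lra.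
  apply: (@le_trans _ _ (\sum_(0 <= n <oo) (geometric `|C| (q / r) n)%:E)%E).
    apply: lee_nneseries => [n _ _|n _].
      by apply: integral_ge0 => x Dx; exact: g0.
    have -> : (\int[mu]_(x in D) g n x = ((r ^+ n)^-1)%:E * \int[mu]_(x in D) (s n x)%:E)%E.
      rewrite -ge0_integralZl_EFin//.
      - by move=> x Dx; rewrite lee_fin s0.
      - by rewrite invr_ge0 exprn_ge0// ltW.
    apply: (@le_trans _ _ (((r ^+ n)^-1)%:E * (C * q ^+ n)%:E)%E).
      by rewrite lee_pmul2l// ?lte_fin ?invr_gt0 ?exprn_gt0//; exact: geo.
    rewrite -EFinM lee_fin /= expr_div_n mulrCA [_ * q ^+ n]mulrC.
    by rewrite ler_wpM2r ?ler_norm// divr_ge0 ?exprn_ge0// ltW.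
  have cv := @cvg_geometric_series R `|C| (q / r) ltac:(by rewrite ger0_norm; lra).
  rewrite le_eqVlt; apply/orP; left; apply/eqP.
  apply/cvg_lim => //.
  have -> : (fun n => (\sum_(0 <= k < n) (geometric `|C| (q / r) k)%:E)%E) =
      EFin \o series (geometric `|C| (q / r)).
    by apply/funext => n /=; rewrite sumEFin.
  by apply: cvg_EFin => //; exact: nearW.
have iS : mu.-integrable D S.
  apply/integrableP; split => //.
  under eq_integral => x /[!inE] Dx do rewrite gee0_abs ?S0//.
  exact: le_lt_trans IS (ltry _).
(* The upper limit is measurable without any convergence, and it equals the limit at almost every
   point. *)
pose u x := fine (limn_esup (fun n => (w n x)%:E)).
have mu' : measurable_fun D u.
  apply: (measurableT_comp (fine_measurable measurableT)).
  by apply: measurable_fun_limn_esup => n; exact/measurable_EFinP.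
have Sfin := integrable_ae mD iS.
have key x n : D x -> S x \is a fin_num ->
    (w n x - u x) ^+ 2 * rho x <= fine (S x) * ((1 - p) ^+ 2)^-1 * r ^+ n.
  move=> Dx Sx; have rx := rho_gt0 Dx.
  have sS k : s k x <= fine (S x) * r ^+ k.
    rewrite mulrC -ler_pdivrMl ?exprn_gt0// -lee_fin fineK//.
    have := @nneseries_lim_ge R (g ^~ x) xpredT 0 k.+1 (fun n _ _ => g0 n x Dx).
    apply: le_trans; rewrite big_mkord big_ord_recr/= leeDr//.
    by apply: sume_ge0 => i _; exact: g0.
  pose b := Num.sqrt (fine (S x) / rho x).
  have S0' : 0 <= fine (S x) by rewrite fine_ge0// S0.
  have b2 : b ^+ 2 = fine (S x) / rho x by rewrite sqr_sqrtr// divr_ge0// ltW.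
  have [k|l [wl lb]] := @geometric_limit R (w ^~ x) b p p01.
    have pk : 0 < p ^+ k by rewrite exprn_gt0.
    rewrite -(ler_pXn2r (n := 2)) ?nnegrE// ?mulr_ge0 ?sqrtr_ge0// ?(ltW pk)//.
    rewrite real_normK ?num_real// exprMn b2 exprAC p2 mulrAC ler_pdivlMr//.
    exact: sS.
  have ul : u x = l.
    rewrite /u (_ : limn_esup _ = l%:E)//.
    apply: (cvg_limn_einf_sup _).2.
    by apply: cvg_EFin => //; exact: nearW.
  have := lb n; rewrite -ul distrC.
  rewrite -(ler_pXn2r (n := 2)) ?nnegrE//; last first.
    by rewrite mulr_ge0 ?exprn_ge0 ?(ltW p0)// divr_ge0 ?sqrtr_ge0// subr_ge0 ltW.
  rewrite real_normK ?num_real// exprMn exprAC p2 expr_div_n b2 => h.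
  rewrite -ler_pdivlMr//; apply: (le_trans h).
  by rewrite le_eqVlt; apply/orP; left; apply/eqP; ring.
exists u => //; exists (`|C| / (1 - q / r) * ((1 - p) ^+ 2)^-1) => n.
pose k := ((1 - p) ^+ 2)^-1 * r ^+ n.
have k0 : 0 <= k by rewrite mulr_ge0 ?invr_ge0 ?sqr_ge0 ?exprn_ge0// ltW.
apply: (@le_trans _ _ (\int[mu]_(x in D) (k%:E * S x))%E).
  apply: ae_ge0_le_integral => //.
  - by move=> x Dx; exact: (sq_ge0 (fun x => w n x - u x)).
  - by apply: (@measurable_sq (fun x => w n x - u x)); exact: measurable_funB.
  - by move=> x Dx; rewrite mule_ge0 ?S0.
  - exact: measurable_funeM.
  apply: filterS Sfin => x Sx Dx; have {}Sx := Sx Dx.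
  by rewrite -(fineK Sx) -EFinM lee_fin [leRHS]mulrC /k mulrA; exact: key.
rewrite ge0_integralZl_EFin//.
apply: (@le_trans _ _ (k%:E * (`|C| / (1 - q / r))%:E)%E); first by rewrite lee_wpmul2l.
by rewrite -EFinM lee_fin /k mulrC mulrA lexx.
Qed.

End weighted_L2.

(** * Weighted L2 of row-valued functions *)

Section L2_hilbert.
Context {R : realType} {q k : nat}.
Variables (D : set 'rV[R]_q) (rho : 'rV[R]_q -> R).
Hypothesis mD : measurable D.
Hypothesis mrho : measurable_fun D rho.
Hypothesis rho_gt0 : forall x, D x -> 0 < rho x.
Local Notation mu := (lebesgue_row q).
Implicit Types U V W : 'rV[R]_q -> 'rV[R]_k.

Lemma dot_integrable U V : L2_real D rho U -> L2_real D rho V ->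
  mu.-integrable D
    (EFin \o (fun x => (\sum_i coord U i x * coord V i x) * rho x)).
Proof.
move=> hU hV.
rewrite (_ : _ \o _ =
  (fun x => \sum_i (coord U i x * coord V i x * rho x)%:E)%E); last first.
  by apply/funext => x /=; rewrite mulr_suml sumEFin.
apply: integrable_sum => // i _.
exact: (mul_integrable mD mrho rho_gt0 (hU i) (hV i)).
Qed.

Lemma L2_realP a U V : L2_real D rho U -> L2_real D rho V ->
  L2_real D rho (U + a *: V).
Proof.
move=> hU hV i.
rewrite (_ : coord _ i = (fun x => coord U i x + a * coord V i x)).
  exact: (sqintP mD mrho rho_gt0 _ (hU i) (hV i)).
by apply/funext => x; rewrite /coord !fctE !mxE.
Qed.

Lemma L2_real0 : L2_real D rho (0 : 'rV[R]_q -> 'rV[R]_k).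
Proof.
move=> i; rewrite (_ : coord _ i = fun=> 0).
  exact: (sqint0 mu D rho).
by apply/funext => x; exact: mxE.
Qed.

Lemma L2_dotC U V : L2_dot D rho U V = L2_dot D rho V U.
Proof.
by apply: eq_Rintegral => x _; congr (_ * _); apply: eq_bigr => i _; rewrite mulrC.
Qed.

Lemma L2_dotP a U V W : L2_real D rho U -> L2_real D rho V -> L2_real D rho W ->
  L2_dot D rho (U + a *: V) W = L2_dot D rho U W + a * L2_dot D rho V W.
Proof.
move=> hU hV hW; rewrite /L2_dot -RintegralZl//; last exact: dot_integrable.
rewrite -RintegralD//; [|exact: dot_integrable|]; last first.
  have := integrableZl mD a (dot_integrable hV hW).
  by apply: eq_integrable => // x _; rewrite /= EFinM.
apply: eq_Rintegral => x _; rewrite mulrA -mulrDl mulr_sumr -big_split/=.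
by congr (_ * _); apply: eq_bigr => i _; rewrite /coord !fctE !mxE mulrDl mulrA.
Qed.

Lemma L2_dot_ge0 U : 0 <= L2_dot D rho U U.
Proof.
apply: Rintegral_ge0 => x Dx; rewrite mulr_ge0 ?(ltW (rho_gt0 Dx))//.
by apply: sumr_ge0 => i _; rewrite -expr2 sqr_ge0.
Qed.

Lemma L2_dot_sum U : L2_real D rho U -> ((L2_dot D rho U U)%:E =
  \sum_i \int[mu]_(x in D) (coord U i x ^+ 2 * rho x)%:E)%E.
Proof.
move=> hU; rewrite /L2_dot /Rintegral fineK; last first.
  by apply: integrable_fin_num => //; exact: dot_integrable.
rewrite -ge0_integral_sum//; last 2 first.
- by move=> i; apply: (measurable_sq mrho); exact: (hU i).1.
- by move=> i x Dx; exact: (sq_ge0 rho_gt0).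
apply: eq_integral => x _; rewrite sumEFin mulr_suml.
by congr EFin; apply: eq_bigr => i _; rewrite -expr2.
Qed.

Lemma L2_complete (w : nat -> 'rV[R]_q -> 'rV[R]_k) (C r : R) :
  (forall n, L2_real D rho (w n)) -> 0 <= r < 1 ->
  (forall n, L2_dot D rho (w n.+1 - w n) (w n.+1 - w n) <= C * r ^+ n) ->
  exists2 u, L2_real D rho u &
    (fun n => L2_dot D rho (w n - u) (w n - u)) @ \oo --> (0 : R).
Proof.
move=> hw r01 geo.
have hB U V : L2_real D rho U -> L2_real D rho V -> L2_real D rho (U - V).
  by move=> hU hV; rewrite -scaleN1r; exact: L2_realP.
have coordB U V i x : coord (U - V) i x = coord U i x - coord V i x.
  by rewrite /coord !fctE !mxE.
have ex i : exists u : 'rV[R]_q -> R, measurable_fun D u /\ exists C' : R,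
    forall n, (\int[mu]_(x in D) ((coord (w n) i x - u x) ^+ 2 * rho x)%:E <=
      (C' * ((1 + r) / 2) ^+ n)%:E)%E.
  have geoi n : (\int[mu]_(x in D)
      ((coord (w n.+1) i x - coord (w n) i x) ^+ 2 * rho x)%:E <= (C * r ^+ n)%:E)%E.
    apply: (@le_trans _ _ (L2_dot D rho (w n.+1 - w n) (w n.+1 - w n))%:E); last first.
      by rewrite lee_fin; exact: geo.
    rewrite L2_dot_sum; last exact: hB.
    under eq_integral do rewrite -coordB.
    rewrite (bigD1 i)//= leeDl//.
    by apply: sume_ge0 => j _; apply: integral_ge0 => x Dx; exact: (sq_ge0 rho_gt0).
  have [u mu' H] := sqint_complete mD mrho rho_gt0 r01 (fun n => (hw n i).1) geoi.
  by exists u.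
pose u i := sval (cid (ex i)).
have mu' i : measurable_fun D (u i) by have [] := svalP (cid (ex i)).
have Cex i : exists C' : R, forall n,
    (\int[mu]_(x in D) ((coord (w n) i x - u i x) ^+ 2 * rho x)%:E <=
      (C' * ((1 + r) / 2) ^+ n)%:E)%E by have [] := svalP (cid (ex i)).
pose C' i := sval (cid (Cex i)).
have HC i := svalP (cid (Cex i)).
pose U : 'rV[R]_q -> 'rV[R]_k := fun x => \row_i u i x.
have cU i : coord U i = u i by apply/funext => x; rewrite /coord mxE.
have hwU n i : sqint mu D rho (fun x => coord (w n) i x - u i x).
  split; first by apply: measurable_funB => //; exact: (hw n i).1.
  exact: le_lt_trans (HC i n) (ltry _).
have hU : L2_real D rho U.
  move=> i; rewrite cU.
  have := sqintP mD mrho rho_gt0 (-1) (hw 0%N i) (hwU 0%N i).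
  by congr (sqint _ _ _ _); apply/funext => x; rewrite mulN1r opprB addrC subrK.
exists U => //.
have r1 : 0 <= (1 + r) / 2 < 1 by lra.
have cv : (fun n => \sum_i C' i * ((1 + r) / 2) ^+ n) @ \oo --> (0 : R).
  rewrite (_ : (fun n => _) = geometric (\sum_i C' i) ((1 + r) / 2)).
    by apply: cvg_geometric; rewrite ger0_norm; lra.
  by apply/funext => n /=; rewrite mulr_suml.
apply: (squeeze_cvgr _ (@cvg_cst _ (0 : R) _ _ _) cv).
apply: nearW => n; rewrite L2_dot_ge0/= -lee_fin L2_dot_sum; last exact: hB.
rewrite -sumEFin; apply: lee_sum => i _.
under eq_integral do rewrite coordB cU.
exact: HC.
Qed.

Definition L2_hilbert : semi_hilbert ('rV[R]_q -> 'rV[R]_k) :=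
  SemiHilbert L2_real0 L2_realP L2_dotC L2_dotP L2_dot_ge0 L2_complete.

End L2_hilbert.

(** * The Reissner-Mindlin operator *)

Lemma sqr_sum_le (R : realFieldType) (q : nat) (a : 'I_q -> R) :
  (\sum_i a i) ^+ 2 <= q%:R * \sum_i a i ^+ 2.
Proof.
rewrite expr2 mulr_suml.
apply: (@le_trans _ _ (\sum_i \sum_j (a i ^+ 2 + a j ^+ 2) / 2)).
  apply: ler_sum => i _; rewrite mulr_sumr; apply: ler_sum => j _.
  have := sqr_ge0 (a i - a j); lra.
rewrite le_eqVlt; apply/orP; left; apply/eqP.
pose s := \sum_i a i ^+ 2.
have inner i : \sum_(j < q) (a i ^+ 2 + a j ^+ 2) / 2 = (q%:R * a i ^+ 2 + s) / 2.
  by rewrite -mulr_suml big_split/= sumr_const card_ord mulr_natl.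
under eq_bigr do rewrite inner.
rewrite -mulr_suml big_split/= sumr_const card_ord -mulr_sumr -/s -mulr_natl.
lra.
Qed.

(* [1 - sigma + q * kappa >= 0] is nonnegativity on the multiples of the
   identity. *)
Lemma elastic_ge0 (R : realFieldType) (q : nat) (sigma kappa : R)
    (e : 'I_q -> 'I_q -> R) : 0 <= 1 - sigma -> 0 <= 1 - sigma + q%:R * kappa ->
  0 <= (1 - sigma) * (\sum_i \sum_j e i j * e i j) +
       kappa * ((\sum_i e i i) * (\sum_i e i i)).
Proof.
move=> s0 k0.
have sum0 : 0 <= \sum_i e i i ^+ 2 by apply: sumr_ge0 => i _; exact: sqr_ge0.
have h1 : \sum_i e i i ^+ 2 <= \sum_i \sum_j e i j * e i j.
  apply: ler_sum => i _; rewrite (bigD1 i)//= -expr2 lerDl.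
  by apply: sumr_ge0 => j _; rewrite -expr2 sqr_ge0.
have h2 := sqr_sum_le (fun i => e i i).
have [kp|kn] := leP 0 kappa.
  apply: addr_ge0; apply: mulr_ge0 => //; last by rewrite -expr2 sqr_ge0.
  exact: le_trans h1.
rewrite -expr2.
set a := \sum_i \sum_j _ in h1 *; set b := \sum_i e i i ^+ 2 in h1 h2 sum0.
set s := _ ^+ 2 in h2 *.
have h3 : (1 - sigma) * b <= (1 - sigma) * a by rewrite ler_wpM2l.
have h4 : kappa * (q%:R * b) <= kappa * s by rewrite ler_wnM2l// ltW.
have h5 := mulr_ge0 k0 sum0.
by apply: (le_trans h5); apply: le_trans (lerD h3 h4); rewrite mulrDl; lra.
Qed.

Section reissner_mindlin_operator.
Context {R : realType} {q : nat}.
Variables (t E k sigma kappa : R) (D : set 'rV[R]_q) (rho : 'rV[R]_q -> R) (C : R).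
Hypotheses (t0 : 0 < t) (E0 : 0 < E) (k0 : 0 < k) (sigma1 : -1 < sigma < 1).
Hypothesis kappa_ge : 0 <= 1 - sigma + q%:R * kappa.
Hypothesis mD : measurable D.
Hypothesis mrho : measurable_fun D rho.
Hypothesis rho_gt0 : forall x, D x -> 0 < rho x.
Hypothesis rho_le : forall x, D x -> rho x <= C.
Local Notation mu := (lebesgue_row q).
Local Notation A := (rm_operator t E k sigma kappa D rho).
Implicit Types U V F : 'rV[R]_q -> 'rV[R]_(q + 1).

Lemma square_integrable_weight u :
  square_integrable D (cst 1) u -> square_integrable D rho u.
Proof.
move=> [mu' u2]; split=> //.
have m1 : measurable_fun D (fun x => (u x ^+ 2 * (cst 1 : 'rV[R]_q -> R) x)%:E : \bar R).
  by apply: measurable_sq => //; exact: measurable_cst.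
apply: (@le_lt_trans _ _ (\int[mu]_(x in D) (`|C|%:E * (u x ^+ 2 * cst 1 x)%:E))%E).
  apply: ge0_le_integral => //.
  - by move=> x Dx; exact: (sq_ge0 rho_gt0).
  - exact: measurable_sq.
  - exact: measurable_funeM.
  move=> x Dx; rewrite -EFinM lee_fin mulr1 mulrC ler_wpM2r ?sqr_ge0//.
  by rewrite (le_trans (rho_le Dx))// ler_norm.
rewrite ge0_integralZl_EFin//; last by move=> x Dx; rewrite lee_fin mulr1 sqr_ge0.
by rewrite lte_mul_pinfty// ?lee_fin.
Qed.

Lemma wderiv_square_integrable i u : H1 D u -> square_integrable D rho (wderiv D i u).
Proof.
move=> [_ /(_ i) hu]; apply: square_integrable_weight.
by rewrite /wderiv; have [] := xgetPex (cst 0) hu.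
Qed.

Lemma rm_operator_dom U F : A U F -> L2_real D rho U /\ L2_real D rho F.
Proof.
move=> [hU hF _]; split=> // i; apply: square_integrable_weight.
by have [] := hU i.
Qed.

Lemma rm_formC U V :
  rm_form t E k sigma kappa D rho U V = rm_form t E k sigma kappa D rho V U.
Proof.
apply: eq_Rintegral => x _; congr (_ * _); congr (_ + _ + _ + _); last exact: mulrC.
- congr (_ * (_ * _ + _ * _)); last exact: mulrC.
  by apply: eq_bigr => i _; apply: eq_bigr => j _; exact: mulrC.
- by congr (_ * _); apply: eq_bigr => i _; exact: mulrC.
- by congr (_ * _); apply: eq_bigr => i _; exact: mulrC.
Qed.

Lemma rm_operator_sym U F V G : A U F -> A V G ->
  L2_dot D rho F V = L2_dot D rho U G.
Proof.
move=> [hU _ UF] [hV _ VG].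
by rewrite -UF// rm_formC VG// L2_dotC.
Qed.

Let weighted f := mu.-integrable D (EFin \o (fun x => f x * rho x)).

Let weightedD f g : weighted f -> weighted g -> weighted (fun x => f x + g x).
Proof.
move=> hf hg; have := integrableD mD hf hg.
by apply: eq_integrable => // x _; rewrite /= -EFinD mulrDl.
Qed.

Let weightedZ a f : weighted f -> weighted (fun x => a * f x).
Proof.
move=> hf; have := integrableZl mD a hf.
by apply: eq_integrable => // x _; rewrite /= -EFinM mulrA.
Qed.

Let weighted_sum n (f : 'I_n -> _) : (forall i, weighted (f i)) ->
  weighted (fun x => \sum_i f i x).
Proof.
move=> hf.
have : mu.-integrable D (fun x => \sum_i (f i x * rho x)%:E)%E.
  by apply: integrable_sum => // i _; exact: hf.
by apply: eq_integrable => // x _; rewrite /= sumEFin mulr_suml.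
Qed.

Let weighted_sq f g : square_integrable D rho f -> square_integrable D rho g ->
  weighted (fun x => f x * g x).
Proof. exact: mul_integrable. Qed.

Let sum_square_integrable n (f : 'I_n -> 'rV[R]_q -> R) :
  (forall i, square_integrable D rho (f i)) ->
  square_integrable D rho (fun x => \sum_i f i x).
Proof.
elim: n f => [|n IH] f hf.
  have := sqint0 mu D rho; congr (sqint _ _ _ _).
  by apply/funext => x; rewrite big_ord0.
have := sqintP mD mrho rho_gt0 1 (hf ord0) (IH _ (fun i => hf (lift ord0 i))).
by congr (sqint _ _ _ _); apply/funext => x; rewrite mul1r big_ord_recl.
Qed.

(** The zero-order terms alone dominate the L2 norm; the elastic and shear energies contribute only
    their nonnegativity. *)
Definition rm_coercivity := Num.min (t ^+ 2 / 12) 1.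

Lemma rm_coercivity_gt0 : 0 < rm_coercivity.
Proof. by rewrite lt_min ltr01 divr_gt0// exprn_gt0. Qed.

Lemma rm_operator_coercive U F : A U F ->
  rm_coercivity * L2_dot D rho U U <= L2_dot D rho F U.
Proof.
move=> AUF; have [hU _] := rm_operator_dom AUF; have [hU1 _ UF] := AUF.
rewrite -UF// /L2_dot /rm_form -RintegralZl//; last exact: dot_integrable.
have sum_sq (a b : R) (u v : 'rV[R]_q -> R) : square_integrable D rho u ->
    square_integrable D rho v -> square_integrable D rho (fun x => a * (u x + b * v x)).
  move=> hu hv.
  have := sqintP mD mrho rho_gt0 a (sqint0 mu D rho) (sqintP mD mrho rho_gt0 b hu hv).
  by congr (sqint _ _ _ _); apply/funext => x; rewrite add0r.
have w2 i j : square_integrable D rho (wderiv D i (coord U j)).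
  by apply: wderiv_square_integrable.
have st i j : square_integrable D rho (strain D U i j).
  have := sum_sq 2^-1 1 _ _ (w2 j (lshift 1 i)) (w2 i (lshift 1 j)).
  by congr (square_integrable _ _ _); apply/funext => x; rewrite mul1r.
have sh i : square_integrable D rho (shear D U i).
  have := sum_sq 1 (-1) _ _ (w2 i (rshift q ord0)) (hU (lshift 1 i)).
  by congr (square_integrable _ _ _); apply/funext => x; rewrite mulN1r mul1r.
(* The divergence as the trace of the strain brings the elastic energy into the form treated by
   [elastic_ge0]. *)
have dvE x : divergence D U x = \sum_i strain D U i i x.
  by apply: eq_bigr => i _; rewrite /strain; lra.
have dv : square_integrable D rho (divergence D U).
  rewrite (_ : divergence D U = (fun x => \sum_i strain D U i i x)); last exact/funext.
  exact: sum_square_integrable.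
have rt i : square_integrable D rho (rot U i) := hU (lshift 1 i).
have df : square_integrable D rho (defl U) := hU (rshift q ord0).
apply: le_Rintegral => //.
- have := weightedZ rm_coercivity (weighted_sum (fun i => weighted_sq (hU i) (hU i))).
  by apply: eq_integrable => // x _; rewrite /= mulrA.
- apply: weightedD; last by apply: weighted_sq.
  apply: weightedD; last first.
    by apply: weightedZ; apply: weighted_sum => i; apply: weighted_sq.
  apply: weightedD; last first.
    by apply: weightedZ; apply: weighted_sum => i; apply: weighted_sq.
  apply: weightedZ; apply: weightedD; apply: weightedZ; last by apply: weighted_sq.
  apply: weighted_sum => i; apply: weighted_sum => j; by apply: weighted_sq.
move=> x Dx; rewrite mulrA ler_wpM2r ?(ltW (rho_gt0 Dx))//.
rewrite big_split_ord/= big_ord1.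
have [s1 s2] := andP sigma1.
have e1 : 0 <= E / (12 * (1 - sigma ^+ 2)) *
    ((1 - sigma) * (\sum_i \sum_j strain D U i j x * strain D U i j x) +
     kappa * (divergence D U x * divergence D U x)).
  apply: mulr_ge0; first by apply: divr_ge0; [exact: ltW|nra].
  by rewrite dvE; apply: elastic_ge0 => //; lra.
have e2 : 0 <= E * k / (2 * (1 + sigma) * t ^+ 2) *
    (\sum_i shear D U i x * shear D U i x).
  apply: mulr_ge0; last by apply: sumr_ge0 => i _; rewrite -expr2 sqr_ge0.
  apply: divr_ge0; first by rewrite mulr_ge0// ltW.
  by apply: mulr_ge0; [apply: mulr_ge0 => //; lra|exact: sqr_ge0].
have e3 : rm_coercivity * (\sum_i rot U i x * rot U i x) <=
    t ^+ 2 / 12 * (\sum_i rot U i x * rot U i x).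
  apply: ler_wpM2r; first by apply: sumr_ge0 => i _; rewrite -expr2 sqr_ge0.
  by rewrite ge_min lexx.
have e4 : rm_coercivity * (defl U x * defl U x) <= defl U x * defl U x.
  rewrite -[leRHS]mul1r; apply: ler_wpM2r; first by rewrite -expr2 sqr_ge0.
  by rewrite ge_min lexx orbT.
rewrite mulrDr; move: e3 e4; rewrite /Defs.rot /defl; lra.
Qed.

Lemma rm_operator_null U F F' : A U F -> L2_real D rho F' ->
  L2_dot D rho (F - F') (F - F') = 0 -> A U F'.
Proof.
move=> AUF hF' FF'; have [_ hF] := rm_operator_dom AUF; have [hU1 _ UF] := AUF.
split=> // V hV; rewrite UF//.
have hV2 : L2_real D rho V by move=> i; apply: square_integrable_weight; have [] := hV i.
pose S := L2_hilbert mD mrho rho_gt0 (k := q + 1).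
have hFF : L2_real D rho (F - F') := domB (S := S) hF hF'.
have := form_cauchy_schwarz (S := S) hFF hV2.
rewrite /= FF' mul0r => h.
have {h} : L2_dot D rho (F - F') V = 0.
  by apply/eqP; rewrite -sqrf_eq0 eq_le h sqr_ge0.
rewrite -scaleN1r (L2_dotP mD mrho rho_gt0)// mulN1r => /eqP.
by rewrite subr_eq0 => /eqP.
Qed.

End reissner_mindlin_operator.

(** * Integration over rows *)

Section row_integrals.
Context {R : realType}.
Local Notation leb := (@lebesgue_measure R).

Lemma integral_rowS n (f : 'rV[R]_n.+1 -> \bar R) :
  measurable_fun setT f -> (forall v, 0 <= f v)%E ->
  (\int[lebesgue_row n.+1]_v f v =
   \int[leb]_r \int[lebesgue_row n]_v f (row_cons (r, v)))%E.
Proof.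
move=> mf f0.
have mc : measurable_fun setT (@row_cons R n : measurableTypeR R * 'rV[R]_n -> 'rV[R]_n.+1)
  := @measurable_row_cons R n.
have mfc : measurable_fun setT
    (f \o (@row_cons R n : measurableTypeR R * 'rV[R]_n -> 'rV[R]_n.+1))
    by exact: measurableT_comp.
have -> := esym (@fubini_tonelli1 _ _ _ _ _ leb (lebesgue_row n) _ mfc
  (fun p => f0 (row_cons p))).
have := ge0_integral_pushforward mc (leb \x lebesgue_row n)%E measurableT mf (fun v _ => f0 v).
rewrite preimage_setT => <-.
exact: eq_measure_integral.
Qed.

Lemma measurable_row_mx n d :
  measurable_fun setT (fun p : 'rV[R]_n * 'rV[R]_d => row_mx p.1 p.2).
Proof.
apply: measurable_fun_row => i; case: (split_ordP i) => j ->.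
  rewrite (_ : (fun _ => _) = (fun v : 'rV[R]_n => v ord0 j) \o fst).
    exact: (measurableT_comp (@measurable_entry _ _ _ j)).
  by apply/funext => p; exact: row_mxEl.
rewrite (_ : (fun _ => _) = (fun v : 'rV[R]_d => v ord0 j) \o snd).
  exact: (measurableT_comp (@measurable_entry _ _ _ j)).
by apply/funext => p; exact: row_mxEr.
Qed.

Lemma slice_xsection n d (A : set 'rV[R]_(n + d)) (x : 'rV[R]_n) :
  slice A x = xsection ((fun p : 'rV[R]_n * 'rV[R]_d => row_mx p.1 p.2) @^-1` A) x.
Proof. by apply/seteqP; split=> y; [exact: mem_set|exact: set_mem]. Qed.

Lemma measurable_pairs n d (A : set 'rV[R]_(n + d)) : measurable A ->
  measurable ((fun p : 'rV[R]_n * 'rV[R]_d => row_mx p.1 p.2) @^-1` A).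
Proof.
by move=> mA; rewrite -[X in measurable X]setTI; exact: (measurable_row_mx measurableT mA).
Qed.

Lemma measurable_slice n d (A : set 'rV[R]_(n + d)) (x : 'rV[R]_n) :
  measurable A -> measurable (slice A x).
Proof.
by move=> mA; rewrite slice_xsection; apply: measurable_xsection; exact: measurable_pairs.
Qed.

Lemma measurable_fun_slice n d (A : set 'rV[R]_(n + d)) : measurable A ->
  measurable_fun setT (fun x : 'rV[R]_n => lebesgue_row d (slice A x)).
Proof.
move=> mA; under eq_fun do rewrite slice_xsection.
exact: measurable_fun_xsection (measurable_pairs mA).
Qed.

(** Associativity of concatenation; the two row types are convertible, so the cast in [row_mxA] is
    the identity. *)
Lemma row_mx_cons n d (r : R) (x : 'rV[R]_n) (y : 'rV[R]_d) :
  row_cons (r, row_mx x y) = row_mx (row_cons (r, x) : 'rV_(n.+1)) y.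
Proof.
rewrite /row_cons /= (@row_mxA _ 1 1 n d (const_mx r) x y). apply: castmx_id.
Qed.

(** The recursive definition removes one leading coordinate at a time, so Cavalieri's principle for
    a block of [n] coordinates goes by induction on [n], starting from a Dirac mass. *)
Lemma lebesgue_row_split n d (A : set 'rV[R]_(n + d)) : measurable A ->
  (lebesgue_row (n + d) A = \int[lebesgue_row n]_x lebesgue_row d (slice A x))%E.
Proof.
elim: n A => [|n IH] A mA.
  rewrite (integral_dirac _ measurableT (@measurable_fun_slice 0 d A mA)) diracT mul1e.
  congr (lebesgue_row d _); apply/seteqP.
  by split=> y; rewrite /slice/= row_thin_mx.
rewrite integral_rowS//; last exact: measurable_fun_slice.
have mcA : measurable (@row_cons R (n + d) @^-1` A).
  rewrite -[X in measurable X]setTI; exact: (@measurable_row_cons R (n + d) measurableT _ mA).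
rewrite [LHS]/= /row_measure /pushforward /product_measure1.
apply: eq_integral => r _ /=; rewrite IH; last exact: measurable_xsection.
apply: eq_integral => x _; congr (lebesgue_row d _).
apply/seteqP; split=> y.
  by rewrite /slice /= => /set_mem /=; rewrite row_mx_cons.
by rewrite /slice /= => Ay; apply/mem_set; rewrite /= row_mx_cons.
Qed.

Lemma integral_row_split n d (f : 'rV[R]_(n + d) -> \bar R) :
  measurable_fun setT f -> (forall v, 0 <= f v)%E ->
  (\int[lebesgue_row (n + d)]_v f v =
   \int[lebesgue_row n]_x \int[lebesgue_row d]_y f (row_mx x y))%E.
Proof.
move=> mf f0.
have mr := @measurable_row_mx n d.
have mfr : measurable_fun setT (f \o (fun p : 'rV[R]_n * 'rV[R]_d => row_mx p.1 p.2)).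
  exact: measurableT_comp.
have -> := esym (@fubini_tonelli1 _ _ _ _ _ (lebesgue_row n) (lebesgue_row d) _ mfr
  (fun p => f0 (row_mx p.1 p.2))).
have := ge0_integral_pushforward mr (lebesgue_row n \x lebesgue_row d)%E measurableT mf
  (fun v _ => f0 v).
rewrite preimage_setT => <-.
apply: eq_measure_integral => A mA _.
apply: (etrans (lebesgue_row_split mA)); apply: eq_integral => x _.
by rewrite slice_xsection.
Qed.

Lemma measurable_lsubmx n d :
  measurable_fun setT (fun z : 'rV[R]_(n + d) => lsubmx z).
Proof.
apply: measurable_fun_row => i.
rewrite (_ : (fun _ => _) = (fun v : 'rV[R]_(n + d) => v ord0 (lshift d i))).
  exact: measurable_entry.
by apply/funext => z; rewrite mxE.
Qed.

Lemma integral_slices n d (A : set 'rV[R]_(n + d)) (f : 'rV[R]_n -> \bar R) :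
  measurable A -> measurable_fun setT f -> (forall x, 0 <= f x)%E ->
  (\int[lebesgue_row (n + d)]_(z in A) f (lsubmx z) =
   \int[lebesgue_row n]_x (f x * lebesgue_row d (slice A x)))%E.
Proof.
move=> mA mf f0.
have mfl : measurable_fun setT (fun z : 'rV[R]_(n + d) => f (lsubmx z)).
  exact: (measurableT_comp mf (@measurable_lsubmx n d)).
rewrite integral_mkcond integral_row_split; last 2 first.
- by apply/(measurable_restrictT _ mA); exact: measurable_funTS.
- by move=> v; apply: erestrict_ge0.
apply: eq_integral => x _.
rewrite -integral_cst; last exact: measurable_slice.
rewrite [RHS]integral_mkcond; apply: eq_integral => y _.
rewrite !patchE; have -> : (row_mx x y \in A) = (y \in slice A x).
  by apply/idP/idP => /set_mem h; apply/mem_set.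
by case: ifP => //= _; rewrite row_mxKl.
Qed.

(** By uniqueness of Lebesgue measure: c times its pushforward under multiplication by c gives
    half-open intervals their length. *)
Lemma lebesgue_measure_scale (c : R) (A : set R) : 0 < c -> measurable A ->
  leb ( *%R c @^-1` A) = ((c^-1)%:E * leb A)%E.
Proof.
move=> c0 mA.
have mc : measurable_fun setT ( *%R c : measurableTypeR R -> measurableTypeR R).
  exact: mulrl_measurable.
have key : leb A = (c%:E * pushforward leb ( *%R c : measurableTypeR R -> measurableTypeR R) A)%E.
  pose nu := [the measure _ _ of mscale (NngNum (ltW c0))
    (measure_function_pushforward__canonical__measure_function_Measure leb mc)].
  apply: (@lebesgue_measure_unique R nu) => // _ [[a b]] _ <-.
  rewrite /nu /= /mscale /= /pushforward.
  rewrite (_ : _ @^-1` _ = `]a / c, b / c]%classic); last first.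
    apply/seteqP; split=> x /=; rewrite !in_itv/= ltr_pdivrMr// ler_pdivlMr// mulrC//.
  rewrite !lebesgue_measure_itv/= !lte_fin ltr_pM2r ?invr_gt0//.
  case: ifP => _; last by rewrite mule0.
  by rewrite -!EFinB -EFinM -mulrBl mulrC divfK// gt_eqF.
by rewrite [in RHS]key muleA -EFinM mulVf ?gt_eqF// mul1e.
Qed.

Lemma lebesgue_integral_scale (c : R) (f : R -> \bar R) : 0 < c ->
  measurable_fun setT f -> (forall x, 0 <= f x)%E ->
  (\int[leb]_x f (c * x)%R = (c^-1)%:E * \int[leb]_x f x)%E.
Proof.
move=> c0 mf f0.
have mc : measurable_fun setT ( *%R c : measurableTypeR R -> measurableTypeR R).
  exact: mulrl_measurable.
have := ge0_integral_pushforward mc leb measurableT mf (fun v _ => f0 v).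
rewrite preimage_setT => <-.
have c0' : 0 <= c^-1 by rewrite invr_ge0 ltW.
rewrite -[c^-1]/((NngNum c0')%:num) -ge0_integral_mscale//.
apply: eq_measure_integral => A mA _ /=.
by rewrite /pushforward lebesgue_measure_scale.
Qed.

Lemma scale_row_cons n (c r : R) (y : 'rV[R]_n) :
  c *: row_cons (r, y) = row_cons (c * r, c *: y).
Proof.
apply: (etrans (@scale_row_mx R 1 1 n c (const_mx r) y)); congr row_mx.
by apply/rowP => i; rewrite !mxE.
Qed.

Lemma lebesgue_row_scale d (c : R) (A : set 'rV[R]_d) : 0 < c -> measurable A ->
  (lebesgue_row d [set y | A (c *: y)%R] = (c^-1 ^+ d)%R%:E * lebesgue_row d A)%E.
Proof.
move=> c0; elim: d A => [|d IH] A mA.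
  rewrite expr0 mul1e; congr (lebesgue_row 0 _).
  by apply/seteqP; split=> y /=; rewrite [c *: y]thinmx0 [y]thinmx0.
have mcA : measurable (@row_cons R d @^-1` A).
  rewrite -[X in measurable X]setTI; exact: (@measurable_row_cons R d measurableT _ mA).
pose h r := lebesgue_row d (xsection (@row_cons R d @^-1` A) r).
have mh : measurable_fun setT h by exact: measurable_fun_xsection.
have E (B : set 'rV[R]_d.+1) : lebesgue_row d.+1 B =
    (\int[leb]_r lebesgue_row d (xsection (@row_cons R d @^-1` B) r))%E by [].
have c0' : 0 <= c^-1 ^+ d by rewrite exprn_ge0// invr_ge0 ltW.
rewrite !E exprS mulrC EFinM -muleA -(lebesgue_integral_scale c0 mh)//.
rewrite -ge0_integralZl_EFin//; last first.
  have mc : measurable_fun setT ( *%R c : measurableTypeR R -> measurableTypeR R).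
    exact: mulrl_measurable.
  exact: (measurableT_comp mh mc).
apply: eq_integral => r _; rewrite /h -IH; last exact: measurable_xsection.
congr (lebesgue_row d _).
apply/seteqP; split=> y /=.
  by move=> /set_mem /=; rewrite scale_row_cons => ?; apply/mem_set.
by move=> /set_mem /= Ay; apply/mem_set => /=; rewrite scale_row_cons.
Qed.

End row_integrals.

(** * Measurability of open sets and of their Lipschitz images *)

Section measurability_rows.
Context {R : realType}.

(** Rational centres and radii 1/(k+1) make the family countable. The boxes are closed, hence
    compact, so that their continuous images are compact as well. *)
Definition box n (p : 'rV[rat]_n * nat) : set 'rV[R]_n :=
  [set y | forall i, y ord0 i \in
    `[ratr (p.1 ord0 i) - p.2.+1%:R^-1, ratr (p.1 ord0 i) + p.2.+1%:R^-1]].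

Lemma box_compact n p : compact (@box n p).
Proof.
apply: (@rV_compact R n (fun i : 'I_n => `[ratr (p.1 ord0 i) - p.2.+1%:R^-1,
  ratr (p.1 ord0 i) + p.2.+1%:R^-1]%classic)).
by move=> i; exact: segment_compact.
Qed.

Lemma box_measurable n p : measurable (@box n p).
Proof.
rewrite (_ : box p = \bigcap_(i in [set: 'I_n])
  ((fun v : 'rV[R]_n => v ord0 i) @^-1`
    `[ratr (p.1 ord0 i) - p.2.+1%:R^-1, ratr (p.1 ord0 i) + p.2.+1%:R^-1]%classic)).
  apply: fin_bigcap_measurable => [|i _]; first exact: finite_finset.
  rewrite -[X in measurable X]setTI.
  exact: (@measurable_entry _ _ _ i measurableT).
by apply/seteqP; split=> [y by_ i _|y by_ i]; [exact: by_|exact: (by_ i I)].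
Qed.

Lemma box_cover n (U : set 'rV[R]_n) : open U ->
  exists B : 'rV[rat]_n * nat -> set 'rV[R]_n, U = \bigcup_p B p /\
    forall p, B p `<=` U /\ (B p = box p \/ B p = set0).
Proof.
move=> oU.
exists (fun p => if pselect (box p `<=` U) then box p else set0); split; last first.
  move=> p; case: pselect => h; first by split; [exact: h|left].
  by split; [exact: sub0set|right].
apply/seteqP; split=> [y Uy|y [p _]]; last first.
  by case: pselect => // h; exact: h.
have /nbhs_ballP[e /= e0 yeU] := oU y Uy.
have e2 : 0 < e / 2 by rewrite divr_gt0.
(* Half of [e] suffices: the centre is within 1/(k+1) of [y], and every point of the box is within
   1/(k+1) of the centre. *)
have [k _ /(_ k (leqnn k)) /= ke] := near_infty_natSinv_lt (PosNum e2).
have k0 : 0 < k.+1%:R^-1 :> R by rewrite invr_gt0.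
have cex i : exists c : rat, ratr c \in `](y ord0 i - k.+1%:R^-1), (y ord0 i)[.
  by apply: rat_in_itvoo; rewrite ltrBlDr ltrDl.
pose c : 'rV[rat]_n := \row_i sval (cid (cex i)).
have cP i : y ord0 i - k.+1%:R^-1 < ratr (c ord0 i) < y ord0 i.
  by rewrite mxE; have := svalP (cid (cex i)); rewrite in_itv.
have bU : box (c, k) `<=` U.
  move=> z zb; apply: yeU; split=> // i j; rewrite /ball/= (_ : i = ord0); last exact: ord1.
  have := zb j; rewrite in_itv/= => /andP[z1 z2].
  have /andP[c1 c2] := cP j.
  rewrite /= in z1 z2 ke; rewrite ltr_norml.
  move: z1 z2 c1 c2 ke; set h := k.+1%:R^-1; set a := ratr _; set b := y ord0 j.
  by set w := z ord0 j; move=> *; apply/andP; split; lra.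
exists (c, k) => //; case: pselect => // _ i.
rewrite in_itv/=; have /andP[] := cP i; move: k0.
set h := k.+1%:R^-1; set a := ratr _; set b := y ord0 i.
by move=> *; apply/andP; split; lra.
Qed.

Lemma countable_boxes n : countable [set: 'rV[rat]_n * nat].
Proof. exact: countableP. Qed.

Lemma open_measurable_row n (U : set 'rV[R]_n) : open U -> measurable U.
Proof.
move=> /box_cover[B [-> HB]].
apply: countable_bigcupT_measurable; first exact: countable_boxes.
by move=> p; have [_ [->|->]] := HB p; [exact: box_measurable|exact: measurable0].
Qed.

(** An open set is a countable union of compact boxes, so its image is a countable union of compact
    sets. This is what makes [Omega1], known only as an image, measurable. *)
Lemma lipschitz_image_measurable n d (U : set 'rV[R]_n) (K : R)
    (f : 'rV[R]_n -> 'rV[R]_d) :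
  open U -> K.-lipschitz_U f -> measurable (f @` U).
Proof.
move=> /box_cover[B [UB HB]] lf.
rewrite {1}UB image_bigcup.
apply: countable_bigcupT_measurable; first exact: countable_boxes.
move=> p; have [BU Bp] := HB p.
have cB : compact (B p) by case: Bp => ->; [exact: box_compact|exact: compact0].
have cfB : compact (f @` B p).
  apply: continuous_compact cB; apply/subspace_continuousP => x Bx.
  apply/cvgrPdist_lt => e e0.
  have K0 : 0 < `|K| + 1 by rewrite ltr_wpDl.
  rewrite near_withinE; near=> y => By.
  have := lf (x, y) (conj (BU _ Bx) (BU _ By)) => /= /le_lt_trans; apply.
  apply: (@le_lt_trans _ _ ((`|K| + 1) * `|x - y|)).
    by apply: ler_wpM2r => //; rewrite (le_trans (ler_norm K))// lerDl.
  rewrite -ltr_pdivlMl//; near: y.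
  by apply: cvgr_dist_lt => //; rewrite mulr_gt0 ?invr_gt0.
rewrite -(setCK (f @` B p)); apply: measurableC; apply: open_measurable_row.
by apply: closed_openC; apply: compact_closed => //; exact: norm_hausdorff.
Unshelve. all: by end_near.
Qed.

End measurability_rows.

(** * Thin domains *)

Section thin_domain_facts.
Context {R : realType} {n d : nat}.
Variables (Omega : set 'rV[R]_n) (Omega1 : set 'rV[R]_(n + d)).
Hypothesis hthin : thin_domain Omega Omega1.
Local Notation g := (slice_volume Omega1).

Lemma Omega_measurable : measurable Omega.
Proof. by have [[oO _ _] _ _ _] := hthin; exact: open_measurable_row. Qed.

Lemma unit_ball_open : open (unit_ball : set 'rV[R]_d).
Proof.
rewrite (_ : unit_ball = (fun y : 'rV[R]_d => \sum_i y ord0 i ^+ 2) @^-1` [set x | x < 1])//.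
apply: open_comp; last exact: open_lt.
move=> y _; apply: cvg_big => [||i _]; [exact: add_continuous|exact: nbhs_filter|].
have c := @coord_continuous R 1 d ord0 i y; exact: (cvgM c c).
Qed.

Lemma Omega1_measurable : measurable Omega1.
Proof.
have [[oO _ _] [L [_ [<- [K [lip _]]]]] _ _] := hthin.
apply: lipschitz_image_measurable lip.
apply: openI.
  by apply: open_comp oO => z _; exact: continuous_lsubmx.
by apply: open_comp unit_ball_open => z _; exact: continuous_rsubmx.
Qed.

Lemma Omega1_sub z : Omega1 z -> Omega (lsubmx z).
Proof.
have [_ [L [_ [<- _]]] _ _] := hthin => -[y [Oy _] <-].
by rewrite row_mxKl.
Qed.

Lemma slice_volume_gt0 x : Omega x -> 0 < g x.
Proof. by have [_ _ _ [c0 c00 H]] := hthin => Ox; exact: lt_le_trans (H _ Ox). Qed.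

(** Positivity of [g] excludes a section of infinite measure, to which [fine] would assign 0. *)
Lemma slice_volumeE x : Omega x -> lebesgue_row d (slice Omega1 x) = (g x)%:E.
Proof.
move=> Ox; have := slice_volume_gt0 Ox; rewrite /slice_volume.
by case: (lebesgue_row d _) => //=; rewrite ltxx.
Qed.

Lemma slice_volume_measurable : measurable_fun Omega g.
Proof.
apply: measurable_funTS.
exact: (measurableT_comp (fine_measurable measurableT) (measurable_fun_slice Omega1_measurable)).
Qed.

Lemma slice_volume_bounded : exists C, forall x, Omega x -> g x <= C.
Proof.
have [[_ bO _] _ lip _] := hthin.
have [[x0 Ox0]|no] := pselect (exists x, Omega x); last first.
  by exists 0 => x Ox; exfalso; apply: no; exists x.
have [M M0 hM] := pinfty_ex_gt0 lip.
have [B B0 hB] := pinfty_ex_gt0 bO.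
exists (g x0 + M * (B + B)) => x Ox.
have := hM (x, x0) (conj Ox Ox0) => /= h.
rewrite -lerBlDl; apply: le_trans (ler_norm _) _; apply: (le_trans h).
rewrite ler_pM2l//; apply: (le_trans (ler_normB _ _)).
by apply: lerD; exact: hB.
Qed.

Section delta.
Variable delta : R.
Hypothesis delta_gt0 : 0 < delta.
Local Notation Od := (Omega_ Omega1 delta).

Lemma Omega_E : Od = [set z | Omega1 (row_mx (lsubmx z) (delta^-1 *: rsubmx z))].
Proof.
have dn : delta != 0 by rewrite gt_eqF.
apply/seteqP; split=> [_ [z Oz <-]|z Oz] /=.
  by rewrite row_mxKl row_mxKr scalerA mulVf// scale1r hsubmxK.
exists (row_mx (lsubmx z) (delta^-1 *: rsubmx z)) => //.
by rewrite row_mxKl row_mxKr scalerA divff// scale1r hsubmxK.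
Qed.

Lemma Omega__measurable : measurable Od.
Proof.
rewrite Omega_E -[X in measurable X]setTI.
apply: (_ : measurable_fun setT
  (fun z : 'rV[R]_(n + d) => row_mx (lsubmx z) (delta^-1 *: rsubmx z))) => //; last first.
  exact: Omega1_measurable.
apply: measurable_fun_row => i; case: (split_ordP i) => j ->.
  rewrite (_ : (fun _ => _) = (fun v : 'rV[R]_(n + d) => v ord0 (lshift d j))).
    exact: measurable_entry.
  by apply/funext => z; rewrite row_mxEl mxE.
rewrite (_ : (fun _ => _) = (fun v : 'rV[R]_(n + d) => delta^-1 * v ord0 (rshift n j))).
  by apply: measurable_funM => //; exact: measurable_entry.
by apply/funext => z; rewrite row_mxEr !mxE.
Qed.

Lemma Omega__sub z : Od z -> Omega (lsubmx z).
Proof. by rewrite Omega_E => /= /Omega1_sub; rewrite row_mxKl. Qed.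

Lemma slice_Omega_ x :
  lebesgue_row d (slice Od x) = ((delta ^+ d)%:E * lebesgue_row d (slice Omega1 x))%E.
Proof.
have d0 : 0 < delta^-1 by rewrite invr_gt0.
have := lebesgue_row_scale d0 (measurable_slice x Omega1_measurable).
rewrite invrK => <-; congr (lebesgue_row d _).
by rewrite Omega_E; apply/seteqP; split=> y; rewrite /slice /= row_mxKl row_mxKr.
Qed.

(** The sections of the thin domain have volume delta^d g(x), which cancels the weight delta^-d.
    This is the source of the isometry. *)
Lemma integral_connecting (F : 'rV[R]_n -> R) : measurable_fun Omega F ->
  (forall x, Omega x -> 0 <= F x) ->
  (\int[lebesgue_row (n + d)]_(z in Od) (F (lsubmx z) * delta ^- d)%:E =
   \int[lebesgue_row n]_(x in Omega) (F x * g x)%:E)%E.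
Proof.
move=> mF F0.
have dn : delta ^+ d != 0 by rewrite expf_neq0// gt_eqF.
have d0 : 0 <= delta ^- d by rewrite invr_ge0 exprn_ge0// ltW.
(* [F] is controlled only on [Omega], so it is extended by 0 before Tonelli's theorem is applied on
   the whole space. *)
pose f x : \bar R := ((F \_ Omega) x * delta ^- d)%:E.
transitivity (\int[lebesgue_row (n + d)]_(z in Od) f (lsubmx z))%E.
  apply: eq_integral => z /[!inE] Oz; rewrite /f patchE.
  by rewrite mem_set//; exact: Omega__sub.
rewrite integral_slices//.
- rewrite [RHS]integral_mkcond; apply: eq_integral => x _.
  rewrite /f patchE; case: ifPn => [/set_mem Ox|/negP nO].
    rewrite patchE mem_set// slice_Omega_ slice_volumeE// -!EFinM.
    by congr EFin; rewrite -mulrA [delta ^- d * _]mulrA mulVf// mul1r.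
  by rewrite patchE ifN ?mul0r ?mul0e//; apply/negP.
- exact: Omega__measurable.
- apply/measurable_EFinP; apply: measurable_funM; last exact: measurable_cst.
  by apply/(measurable_restrictT _ Omega_measurable).
- move=> x; rewrite lee_fin mulr_ge0// patchE; case: ifPn => // /set_mem; exact: F0.
Qed.

Definition real_connecting (u : 'rV[R]_n -> 'rV[R]_(n + 1))
  : 'rV[R]_(n + d) -> 'rV[R]_(n + d + 1) :=
  fun z => row_mx (row_mx (lsubmx (u (lsubmx z))) 0) (rsubmx (u (lsubmx z))).

Lemma real_connecting_rot u i :
  coord (real_connecting u) (lshift 1 (lshift d i)) = coord u (lshift 1 i) \o lsubmx.
Proof. by apply/funext => z; rewrite /coord /= !row_mxEl mxE. Qed.

Lemma real_connecting_thin u j :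
  coord (real_connecting u) (lshift 1 (rshift n j)) = fun=> 0.
Proof. by apply/funext => z; rewrite /coord row_mxEl row_mxEr mxE. Qed.

Lemma real_connecting_defl u j :
  coord (real_connecting u) (rshift (n + d) j) = coord u (rshift n j) \o lsubmx.
Proof. by apply/funext => z; rewrite /coord /= row_mxEr mxE. Qed.

Lemma L2_real_connecting u : L2_real Omega g u ->
  L2_real Od (cst (delta ^- d)) (real_connecting u).
Proof.
move=> hu.
have sq i : square_integrable Od (cst (delta ^- d)) (coord u i \o lsubmx).
  have [mu' u2] := hu i; split.
    apply: (measurable_comp Omega_measurable) => //.
      by move=> _ [z Oz <-]; exact: Omega__sub.
    by apply: measurable_funTS; exact: measurable_lsubmx.
  rewrite (integral_connecting (F := fun x => coord u i x ^+ 2))//.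
    exact: measurable_funX.
  by move=> x _; exact: sqr_ge0.
move=> k; case: (split_ordP k) => [l ->|l ->]; last by rewrite real_connecting_defl.
case: (split_ordP l) => [i ->|j ->]; first by rewrite real_connecting_rot.
by rewrite real_connecting_thin; exact: sqint0.
Qed.

Lemma L2_dot_connecting u : L2_real Omega g u ->
  L2_dot Od (cst (delta ^- d)) (real_connecting u) (real_connecting u) =
  L2_dot Omega g u u.
Proof.
move=> hu; rewrite /L2_dot /Rintegral; congr fine.
rewrite -(integral_connecting (F := fun x => \sum_i coord u i x * coord u i x)).
- apply: eq_integral => z _; congr (_ * _)%:E.
  rewrite !big_split_ord/= [X in _ + X + _]big1 ?addr0; last first.
    by move=> j _; rewrite real_connecting_thin mulr0.
  by congr (_ + _); apply: eq_bigr => i _; rewrite ?real_connecting_rot ?real_connecting_defl.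
- by apply: measurable_sum => i; apply: measurable_funM; exact: (hu i).1.
- by move=> x _; apply: sumr_ge0 => i _; rewrite -expr2 sqr_ge0.
Qed.

Lemma re_connecting (f : 'rV[R]_n -> 'rV[R[i]]_(n + 1)) :
  re_part (connecting f) = real_connecting (re_part f).
Proof.
apply/funext => z; rewrite /re_part /connecting /real_connecting !map_row_mx.
by rewrite map_lsubmx map_rsubmx map_const_mx.
Qed.

Lemma im_connecting (f : 'rV[R]_n -> 'rV[R[i]]_(n + 1)) :
  im_part (connecting f) = real_connecting (im_part f).
Proof.
apply/funext => z; rewrite /im_part /connecting /real_connecting !map_row_mx.
by rewrite map_lsubmx map_rsubmx map_const_mx.
Qed.

Lemma carrier_connecting f : carrier (H_0 Omega Omega1) f ->
  carrier (H_delta Omega Omega1 delta) (connecting f).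
Proof.
have zero u j : zero_average Omega Od
    (fun z => delta^-1 * coord (real_connecting u) (lshift 1 (rshift n j)) z).
  apply: aeW => x _; rewrite /average.
  under eq_Rintegral do rewrite real_connecting_thin mulr0.
  by rewrite /Rintegral integral0 mulr0.
move=> [hre him]; split; rewrite ?re_connecting ?im_connecting//.
by split; rewrite /= ?re_connecting ?im_connecting; exact: L2_real_connecting.
Qed.

Lemma hnorm_connecting f : carrier (H_0 Omega Omega1) f ->
  hnorm (H_delta Omega Omega1 delta) (connecting f) = hnorm (H_0 Omega Omega1) f.
Proof.
by move=> [hre him]; rewrite /= re_connecting im_connecting !L2_dot_connecting.
Qed.

End delta.
End thin_domain_facts.

(** * Complexification *)

Section complexification.
Context {R : realType} {q k : nat}.
Implicit Types U V W : 'rV[R]_q -> 'rV[R[i]]_k.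

Definition of_parts (u v : 'rV[R]_q -> 'rV[R]_k) : 'rV[R]_q -> 'rV[R[i]]_k :=
  fun x => \row_j Complex (u x ord0 j) (v x ord0 j).

Lemma re_of_parts u v : re_part (of_parts u v) = u.
Proof. by apply/funext => x; apply/rowP => j; rewrite !mxE. Qed.

Lemma im_of_parts u v : im_part (of_parts u v) = v.
Proof. by apply/funext => x; apply/rowP => j; rewrite !mxE. Qed.

Lemma re_partD U V : re_part (U + V) = re_part U + re_part V.
Proof.
by apply/funext => x; apply/rowP => j; rewrite !mxE; case: (U x _ _) (V x _ _) => [? ?] [].
Qed.

Lemma im_partD U V : im_part (U + V) = im_part U + im_part V.
Proof.
by apply/funext => x; apply/rowP => j; rewrite !mxE; case: (U x _ _) (V x _ _) => [? ?] [].
Qed.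

Lemma re_partN U : re_part (- U) = - re_part U.
Proof. by apply/funext => x; apply/rowP => j; rewrite !mxE; case: (U x _ _). Qed.

Lemma im_partN U : im_part (- U) = - im_part U.
Proof. by apply/funext => x; apply/rowP => j; rewrite !mxE; case: (U x _ _). Qed.

Lemma re_partB U V : re_part (U - V) = re_part U - re_part V.
Proof. by rewrite re_partD re_partN. Qed.

Lemma im_partB U V : im_part (U - V) = im_part U - im_part V.
Proof. by rewrite im_partD im_partN. Qed.

Lemma re_partZ a U :
  re_part (a *: U) = complex.Re a *: re_part U + (- complex.Im a) *: im_part U.
Proof.
apply/funext => x; apply/rowP => j; rewrite !mxE.
by case: (U x _ _) a => [? ?] []/= ? ?; rewrite mulNr.
Qed.

Lemma im_partZ a U :
  im_part (a *: U) = complex.Re a *: im_part U + complex.Im a *: re_part U.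
Proof.
by apply/funext => x; apply/rowP => j; rewrite !mxE; case: (U x _ _) a => [? ?] []/= ? ?.
Qed.

Lemma re_partZr (a : R) U : re_part (Complex a 0 *: U) = a *: re_part U.
Proof. by rewrite re_partZ /= oppr0 scale0r addr0. Qed.

Lemma im_partZr (a : R) U : im_part (Complex a 0 *: U) = a *: im_part U.
Proof. by rewrite im_partZ /= scale0r addr0. Qed.

Variables (D : set 'rV[R]_q) (rho : 'rV[R]_q -> R).
Hypothesis mD : measurable D.
Hypothesis mrho : measurable_fun D rho.
Hypothesis rho_gt0 : forall x, D x -> 0 < rho x.
Local Notation S := (L2_hilbert mD mrho rho_gt0 (k := k)).
Local Notation f := (L2_dot D rho).
Local Notation HC := (L2 k D rho).

Definition norm2 U := f (re_part U) (re_part U) + f (im_part U) (im_part U).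

Lemma norm2_ge0 U : 0 <= norm2 U.
Proof. by apply: addr_ge0; exact: L2_dot_ge0. Qed.

Lemma hnorm_sq U : hnorm HC U ^+ 2 = norm2 U.
Proof. by rewrite sqr_sqrtr// norm2_ge0. Qed.

Lemma hnorm_eq0 U : (hnorm HC U = 0) <-> (norm2 U = 0).
Proof.
split; last by rewrite /= /norm2 => ->; rewrite sqrtr0.
by rewrite -hnorm_sq => ->; rewrite expr0n.
Qed.

Lemma carrierD U V : carrier HC U -> carrier HC V -> carrier HC (U + V).
Proof.
move=> [u1 u2] [v1 v2]; split; rewrite ?re_partD ?im_partD;
exact: (domD (S := S)).
Qed.

Lemma carrierZ a U : carrier HC U -> carrier HC (a *: U).
Proof.
move=> [u1 u2]; split; rewrite ?re_partZ ?im_partZ;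
by apply: (domP (s := S)) => //; exact: (domZ (S := S)).
Qed.

Lemma carrierB U V : carrier HC U -> carrier HC V -> carrier HC (U - V).
Proof. by move=> hU hV; rewrite -scaleN1r; apply: carrierD => //; exact: carrierZ. Qed.

Lemma carrier0 : carrier HC 0.
Proof.
have h := dom0 S; split.
  by rewrite (_ : re_part 0 = 0)//; apply/funext => x; apply/rowP => j; rewrite !mxE.
by rewrite (_ : im_part 0 = 0)//; apply/funext => x; apply/rowP => j; rewrite !mxE.
Qed.

Lemma carrier_sum m (e : 'I_m -> _) : (forall i, carrier HC (e i)) ->
  carrier HC (\sum_i e i).
Proof.
by move=> he; apply: big_ind => //; [exact: carrier0|exact: carrierD].
Qed.

Lemma norm2D U V : carrier HC U -> carrier HC V ->
  norm2 (U + V) <= 2 * norm2 U + 2 * norm2 V.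
Proof.
move=> [u1 u2] [v1 v2]; rewrite /norm2 re_partD im_partD.
have sq (x y : 'rV[R]_q -> 'rV[R]_k) : L2_real D rho x -> L2_real D rho y ->
    f (x + y) (x + y) <= 2 * f x x + 2 * f y y.
  move=> hx hy.
  have := sq_add (@ip_sym _ _ S) (@ip_addl _ _ S) (@ip_scalel _ _ S) (@ip_nonneg _ _ S)
    (cls S x) (cls S y).
  by rewrite -clsD// !(ip_cls (S := S))//; exact: (domD (S := S)).
by have := sq _ _ u1 v1; have := sq _ _ u2 v2; lra.
Qed.

Lemma norm2Z a U : carrier HC U -> norm2 (a *: U) = normc a ^+ 2 * norm2 U.
Proof.
move=> [u1 u2]; rewrite /norm2 re_partZ im_partZ.
have lin (x y : 'rV[R]_q -> 'rV[R]_k) b1 b2 :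
    L2_real D rho x -> L2_real D rho y ->
    f (b1 *: x + b2 *: y) (b1 *: x + b2 *: y) =
    b1 ^+ 2 * f x x + 2 * b1 * b2 * f x y + b2 ^+ 2 * f y y.
  move=> hx hy.
  have hbx : L2_real D rho (b1 *: x) := domZ (S := S) b1 hx.
  have hs : L2_real D rho (b1 *: x + b2 *: y) := domP (s := S) b2 hbx hy.
  have L c (u v : 'rV[R]_q -> 'rV[R]_k) :
      L2_real D rho u -> L2_real D rho v -> f (c *: u) v = c * f u v.
    move=> hu hv.
    have := formP (s := S) c (dom0 S) hu hv; rewrite add0r => /= ->.
    by have /= -> := form0 (S := S) hv; rewrite add0r.
  rewrite (L2_dotP mD mrho rho_gt0)// L// !(L2_dotC D rho _ (_ + _)).
  rewrite !(L2_dotP mD mrho rho_gt0)// !L// (L2_dotC D rho y x).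
  by ring.
rewrite !lin// (L2_dotC D rho (im_part U)).
case: a => a1 a2 /=; rewrite sqr_sqrtr ?addr_ge0 ?sqr_ge0//.
by rewrite sqrrN; ring.
Qed.

(** The Hermitian product, linear in [U] and conjugate linear in [V]. *)
Definition hdot U V : R[i] :=
  Complex (f (re_part U) (re_part V) + f (im_part U) (im_part V))
          (f (im_part U) (re_part V) - f (re_part U) (im_part V)).

Lemma hdotP a U V W : carrier HC U -> carrier HC V -> carrier HC W ->
  hdot (U + a *: V) W = hdot U W + a * hdot V W.
Proof.
move=> [u1 u2] [v1 v2] [w1 w2].
have lin (x y z w : 'rV[R]_q -> 'rV[R]_k) b1 b2 :
    L2_real D rho x -> L2_real D rho y -> L2_real D rho z ->
    L2_real D rho w -> f (x + (b1 *: y + b2 *: z)) w = f x w + b1 * f y w + b2 * f z w.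
  move=> hx hy hz hw.
  have hxy : L2_real D rho (x + b1 *: y) := domP (s := S) b1 hx hy.
  by rewrite addrA !(L2_dotP mD mrho rho_gt0).
rewrite /hdot !re_partD !im_partD re_partZ im_partZ !lin//.
by case: a => a1 a2; apply/eqP; rewrite eq_complex /=; apply/andP; split; apply/eqP; ring.
Qed.

Lemma hdot_sum m (c : 'I_m -> R[i]) (e : 'I_m -> _) W :
  (forall i, carrier HC (e i)) -> carrier HC W ->
  hdot (\sum_i c i *: e i) W = \sum_i c i * hdot (e i) W.
Proof.
move=> he hW.
have h0 : hdot 0 W = 0.
  have := hdotP (-1) carrier0 carrier0 hW.
  by rewrite scaler0 addr0 mulN1r subrr.
suff : carrier HC (\sum_i c i *: e i) /\
    hdot (\sum_i c i *: e i) W = \sum_i c i * hdot (e i) W by case.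
elim/big_rec2: _ => [|i y1 y2 _ [h1 h2]]; first by split; [exact: carrier0|].
split; first by apply: carrierD => //; exact: carrierZ.
by rewrite addrC hdotP// h2 addrC.
Qed.

Lemma hdot_eq0C U V : hdot U V = 0 -> hdot V U = 0.
Proof.
move=> [h1 h2]; rewrite /hdot; congr Complex.
  by rewrite (L2_dotC D rho (re_part V)) (L2_dotC D rho (im_part V)).
by rewrite (L2_dotC D rho (re_part V)) (L2_dotC D rho (im_part V)) -opprB h2 oppr0.
Qed.

Lemma L2_dot_null (u v w : 'rV[R]_q -> 'rV[R]_k) :
  L2_real D rho u -> L2_real D rho v -> L2_real D rho w ->
  f (u - v) (u - v) = 0 -> f u w = f v w.
Proof.
move=> hu hv hw /(cls_eqP (S := S) hu hv) uv.
by rewrite -[LHS](ip_cls (S := S))// uv (ip_cls (S := S)).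
Qed.

Lemma norm2_eq0 U : norm2 U = 0 ->
  f (re_part U) (re_part U) = 0 /\ f (im_part U) (im_part U) = 0.
Proof.
have := L2_dot_ge0 rho_gt0 (re_part U); have := L2_dot_ge0 rho_gt0 (im_part U).
by rewrite /norm2; split; lra.
Qed.

Lemma hdot_null U V W : carrier HC U -> carrier HC V -> carrier HC W ->
  norm2 (U - V) = 0 -> hdot U W = hdot V W.
Proof.
move=> [u1 u2] [v1 v2] [w1 w2] /norm2_eq0; rewrite re_partB im_partB => -[h1 h2].
by rewrite /hdot !(L2_dot_null u1 v1 _ h1)// !(L2_dot_null u2 v2 _ h2).
Qed.

End complexification.

(** * Complexified operators, their spectrum and eigenspaces *)

Section complex_operator.
Context {R : realType} {q k : nat}.
Variables (D : set 'rV[R]_q) (rho : 'rV[R]_q -> R).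
Hypothesis mD : measurable D.
Hypothesis mrho : measurable_fun D rho.
Hypothesis rho_gt0 : forall x, D x -> 0 < rho x.
Local Notation S := (L2_hilbert mD mrho rho_gt0 (k := k)).
Local Notation f := (L2_dot D rho).
Local Notation HC := (L2 k D rho).
Variables (A : ('rV[R]_q -> 'rV[R]_k) -> ('rV[R]_q -> 'rV[R]_k) -> Prop) (c : R).
Hypothesis c0 : 0 < c.
Hypothesis A_dom : forall u v, A u v -> L2_real D rho u /\ L2_real D rho v.
Hypothesis A_sym : forall u v u' v', A u v -> A u' v' -> f v u' = f u v'.
Hypothesis A_coercive : forall u v, A u v -> c * f u u <= f v u.
Hypothesis A_null : forall u v v', A u v -> L2_real D rho v' ->
  f (v - v') (v - v') = 0 -> A u v'.
Local Notation AC := (complexified A).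

Lemma complexified_dom U F : AC U F -> carrier HC U /\ carrier HC F.
Proof. by move=> [/A_dom[? ?] /A_dom[? ?]]. Qed.

Lemma regular_of_resolvent (z : R) :
  resolvent_set HC AC (Complex z 0) -> regular S A z.
Proof.
move=> [surj [M HM]]; split=> [g Hg|].
  have [|U [AU _]] := surj (of_parts g 0).
    by split; rewrite ?re_of_parts ?im_of_parts//; exact: (dom0 S).
  by exists (re_part U); rewrite re_partD re_of_parts re_partZr in AU.
exists (M ^+ 2) => g u Hg Au.
(* Using the same function as real and imaginary part doubles both sides and calls for no relation
   other than the given one for [u]. *)
have := HM (of_parts g g) (of_parts u u).
rewrite /= !re_of_parts !im_of_parts => /(_ (conj Hg Hg)) H.
have {}H : Num.sqrt (f u u + f u u) <= M * Num.sqrt (f g g + f g g).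
  by apply: H; split; rewrite ?re_partD ?im_partD ?re_partZr ?im_partZr
    ?re_of_parts ?im_of_parts.
have u0 := form_ge0 S u; have g0 := form_ge0 S g; rewrite /= in u0 g0 *.
have h1 : 0 <= f u u + f u u by lra.
have h2 : 0 <= f g g + f g g by lra.
have := H; rewrite -(ler_pXn2r (n := 2)) ?nnegrE ?sqrtr_ge0//; last first.
  exact: le_trans (sqrtr_ge0 _) H.
by rewrite exprMn !sqr_sqrtr//; lra.
Qed.

Lemma eigenvalue_real U lam : AC U (lam *: U) -> norm2 D rho U <> 0 ->
  lam = Complex (complex.Re lam) 0 /\ c <= complex.Re lam.
Proof.
move=> [A1 A2] U0; rewrite re_partZ im_partZ in A1 A2.
set a := complex.Re lam in A1 A2 *; set b := complex.Im lam in A1 A2.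
have [H1 _] := A_dom A1; have [H2 _] := A_dom A2.
set u := re_part U in A1 A2 H1 H2; set v := im_part U in A1 A2 H1 H2.
have N0 : 0 < f u u + f v v.
  by rewrite lt_def (norm2_ge0 rho_gt0 U) andbT; apply/eqP.
have lin x1 x2 (x y w : 'rV[R]_q -> 'rV[R]_k) : L2_real D rho x -> L2_real D rho y ->
    L2_real D rho w -> f (x1 *: x + x2 *: y) w = x1 * f x w + x2 * f y w.
  move=> hx hy hw.
  have hz : L2_real D rho (0 + x1 *: x) := domP (s := S) x1 (dom0 S) hx.
  rewrite -(add0r (x1 *: x)) !(L2_dotP mD mrho rho_gt0)//; last exact: (dom0 S).
  by have /= -> := form0 (S := S) hw; rewrite add0r.
have sym : a * f u v + - b * f v v = a * f v u + b * f u u.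
  by rewrite -!lin// (L2_dotC D rho (a *: v + b *: u)); exact: A_sym A1 A2.
rewrite (L2_dotC D rho v u) in sym.
have b0 : b = 0.
  have : b * (f u u + f v v) = 0 by lra.
  by move=> /eqP; rewrite mulf_eq0 (gt_eqF N0) orbF => /eqP.
split; first by move: b0; rewrite /a /b; case: (lam) => /= ? ? ->.
have := A_coercive A1; have := A_coercive A2.
rewrite !lin// b0 oppr0 !mul0r !addr0 => h1 h2.
have : c * (f u u + f v v) <= a * (f u u + f v v) by lra.
by rewrite ler_pM2r.
Qed.

Lemma complexified_surjective z : regular S A z ->
  forall F, carrier HC F -> exists U, AC U F.
Proof.
move=> reg F [F1 F2].
have surj := regular_surjective (S := S) c0 A_dom A_sym A_coercive A_null reg.
have [u Au] := surj _ F1; have [v Av] := surj _ F2.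
by exists (of_parts u v); split; rewrite ?re_of_parts ?im_of_parts.
Qed.

(** No linearity of the relation [A] is assumed, so a combination of eigenvectors is treated weakly.
    The condition [W] is tested against the graph of [A] and is stable under combinations;
    [adjoint_relation] turns it back into a true preimage, up to a null function. *)
Lemma eigenspace_solution z m (l : R) (e : 'I_m -> _) (a : 'I_m -> R[i]) :
  regular S A z -> l != 0 -> (forall i, AC (e i) (Complex l 0 *: e i)) ->
  let phi := \sum_i a i *: e i in
  exists2 U, AC U phi & norm2 D rho (U - Complex l^-1 0 *: phi) = 0.
Proof.
move=> reg l0 Ae phi.
pose W x := L2_real D rho x /\ forall u v, A u v -> f x v = l * f x u.
have WP x1 x y : W x -> W y -> W (x + x1 *: y).
  move=> [hx Wx] [hy Wy]; split=> [|u v Auv]; first exact: (domP (s := S)).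
  have [hu hv] := A_dom Auv.
  by rewrite !(L2_dotP mD mrho rho_gt0)// (Wx _ _ Auv) (Wy _ _ Auv); ring.
have We x : A x (l *: x) -> W x.
  move=> Ax; have [hx _] := A_dom Ax; split=> // u v Auv.
  have [hu hv] := A_dom Auv.
  rewrite -(A_sym Ax Auv) -(add0r (l *: x)) (L2_dotP mD mrho rho_gt0)//; last exact: (dom0 S).
  by have /= -> := form0 (S := S) hu; rewrite add0r.
have W0 : W 0.
  split; first exact: (dom0 S).
  move=> u v /A_dom[hu hv]; have /= -> := form0 (S := S) hu.
  by have /= -> := form0 (S := S) hv; rewrite mulr0.
have WZ x1 x : W x -> W (x1 *: x) by move=> Wx; rewrite -[_ *: _]add0r; exact: WP.
have [W1 W2] : W (re_part phi) /\ W (im_part phi).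
  rewrite /phi; apply: (big_ind (fun U => W (re_part U) /\ W (im_part U))).
  - by rewrite -(scale0r (0 : 'rV[R]_q -> 'rV[R[i]]_k)) re_partZ im_partZ /= oppr0 !scale0r addr0.
  - move=> x y [x1 x2] [y1 y2]; rewrite re_partD im_partD -(scale1r (re_part y)).
    by rewrite -(scale1r (im_part y)); split; exact: WP.
  - move=> i _; have [/We e1 /We e2] : A (re_part (e i)) (l *: re_part (e i)) /\
        A (im_part (e i)) (l *: im_part (e i)).
      by have := Ae i; rewrite /complexified re_partZr im_partZr.
    by rewrite re_partZ im_partZ; split; apply: WP => //; exact: WZ.
have sol x : W x -> exists2 u, A u x & f (u - l^-1 *: x) (u - l^-1 *: x) = 0.
  move=> [hx Wx].
  apply: (adjoint_relation (S := S) A_dom A_sym A_null reg) => //.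
    exact: (domZ (S := S)).
  move=> u v Auv; have [hu hv] := A_dom Auv.
  rewrite -(add0r (l^-1 *: x)) /= (L2_dotP mD mrho rho_gt0)//; last exact: (dom0 S).
  have /= -> := form0 (S := S) hv.
  by rewrite (Wx _ _ Auv) add0r mulrA mulVf// mul1r.
have [u Au hu] := sol _ W1; have [v Av hv] := sol _ W2.
exists (of_parts u v); first by split; rewrite ?re_of_parts ?im_of_parts.
rewrite /norm2 re_partB im_partB re_of_parts im_of_parts re_partZr im_partZr.
by rewrite hu hv addr0.
Qed.

(** A real eigenvector v is tested through v + i v: the product of [W] with it has real part x + y
    and imaginary part y - x, with x and y the two wanted products, so both vanish. *)
Lemma hdot_orthogonal p (l : R) (e : 'I_p -> _) W :
  (forall i, carrier HC (e i)) -> carrier HC W ->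
  (forall U, AC U (Complex l 0 *: U) ->
    exists a : 'I_p -> R[i], norm2 D rho (U - \sum_i a i *: e i) = 0) ->
  (forall i, hdot D rho W (e i) = 0) ->
  forall v, A v (l *: v) -> f (re_part W) v = 0 /\ f (im_part W) v = 0.
Proof.
move=> He HW span We v Av.
have [hv _] := A_dom Av.
have hV : carrier HC (of_parts v v).
  by split; rewrite ?re_of_parts ?im_of_parts.
have [|a Ha] := span (of_parts v v).
  by split; rewrite ?re_partZr ?im_partZr ?re_of_parts ?im_of_parts.
have hs : carrier HC (\sum_i a i *: e i).
  by apply: (carrier_sum mD mrho rho_gt0) => i; apply: (carrierZ mD mrho rho_gt0).
have : hdot D rho W (of_parts v v) = 0.
  apply: hdot_eq0C; rewrite (hdot_null mD mrho rho_gt0 hV hs HW Ha).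
  rewrite (hdot_sum mD mrho rho_gt0)// big1// => i _.
  by rewrite (hdot_eq0C (We i)) mulr0.
by rewrite /hdot re_of_parts im_of_parts => -[h1 h2]; split; lra.
Qed.

End complex_operator.

(** The dimension count: fewer than [m] conditions on [m] coefficients, written as a square matrix
    whose zero column makes the determinant vanish. *)
Lemma kernel_vector (K : fieldType) (m : nat) (M : 'I_m -> 'I_m -> K) (i : 'I_m) :
  (forall k, M k i = 0) ->
  exists2 a : 'I_m -> K, exists k, a k != 0 & forall j, \sum_k a k * M k j = 0.
Proof.
move=> Mi; pose B : 'M[K]_m := \matrix_(k, j) M k j.
have /eqP/det0P[a a0 aB] : \det B = 0.
  by rewrite (expand_det_col _ i) big1// => k _; rewrite mxE Mi mul0r.
exists (a ord0).
  by apply/existsP; apply: contraNT a0 => /existsPn h; apply/eqP/rowP => k;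
     rewrite mxE; apply/eqP; have := h k; rewrite negbK.
move=> j; have := congr1 (fun x : 'rV_m => x ord0 j) aB; rewrite !mxE => h.
by rewrite -[RHS]h; apply: eq_bigr => k _; rewrite mxE.
Qed.

(** * The resolvent integral *)

Section resolvent_integral.
Context {R : realType} {q k : nat}.
Variables (D : set 'rV[R]_q) (rho : 'rV[R]_q -> R).
Hypothesis mD : measurable D.
Hypothesis mrho : measurable_fun D rho.
Hypothesis rho_gt0 : forall x, D x -> 0 < rho x.
Local Notation HC := (L2 k D rho).
Local Notation Z := ('rV[R]_q -> 'rV[R[i]]_k).

Definition bounded_operator (T : Z -> Z) :=
  (forall f, carrier HC f -> carrier HC (T f)) /\
  exists2 K, 0 <= K & forall f, carrier HC f -> norm2 D rho (T f) <= K * norm2 D rho f.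

Lemma bounded_operatorD T U : bounded_operator T -> bounded_operator U ->
  bounded_operator (fun f => T f + U f).
Proof.
move=> [cT [K1 K10 H1]] [cU [K2 K20 H2]]; split.
  by move=> f hf; apply: (carrierD mD mrho rho_gt0); [exact: cT|exact: cU].
exists (2 * K1 + 2 * K2); first by lra.
move=> f hf; apply: (le_trans (norm2D mD mrho rho_gt0 (cT _ hf) (cU _ hf))).
by have := H1 _ hf; have := H2 _ hf; lra.
Qed.

Lemma bounded_operatorZ a T : bounded_operator T ->
  bounded_operator (fun f => a *: T f).
Proof.
move=> [cT [K K0 H]]; split.
  by move=> f hf; apply: (carrierZ mD mrho rho_gt0); exact: cT.
exists (normc a ^+ 2 * K); first by rewrite mulr_ge0// sqr_ge0.
move=> f hf; rewrite (norm2Z mD mrho rho_gt0 _ (cT _ hf)) -[leRHS]mulrA.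
by rewrite ler_wpM2l ?sqr_ge0//; exact: H.
Qed.

Lemma bounded_operator_sum n (T : 'I_n -> Z -> Z) :
  (forall i, bounded_operator (T i)) -> bounded_operator (fun f => \sum_i T i f).
Proof.
elim: n T => [|n IH] T hT.
  have -> : (fun f => \sum_i T i f) = (fun f => (0 : R[i]) *: f).
    by apply/funext => f; rewrite big_ord0 scale0r.
  by apply: bounded_operatorZ; split=> //; exists 1 => // f _; rewrite mul1r.
have -> : (fun f => \sum_i T i f) =
    (fun f => T ord0 f + \sum_(i < n) T (lift ord0 i) f).
  by apply/funext => f; rewrite big_ord_recl.
by apply: bounded_operatorD => //; exact: IH.
Qed.

(** At tolerance 1 the operator [P] is within norm 1 of a single Riemann sum, a finite combination
    of resolvents, each of which is bounded. *)
Lemma resolvent_integral_bounded (AC : Z -> Z -> Prop) gam P :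
  (forall U F, AC U F -> carrier HC U) ->
  is_resolvent_integral HC AC gam P ->
  exists2 K, 0 <= K & forall f, carrier HC f -> hnorm HC (P f) <= K * hnorm HC f.
Proof.
move=> dom [cres cP intP].
have [eta eta0 Heta] := intP 1 ltr01.
have [n _ /(_ n (leqnn n)) /= neta] := near_infty_natSinv_lt (PosNum eta0).
pose s (j : nat) : R := j%:R / n.+1%:R.
have n0 : 0 < n.+1%:R :> R by [].
have part : tagged_partition n.+1 s s eta.
  split; [by rewrite /s mul0r|by rewrite /s divff// gt_eqF|move=> j jn].
  have sS : s j.+1 = s j + n.+1%:R^-1 by rewrite /s -natr1 mulrDl mul1r.
  by rewrite lexx sS lerDl invr_ge0 ltW// addrC addKr.
have cur (j : 'I_n.+1) : curve_image gam (gam (s j)).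
  exists (s j) => //=; rewrite in_itv/= /s divr_ge0//= ler_pdivrMr// mul1r.
  by rewrite ler_nat ltnW.
have ex (j : 'I_n.+1) f : exists u, carrier HC f -> resolves AC (gam (s j)) f u.
  have [hf|nf] := pselect (carrier HC f); last by exists 0.
  have [surj _] := cres _ (cur j).
  by have [u hu] := surj f hf; exists u.
pose r j f := sval (cid (ex j f)).
have rP (j : 'I_n.+1) f : carrier HC f -> resolves AC (gam (s j)) f (r j f)
  := svalP (cid (ex j f)).
have br (j : 'I_n.+1) : bounded_operator (r j).
  split; first by move=> f hf; exact: dom (rP j f hf).
  have [_ [M HM]] := cres _ (cur j).
  exists (M ^+ 2); first exact: sqr_ge0.
  move=> f hf; have := HM _ _ hf (rP j f hf).
  rewrite -!(hnorm_sq rho_gt0) -exprMn => h.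
  by rewrite lerXn2r ?nnegrE ?sqrtr_ge0//; apply: le_trans h; exact: sqrtr_ge0.
have [T TE] : {T : Z -> Z | T = fun f => (Complex 0 (2 * pi))^-1 *:
    (\sum_(j < n.+1) (gam (s j.+1) - gam (s j)) *: r j f)} by eexists.
have [cT [K K0 HK]] : bounded_operator T.
  rewrite TE; apply: bounded_operatorZ; apply: bounded_operator_sum => j.
  exact: bounded_operatorZ.
(* From |P f|^2 <= 2 |T f|^2 + 2 |T f - P f|^2, with [K] bounding the square of [T] and 1 that of
   the difference. *)
exists (Num.sqrt (2 * K + 2)); first exact: sqrtr_ge0.
move=> f hf.
have hTP : norm2 D rho (T f - P f) <= norm2 D rho f.
  have := Heta n.+1 s s part f (fun j => r (inord j) f) hf.
  have -> : \sum_(j < n.+1) (gam (s j.+1) - gam (s j)) *: r (inord j) f =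
      \sum_(j < n.+1) (gam (s j.+1) - gam (s j)) *: r j f.
    by apply: eq_bigr => j _; rewrite inord_val.
  rewrite (_ : _ *: _ = T f); last by rewrite TE.
  rewrite mul1r => h.
  rewrite -!(hnorm_sq rho_gt0) lerXn2r ?nnegrE ?sqrtr_ge0//; apply: h => j jn.
  by have := rP (inord j) f hf; rewrite inordK.
have hP : P f = T f + (-1) *: (T f - P f) by rewrite scaleN1r opprB addrC subrK.
have cTP : carrier HC (T f - P f).
  by apply: (carrierB mD mrho rho_gt0); [exact: cT|exact: cP].
have hP2 : norm2 D rho (P f) <= (2 * K + 2) * norm2 D rho f.
  rewrite hP; apply: (le_trans (norm2D mD mrho rho_gt0 (cT _ hf) _)).
    exact: (carrierZ mD mrho rho_gt0).
  rewrite (norm2Z mD mrho rho_gt0 (-1) cTP).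
  rewrite (_ : normc (-1) = 1); last first.
    by rewrite /normc /= sqrrN expr1n oppr0 expr0n addr0 sqrtr1.
  by rewrite expr1n mul1r; have := HK f hf; lra.
rewrite -(ler_pXn2r (n := 2)) ?nnegrE ?mulr_ge0 ?sqrtr_ge0//.
have K20 : 0 <= 2 * K + 2 by lra.
by rewrite exprMn !(hnorm_sq rho_gt0) (sqr_sqrtr K20).
Qed.

End resolvent_integral.

(** The image of the curve is compact, so its complement is open and contains a real interval around
    [l0]. The interval is connected, hence lies in the bounded component of [l0]. *)
Lemma inside_interval (R : realType) (gam : R -> R[i]) (l0 : R) :
  jordan_curve gam -> inside gam (Complex l0 0) ->
  exists2 r, 0 < r & forall x, `|x - l0| < r -> inside gam (Complex x 0).
Proof.
move=> [cre cim _ _] [ni bc].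
pose O := [set p : R * R | ~ curve_image gam (Complex p.1 p.2)].
pose h s : R * R := (complex.Re (gam s), complex.Im (gam s)).
have hO : O = ~` (h @` `[0, 1]).
  apply/seteqP; split=> [p Op [s s01 hs]|p Op [s s01 hs]].
    by apply: Op; exists s => //; rewrite -hs /=; case: (gam s).
  by apply: Op; exists s => //; rewrite /h hs; case: p {hs}.
have oO : open O.
  rewrite hO; apply: closed_openC; apply: compact_closed.
    exact: (@norm_hausdorff R (R * R)%type).
  apply: continuous_compact; last exact: segment_compact.
  move/subspace_continuousP : cre => cre; move/subspace_continuousP : cim => cim.
  by apply/subspace_continuousP => s s01; exact: (cvg_pair (cre s s01) (cim s s01)).
have /nbhs_ballP[e /= e0 He] : nbhs (l0, 0) O by apply: oO.
exists e => // x xe.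
pose I := (fun x : R => (x, 0 : R)) @` `]l0 - e, l0 + e[.
have IO : I `<=` O.
  move=> _ [y ye <-]; apply: He; split=> /=; last exact: ballxx.
  by move: ye; rewrite /= in_itv/= => ?; rewrite /ball/= ltr_distlC.
have cI : connected I.
  apply: connected_continuous_connected.
    by apply/connected_intervalP; exact: interval_is_interval.
  apply: continuous_subspaceT => y; exact: (cvg_pair cvg_id (cvg_cst _)).
have Il : I (l0, 0) by exists l0 => //; rewrite /= in_itv/=; apply/andP; split; lra.
have Ix : I (x, 0).
  by exists x => //; rewrite /= in_itv/=; move: xe; rewrite ltr_norml => /andP[? ?];
       apply/andP; split; lra.
split; first exact: (IO _ Ix).
rewrite (_ : connected_component _ _ = connected_component O (l0, 0))//.
apply/esym/same_connected_component.
exact: (connected_component_max Il IO cI Ix).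
Qed.

(** * Comparison of eigenvalues *)

(** The bases are chosen per value z rather than per index, so that indices with equal eigenvalue
    share one basis; its vectors are distributed over these indices by [enum_val]. *)
Lemma eigenbasis_family (R : realType) (V : lmodType R[i]) (H : hspace V)
    (A : V -> V -> Prop) (m : nat) (lam : 'I_m -> R[i]) :
  (forall i, has_multiplicity H A (lam i) #|[pred j | lam j == lam i]|) ->
  exists b : 'I_m -> V, (forall j, A (b j) (lam j *: b j)) /\
    forall j U, A U (lam j *: U) -> exists a : 'I_m -> R[i],
      hnorm H (U - \sum_i a i *: (if lam i == lam j then b i else 0)) = 0.
Proof.
move=> mult.
pose P z := [pred j | lam j == z].
have ex z : exists e : 'I_#|P z| -> V, (exists i, lam i = z) ->
    (forall i, A (e i) (z *: e i)) /\
    forall u, A u (z *: u) ->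
      exists c : 'I_#|P z| -> R[i], hnorm H (u - \sum_i c i *: e i) = 0.
  have [[i <-]|no] := pselect (exists i, lam i = z); last by exists (fun=> 0).
  by have [e [e1 _ e2]] := mult i; exists e.
pose e z := sval (cid (ex z)).
have eP j : (forall i, A (e (lam j) i) (lam j *: e (lam j) i)) /\
    forall u, A u (lam j *: u) -> exists c : 'I_#|P (lam j)| -> R[i],
      hnorm H (u - \sum_i c i *: e (lam j) i) = 0.
  by apply: (svalP (cid (ex (lam j)))); exists j.
pose pk T (x : T) z (c : 'I_#|P z| -> T) j :=
  if [pick i : 'I_#|P z| | enum_val i == j] is Some i then c i else x.
have pkE T (x : T) z (c : 'I_#|P z| -> T) i : pk T x z c (enum_val i) = c i.
  by rewrite /pk; case: pickP => [k /eqP/enum_val_inj ->//|/(_ i)]; rewrite eqxx.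
have mem j : j \in P (lam j) by rewrite inE.
exists (fun j => pk V 0 (lam j) (e (lam j)) j); split=> [j|j U AU].
  have -> : pk V 0 (lam j) (e (lam j)) j = e (lam j) (enum_rank_in (mem j) j).
    by rewrite -[RHS](pkE V 0) enum_rankK_in.
  exact: (eP j).1.
have [c Hc] := (eP j).2 U AU.
exists (pk _ 0 (lam j) c); rewrite -[RHS]Hc; congr (hnorm H (_ - _)).
rewrite (eq_bigr (fun k => if k \in P (lam j) then
    pk _ 0 (lam j) c k *: pk V 0 (lam j) (e (lam j)) k else 0)); last first.
  move=> k _; rewrite inE; case: eqP => [->//|_]; exact: scaler0.
rewrite -big_mkcond big_enum_val; apply: eq_bigr => i _.
by rewrite !pkE.
Qed.

Section connecting_linear.
Context {R : realType} {n d : nat}.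
Implicit Types u v : 'rV[R]_n -> 'rV[R[i]]_(n + 1).

Lemma connectingD u v :
  connecting (u + v) = connecting u + connecting v :> ('rV[R]_(n + d) -> _).
Proof.
apply/funext => z; rewrite /connecting !fctE.
by rewrite !add_row_mx addr0 !linearD.
Qed.

Lemma connectingZ a u :
  connecting (a *: u) = a *: connecting u :> ('rV[R]_(n + d) -> _).
Proof.
apply/funext => z; rewrite /connecting !fctE.
by rewrite !scale_row_mx scaler0 !linearZ.
Qed.

Lemma connecting_sum m (a : 'I_m -> R[i]) (e : 'I_m -> _) :
  connecting (\sum_i a i *: e i) =
  \sum_i a i *: connecting (e i) :> ('rV[R]_(n + d) -> 'rV[R[i]]_(n + d + 1)).
Proof.
have c0 : connecting (0 : 'rV[R]_n -> 'rV[R[i]]_(n + 1)) =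
    0 :> ('rV[R]_(n + d) -> 'rV[R[i]]_(n + d + 1)).
  by rewrite -(scale0r 0) connectingZ scale0r.
rewrite (big_morph _ connectingD c0).
by apply: eq_bigr => i _; rewrite connectingZ.
Qed.

End connecting_linear.

Lemma le_sqr_mul (R : realFieldType) (o a b : R) : 0 <= o -> 0 <= a -> 0 <= b ->
  a <= o * b -> a ^+ 2 <= o ^+ 2 * b ^+ 2.
Proof. by move=> o0 a0 b0 ab; rewrite -exprMn lerXn2r// nnegrE mulr_ge0. Qed.

Lemma sqr_mul_le (R : realFieldType) (o x N : R) : 0 < N -> 0 <= o ->
  `|x| ^+ 2 * N <= o ^+ 2 * N -> `|x| <= o.
Proof. by move=> N0 o0; rewrite ler_pM2r// ler_pXn2r ?nnegrE. Qed.

(** * Distance between the inverses of the eigenvalues *)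

Section inverse_eigenvalue_estimate.
Context {R : realType} {n d : nat}.
Variables (Omega : set 'rV[R]_n) (Omega1 : set 'rV[R]_(n + d)).
Hypothesis hthin : thin_domain Omega Omega1.
Variable delta : R.
Hypothesis delta_gt0 : 0 < delta.
Local Notation g := (slice_volume Omega1).
Local Notation Od := (Omega_ Omega1 delta).
Local Notation w := (cst (delta ^- d) : 'rV[R]_(n + d) -> R).

Definition coercive_symmetric q k (D : set 'rV[R]_q) (rho : 'rV[R]_q -> R)
    (A : ('rV[R]_q -> 'rV[R]_k) -> ('rV[R]_q -> 'rV[R]_k) -> Prop) (c : R) :=
  [/\ 0 < c,
      forall u v, A u v -> L2_real D rho u /\ L2_real D rho v,
      forall u v u' v', A u v -> A u' v' -> L2_dot D rho v u' = L2_dot D rho u v',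
      forall u v, A u v -> c * L2_dot D rho u u <= L2_dot D rho v u &
      forall u v v', A u v -> L2_real D rho v' ->
        L2_dot D rho (v - v') (v - v') = 0 -> A u v'].

Let mO := Omega_measurable hthin.
Let mg := slice_volume_measurable hthin.
Let g0 := slice_volume_gt0 hthin.
Let mOd := Omega__measurable hthin delta_gt0.

Lemma weight_measurable : measurable_fun Od w.
Proof. exact: measurable_cst. Qed.

Lemma weight_gt0 x : Od x -> 0 < w x.
Proof. by move=> _; rewrite /= invr_gt0 exprn_gt0. Qed.

Lemma norm2_null (U V : 'rV[R]_(n + d) -> 'rV[R[i]]_(n + d + 1)) :
  carrier (L2_delta Omega1 delta) U -> carrier (L2_delta Omega1 delta) V ->
  norm2 Od w (U - V) = 0 -> norm2 Od w U = norm2 Od w V.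
Proof.
move=> [u1 u2] [v1 v2] /(norm2_eq0 weight_gt0); rewrite re_partB im_partB => -[h1 h2].
have nul := L2_dot_null mOd weight_measurable weight_gt0.
rewrite /norm2 (nul _ _ _ _ u1 v1 u1 h1) (nul _ _ _ _ u2 v2 u2 h2).
rewrite (L2_dotC Od w (re_part V)) (L2_dotC Od w (im_part V)).
by rewrite (nul _ _ _ _ u1 v1 v1 h1) (nul _ _ _ _ u2 v2 v2 h2).
Qed.

Lemma inverse_eigenvalue_estimate A0 Ad (c : R) (z0 z1 : R) (m : nat) (l0 r h0 om : R)
    (e : 'I_m -> 'rV[R]_n -> 'rV[R[i]]_(n + 1)) (lam : 'I_m -> R)
    (b : 'I_m -> 'rV[R]_(n + d) -> 'rV[R[i]]_(n + d + 1)) (i : 'I_m) :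
  coercive_symmetric Omega g A0 c -> coercive_symmetric Od w Ad c ->
  regular (L2_hilbert mO mg g0) A0 z0 ->
  regular (L2_hilbert mOd weight_measurable weight_gt0) Ad z1 ->
  0 < l0 -> (forall j, 0 < lam j) -> 0 <= om ->
  (forall j, complexified A0 (e j) (Complex l0 0 *: e j)) ->
  (forall a : 'I_m -> R[i],
    hnorm (H_0 Omega Omega1) (\sum_i a i *: e i) = 0 -> forall i, a i = 0) ->
  (forall j, complexified Ad (b j) (Complex (lam j) 0 *: b j)) ->
  (forall j U, complexified Ad U (Complex (lam j) 0 *: U) ->
    exists a : 'I_m -> R[i], hnorm (L2_delta Omega1 delta)
      (U - \sum_i a i *: (if lam i == lam j then b i else 0)) = 0) ->
  (forall z, `|z - l0| < r -> (forall j, z != lam j) ->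
    regular (L2_hilbert mOd weight_measurable weight_gt0) Ad z) ->
  (forall x, `|x - l0^-1| < h0 -> 0 < x /\ `|x^-1 - l0| < r) ->
  `|(lam i)^-1 - l0^-1| < h0 ->
  (forall f0 u0 U, carrier (H_0 Omega Omega1) f0 -> complexified A0 u0 f0 ->
    complexified Ad U (connecting f0) ->
    hnorm (H_delta Omega Omega1 delta) (U - connecting u0) <=
      om * hnorm (H_0 Omega Omega1) f0) ->
  `|(lam i)^-1 - l0^-1| <= om.
Proof.
move=> [c0 dom0 sym0 coe0 nul0] [_ domd symd coed nuld] reg0 regd l0_gt0 lam_gt0 om0.
move=> Ae indep Ab span reg h0P hi conv.
have ce k : carrier (H_0 Omega Omega1) (e k) := (complexified_dom dom0 (Ae k)).1.
have cb j : carrier (L2_delta Omega1 delta) (b j) := (complexified_dom domd (Ab j)).1.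
have cc f : carrier (H_0 Omega Omega1) f -> carrier (L2_delta Omega1 delta) (connecting f).
  by move=> /(carrier_connecting hthin delta_gt0)[].
(* Only eigenvectors with eigenvalue different from [lam i] impose a condition; at least column [i]
   is therefore zero, and [kernel_vector] yields coefficients of a suitable eigenvector. *)
pose M k j := if lam j == lam i then 0 else hdot Od w (connecting (e k)) (b j).
have [|a [k0 ak0] aM] := @kernel_vector _ m M i; first by move=> k; rewrite /M eqxx.
pose phi := \sum_k a k *: e k.
have cphi : carrier (H_0 Omega Omega1) phi.
  by apply: (carrier_sum mO mg g0) => k; apply: (carrierZ mO mg g0).
have phi0 : 0 < norm2 Omega g phi.
  rewrite lt_def (norm2_ge0 g0) andbT; apply: contra_neq ak0 => /(hnorm_eq0 g0 phi) h.
  exact: indep h k0.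
pose W : 'rV[R]_(n + d) -> 'rV[R[i]]_(n + d + 1) := connecting phi.
have WE : W = \sum_k a k *: connecting (e k) by exact: connecting_sum.
have cW : carrier (L2_delta Omega1 delta) W by exact: cc.
have nW : norm2 Od w W = norm2 Omega g phi.
  have := hnorm_connecting hthin delta_gt0 cphi => /(congr1 (fun x => x ^+ 2)).
  by rewrite (hnorm_sq g0) => <-; rewrite -(hnorm_sq weight_gt0).
have Wb j : lam j != lam i -> hdot Od w W (b j) = 0.
  move=> ji; rewrite WE (hdot_sum mOd weight_measurable weight_gt0)//; last first.
    by move=> k; exact: cc.
  by rewrite -[RHS](aM j); apply: eq_bigr => k _; rewrite /M (negbTE ji).
have [u0 Au0 hu0] := eigenspace_solution dom0 sym0 nul0 a reg0 (lt0r_neq0 l0_gt0) Ae.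
have [U AU] := complexified_surjective c0 domd symd coed nuld regd cW.
have cU := (complexified_dom domd AU).1; have cu0 := (complexified_dom dom0 Au0).1.
have est := conv _ _ _ cphi Au0 AU.
have orth j v : lam j != lam i -> Ad v (lam j *: v) ->
    L2_dot Od w (re_part W) v = 0 /\ L2_dot Od w (im_part W) v = 0.
  move=> ji.
  apply: (hdot_orthogonal mOd weight_measurable weight_gt0 domd
    (e := fun k => if lam k == lam j then b k else 0)) => //.
  - by move=> k; case: ifP => // _; exact: (carrier0 mOd weight_measurable weight_gt0).
  - by move=> V /span[a' Ha']; exists a'; apply/(hnorm_eq0 weight_gt0).
  - move=> k; case: ifP => [/eqP kj|_]; first by apply: Wb; rewrite kj.
    apply: hdot_eq0C; rewrite -(scale0r (0 : 'rV[R]_(n + d) -> 'rV[R[i]]_(n + d + 1))).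
    have c00 := carrier0 mOd weight_measurable weight_gt0 (k := n + d + 1).
    have := hdotP mOd weight_measurable weight_gt0 (-1) c00 c00 cW.
    by rewrite scaler0 addr0 mulN1r subrr scale0r.
have surj := regular_surjective (S := L2_hilbert mOd weight_measurable weight_gt0)
  c0 domd symd coed nuld regd.
have estimate := eigenvalue_estimate (S := L2_hilbert mOd weight_measurable weight_gt0)
  c0 domd symd coed nuld surj lam_gt0 reg h0P hi.
have e1 := estimate _ _ (fun j v ji Av => (orth j v ji Av).1) AU.1.
have e2 := estimate _ _ (fun j v ji Av => (orth j v ji Av).2) AU.2.
rewrite /= in e1 e2.
have tot : `|(lam i)^-1 - l0^-1| ^+ 2 * norm2 Od w W <= norm2 Od w (U - Complex l0^-1 0 *: W).
  have e3 := lerD e1 e2; rewrite -mulrDr in e3.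
  by apply: (le_trans e3); rewrite /norm2 re_partB im_partB re_partZr im_partZr lexx.
have cl : carrier (L2_delta Omega1 delta) (Complex l0^-1 0 *: W).
  exact: (carrierZ mOd weight_measurable weight_gt0).
(* The preimage [u0] agrees with [phi] divided by [l0] up to a null function, and the isometry
   carries null functions to null functions. *)
have shift : norm2 Od w (U - connecting u0) = norm2 Od w (U - Complex l0^-1 0 *: W).
  apply: norm2_null; try by apply: (carrierB mOd weight_measurable weight_gt0) => //; exact: cc.
  rewrite opprB addrC addrA subrK -connectingZ -scaleN1r -connectingZ -connectingD scaleN1r.
  rewrite -opprB -scaleN1r connectingZ.
  have cd : carrier (H_0 Omega Omega1) (u0 - Complex l0^-1 0 *: phi).
    by apply: (carrierB mO mg g0) => //; exact: (carrierZ mO mg g0).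
  rewrite (norm2Z mOd weight_measurable weight_gt0)//; last exact: cc.
  rewrite -(hnorm_sq weight_gt0) (_ : hnorm _ _ = 0) ?expr0n ?mulr0//.
  have := hnorm_connecting hthin delta_gt0 cd => /= ->.
  by apply/(hnorm_eq0 g0).
rewrite -shift nW in tot.
have est2 : norm2 Od w (U - connecting u0) <= om ^+ 2 * norm2 Omega g phi.
  have h1 : hnorm (H_delta Omega Omega1 delta) (U - connecting u0) ^+ 2 =
      norm2 Od w (U - connecting u0) := hnorm_sq weight_gt0 _.
  have h2 : hnorm (H_0 Omega Omega1) phi ^+ 2 = norm2 Omega g phi := hnorm_sq g0 _.
  have p1 : 0 <= hnorm (H_delta Omega Omega1 delta) (U - connecting u0) := sqrtr_ge0 _.
  have p2 : 0 <= hnorm (H_0 Omega Omega1) phi := sqrtr_ge0 _.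
  by rewrite -h1 -h2; exact: le_sqr_mul om0 p1 p2 est.
exact: sqr_mul_le phi0 om0 (le_trans tot est2).
Qed.

End inverse_eigenvalue_estimate.

(** The distance of the inverses is |x - l| / (x l), and x l > l^2 / 2. It is applied both near [l0]
    and near its inverse. *)
Lemma inverse_close (R : realFieldType) (l h x : R) : 0 < l -> 0 < h ->
  `|x - l| < Num.min (l / 2) (h * l ^+ 2 / 2) ->
  [/\ 0 < x, x <= 2 * l & `|x^-1 - l^-1| < h].
Proof.
move=> l0 h0; rewrite lt_min => /andP[x1 x2].
have x12 : l / 2 < x <= 2 * l.
  by move: x1; rewrite ltr_norml => /andP[? ?]; apply/andP; split; lra.
have /andP[xl xu] := x12.
have x0 : 0 < x by apply: lt_trans xl; rewrite divr_gt0.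
split => //.
rewrite (_ : x^-1 - l^-1 = (l - x) / (x * l)); last first.
  by field; rewrite !gt_eqF.
rewrite normrM distrC normfV (gtr0_norm (mulr_gt0 x0 l0)) ltr_pdivrMr ?mulr_gt0//.
apply: (lt_le_trans x2); rewrite -mulrA ler_pM2l// expr2.
by have := ler_pM2r l0 (l / 2) x; rewrite (ltW xl) => ?; nra.
Qed.

Lemma rm_coercive_symmetric (R : realType) (q : nat) (t E k sigma kappa C : R)
    (D : set 'rV[R]_q) (rho : 'rV[R]_q -> R) :
  0 < t -> 0 < E -> 0 < k -> -1 < sigma < 1 -> 0 <= 1 - sigma + q%:R * kappa ->
  measurable D -> measurable_fun D rho -> (forall x, D x -> 0 < rho x) ->
  (forall x, D x -> rho x <= C) ->
  coercive_symmetric D rho (rm_operator t E k sigma kappa D rho) (rm_coercivity t).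
Proof.
move=> t0 E0 k0 s1 kap mD mrho rho0 rhoC; split.
- exact: rm_coercivity_gt0.
- by move=> u v; exact: (rm_operator_dom mD mrho rho0 rhoC).
- by move=> u v u' v'; exact: rm_operator_sym.
- by move=> u v; exact: (rm_operator_coercive E0 k0 s1 kap mD mrho rho0 rhoC).
- by move=> u v v'; exact: (rm_operator_null mD mrho rho0 rhoC).
Qed.

Lemma normc_real (R : realType) (x y : R) : normc (Complex x 0 - Complex y 0) = `|x - y|.
Proof. by rewrite /normc /= subr0 expr0n addr0 sqrtr_sqr. Qed.

Section opnorm_bounds.
Context {R : realType} {V W : lmodType R[i]} (X : hspace V) (Y : hspace W).

(** A witness is required because the supremum of an empty set is minus infinity. *)
Lemma opnorm_ge0 (T : V -> W -> Prop) v w :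
  carrier X v -> carrier Y w -> T v w -> hnorm X v <= 1 -> 0 <= hnorm Y w ->
  (0 <= opnorm X Y T)%E.
Proof.
move=> hv hw Tvw v1 w0; apply: (@le_trans _ _ (hnorm Y w)%:E); first by rewrite lee_fin.
by apply: ereal_sup_ubound; exists v, w.
Qed.

Lemma opnorm_le (T : V -> W -> Prop) (K : R) : 0 <= K ->
  (forall v w, carrier X v -> T v w -> hnorm Y w <= K * hnorm X v) ->
  (opnorm X Y T <= K%:E)%E.
Proof.
move=> K0 H; apply: ge_ereal_sup => _ [v [w [hv hw Tvw v1 ->]]].
rewrite lee_fin; apply: (le_trans (H _ _ hv Tvw)).
by rewrite -[leRHS]mulr1 ler_wpM2l.
Qed.

End opnorm_bounds.

(** The inverse of 0 is plus infinity, so a vanishing operator norm only helps; K + 1 replaces [K]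
    to keep the bound finite when [K] is 0. *)
Lemma inve_ge (R : realType) (K : R) (x : \bar R) : 0 <= K ->
  (0 <= x)%E -> (x <= K%:E)%E -> ((K + 1)^-1%:E <= x^-1)%E.
Proof.
move=> K0; case: x => [x||]//; rewrite !lee_fin => x0 xK.
rewrite inver; case: eqP => [_|/eqP xn0]; first exact: leey.
have xp : 0 < x by rewrite lt_def xn0.
by rewrite lee_fin lef_pV2 ?posrE//; lra.
Qed.

(** The lower bound on [sigma] says 1 + (N - 1) sigma > 0. On the thin domain this number is the
    second quantity itself; in the limit it appears multiplied by 1 - sigma and divided by 1 - sigma
    + d sigma, which is positive because d <= N - 1. *)
Lemma rm_parameters (R : realType) (N d : nat) (sigma : R) :
  (2 <= N)%N -> (1 <= d <= N.-1)%N -> - (N.-1%:R)^-1 < sigma < 1 ->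
  [/\ -1 < sigma < 1, 0 <= 1 - sigma + (N - d + d)%:R * sigma &
   0 <= 1 - sigma +
     (N - d)%:R * ((1 - sigma) * sigma / (1 - sigma + d%:R * sigma))].
Proof.
move=> hN /andP[hd1 hd2] /andP[sg1 sg2].
have N0 : (0 < N)%N := ltnW hN.
have N1 : (0 < N.-1)%N by rewrite -ltnS prednK.
have N1R : 0 < N.-1%:R :> R by rewrite ltr0n.
have sN : 0 < 1 + N.-1%:R * sigma.
  have : N.-1%:R * - (N.-1%:R^-1) < N.-1%:R * sigma by rewrite ltr_pM2l.
  by rewrite mulrN divff ?gt_eqF//; lra.
have sg0 : -1 < sigma < 1.
  rewrite sg2 andbT; apply: le_lt_trans sg1.
  by rewrite lerN2 invf_le1// ler1n.
have NE : N%:R = N.-1%:R + 1 :> R by rewrite natr1 prednK.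
have dN : (d <= N)%N by rewrite (leq_trans hd2)// leq_pred.
have d1 : 1 <= d%:R :> R by rewrite ler1n.
have d2 : d%:R <= N.-1%:R :> R by rewrite ler_nat.
have den : 0 < 1 - sigma + d%:R * sigma.
  have [sp|sn] := leP 0 sigma.
    have := mulr_ge0 (ler0n R d) sp; lra.
  have : N.-1%:R * sigma <= d%:R * sigma by rewrite ler_nM2r.
  lra.
split=> //; first by rewrite subnK// NE; lra.
have -> : 1 - sigma + (N - d)%:R * ((1 - sigma) * sigma / (1 - sigma + d%:R * sigma)) =
    (1 - sigma) * (1 + N.-1%:R * sigma) / (1 - sigma + d%:R * sigma).
  by rewrite natrB// NE; field; rewrite gt_eqF.
apply: divr_ge0; last exact: ltW.
by apply: mulr_ge0; [rewrite subr_ge0 ltW|exact: ltW].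
Qed.

Section multiplicity_positive.
Context {R : realType} {q k : nat}.
Variables (D : set 'rV[R]_q) (rho : 'rV[R]_q -> R).
Hypothesis mD : measurable D.
Hypothesis mrho : measurable_fun D rho.
Hypothesis rho_gt0 : forall x, D x -> 0 < rho x.
Variables (A : ('rV[R]_q -> 'rV[R]_k) -> ('rV[R]_q -> 'rV[R]_k) -> Prop) (c : R).
Hypothesis csA : coercive_symmetric D rho A c.

Lemma eigenvalue_positive lam p : (0 < p)%N ->
  has_multiplicity (L2 k D rho) (complexified A) lam p ->
  lam = Complex (complex.Re lam) 0 /\ c <= complex.Re lam.
Proof.
move=> p0 [e [Ae indep _]]; have [c0 dom sym coe _] := csA.
have [i0 _] : exists i0 : 'I_p, true by exists (Ordinal p0).
have n0 : norm2 D rho (e i0) <> 0.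
  move=> /(hnorm_eq0 rho_gt0) h.
  have := indep (fun i => (i == i0)%:R) _ i0.
  rewrite (bigD1 i0)//= eqxx scale1r big1 ?addr0; last first.
    by move=> i /negbTE ->; rewrite scale0r.
  by move=> /(_ h) /eqP; rewrite oner_eq0.
exact: (eigenvalue_real mD mrho rho_gt0 dom sym coe (Ae i0) n0).
Qed.

Lemma hnorm0 : hnorm (L2 k D rho) 0 = 0.
Proof.
have c00 := carrier0 mD mrho rho_gt0 (k := k).
apply/(hnorm_eq0 rho_gt0).
rewrite -(scale0r (0 : 'rV[R]_q -> 'rV[R[i]]_k)) (norm2Z mD mrho rho_gt0 0 c00).
by rewrite normc0 expr0n mul0r.
Qed.

Lemma inverse_opnorm_ge0 z : regular (L2_hilbert mD mrho rho_gt0) A z ->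
  (0 <= opnorm (L2 k D rho) (L2 k D rho) (fun F U => complexified A U F))%E.
Proof.
move=> reg; have [c0 dom sym coe nul] := csA.
have c00 := carrier0 mD mrho rho_gt0 (k := k).
have [U AU] := complexified_surjective c0 dom sym coe nul reg c00.
apply: (opnorm_ge0 c00 (complexified_dom dom AU).1 AU).
  by rewrite hnorm0 ler01.
exact: sqrtr_ge0.
Qed.

End multiplicity_positive.

(** * Estimates at a fixed thickness *)

Section thin_estimate.
Context {R : realType} {n d : nat}.
Variables (Omega : set 'rV[R]_n) (Omega1 : set 'rV[R]_(n + d)).
Hypothesis hthin : thin_domain Omega Omega1.
Variable delta : R.
Hypothesis delta_gt0 : 0 < delta.
Local Notation g := (slice_volume Omega1).
Local Notation Od := (Omega_ Omega1 delta).
Local Notation w := (cst (delta ^- d) : 'rV[R]_(n + d) -> R).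
Local Notation S0 := (L2_hilbert (Omega_measurable hthin)
  (slice_volume_measurable hthin) (slice_volume_gt0 hthin)).
Local Notation Sd := (L2_hilbert (Omega__measurable hthin delta_gt0)
  (@weight_measurable R n d Omega1 delta) (@weight_gt0 R n d Omega1 delta delta_gt0)).

Variables (A0 : ('rV[R]_n -> 'rV[R]_(n + 1)) -> ('rV[R]_n -> 'rV[R]_(n + 1)) -> Prop)
  (Ad : ('rV[R]_(n + d) -> 'rV[R]_(n + d + 1)) ->
        ('rV[R]_(n + d) -> 'rV[R]_(n + d + 1)) -> Prop) (c : R).
Hypothesis cs0 : coercive_symmetric Omega g A0 c.
Hypothesis csd : coercive_symmetric Od w Ad c.
Variables (m : nat) (l0 r om : R) (lam : 'I_m -> R[i]).
Hypotheses (l0_gt0 : 0 < l0) (r_gt0 : 0 < r) (om_ge0 : 0 <= om).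
Hypothesis reg0 : regular S0 A0 (l0 + r / 2).
Hypothesis hmult0 : has_multiplicity (H_0 Omega Omega1) (complexified A0) (Complex l0 0) m.
Hypothesis hmult : forall i, has_multiplicity (L2_delta Omega1 delta)
  (complexified Ad) (lam i) #|[pred j | lam j == lam i]|.
Hypothesis honly : forall z : R, `|z - l0| < r ->
  spectrum (L2_delta Omega1 delta) (complexified Ad) (Complex z 0) ->
  exists i, Complex z 0 = lam i.
Hypothesis hconv : forall f0 u0 U, carrier (H_0 Omega Omega1) f0 ->
  complexified A0 u0 f0 -> complexified Ad U (connecting f0) ->
  hnorm (H_delta Omega Omega1 delta) (U - connecting u0) <=
    om * hnorm (H_0 Omega Omega1) f0.

(** Given by [inverse_close] at 1/l0: inversion sends the window of this radius into the interval of
    radius [r] around [l0]. *)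
Definition inverse_radius := Num.min (l0^-1 / 2) (r * l0^-1 ^+ 2 / 2).
(** The bound r / 2 keeps the eigenvalues away from [l0 + r / 2]; the rest places their inverses
    within [inverse_radius] of 1/l0. *)
Definition eigenvalue_radius :=
  Num.min (r / 2) (Num.min (l0 / 2) (inverse_radius * l0 ^+ 2 / 2)).
Hypothesis hclose : forall i, normc (lam i - Complex l0 0) < eigenvalue_radius.

Let mu i := complex.Re (lam i).

Let lamE i : lam i = Complex (mu i) 0 /\ c <= mu i.
Proof.
have p0 : (0 < #|[pred j | lam j == lam i]|)%N.
  by apply/card_gt0P; exists i; rewrite inE.
exact: (eigenvalue_positive (Omega__measurable hthin delta_gt0)
  (@weight_measurable R n d Omega1 delta) (@weight_gt0 R n d Omega1 delta delta_gt0) csd p0 (hmult i)).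
Qed.

Let mu_close i : `|mu i - l0| < eigenvalue_radius.
Proof. by have := hclose i; rewrite (lamE i).1 normc_real. Qed.

Lemma inverse_radius_gt0 : 0 < inverse_radius.
Proof.
have l0V : 0 < l0^-1 by rewrite invr_gt0.
by rewrite lt_min !divr_gt0// mulr_gt0// exprn_gt0.
Qed.

Lemma eigenvalue_radius_gt0 : 0 < eigenvalue_radius.
Proof.
rewrite !lt_min !divr_gt0//= mulr_gt0 ?inverse_radius_gt0//.
by rewrite exprn_gt0.
Qed.

Let regd z : `|z - l0| < r -> (forall j, z != mu j) -> regular Sd Ad z.
Proof.
move=> zr zmu; apply: regular_of_resolvent; apply: contrapT => spec.
have [j] := honly zr spec; rewrite (lamE j).1 => -[] /eqP.
by apply/negP; exact: zmu.
Qed.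

Lemma regular_thin : regular Sd Ad (l0 + r / 2).
Proof.
have r2 : 0 < r / 2 by rewrite divr_gt0.
have e : `|l0 + r / 2 - l0| = r / 2 by rewrite addrC addKr gtr0_norm.
apply: regd => [|j]; first by rewrite e ltr_pdivrMr// mulr_natr mulr2n ltrDl.
apply/eqP => zj; have := mu_close j; rewrite lt_min => /andP[+ _].
by rewrite -zj e ltxx.
Qed.

Lemma eigenvalue_estimate_thin i :
  normc (lam i - Complex l0 0) <= 2 * l0 ^+ 2 * om.
Proof.
have c0 : 0 < c by case: csd.
have mu0 j : 0 < mu j := lt_le_trans c0 (lamE j).2.
have l0V : 0 < l0^-1 by rewrite invr_gt0.
have /andP[_ cl] : (`|mu i - l0| < r / 2) &&
    (`|mu i - l0| < Num.min (l0 / 2) (inverse_radius * l0 ^+ 2 / 2)).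
  by rewrite -lt_min; exact: mu_close.
have [_ mu2 muh] := inverse_close l0_gt0 inverse_radius_gt0 cl.
have h0P x : `|x - l0^-1| < inverse_radius -> 0 < x /\ `|x^-1 - l0| < r.
  by move=> /(inverse_close l0V r_gt0)[? _]; rewrite invrK.
have [e [Ae indep _]] := hmult0.
have [b [Ab span]] := eigenbasis_family hmult.
have Ab' j : complexified Ad (b j) (Complex (mu j) 0 *: b j).
  by rewrite -(lamE j).1; exact: Ab.
have span' j U : complexified Ad U (Complex (mu j) 0 *: U) ->
    exists a : 'I_m -> R[i], hnorm (L2_delta Omega1 delta)
      (U - \sum_i a i *: (if mu i == mu j then b i else 0)) = 0.
  rewrite -(lamE j).1 => /span[a Ha]; exists a; rewrite -[RHS]Ha.
  congr (hnorm _ (_ - _)); apply: eq_bigr => l _; congr (_ *: _).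
  by rewrite (lamE l).1 (lamE j).1 eq_complex /= eqxx andbT.
have h := inverse_eigenvalue_estimate cs0 csd reg0 regular_thin l0_gt0 mu0 om_ge0
  Ae indep Ab' span' regd h0P muh hconv.
rewrite (lamE i).1 normc_real.
have mn : mu i != 0 by rewrite gt_eqF.
have ln : l0 != 0 by rewrite gt_eqF.
(* The factor 2 of the estimate comes from [mu i <= 2 * l0]. *)
have -> : mu i - l0 = - (mu i * l0) * ((mu i)^-1 - l0^-1).
  by field; rewrite mn ln.
have ml : 0 < mu i * l0 by exact: mulr_gt0.
have -> : 2 * l0 ^+ 2 * om = (2 * l0 * l0) * om by ring.
rewrite normrM normrN (gtr0_norm ml).
by apply: ler_pM => //; [exact: ltW|rewrite ler_pM2r].
Qed.

(** The inverse norm is at least 1/(K + 1) by the isometry, and the sum is at least 1 because it has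
    a term and every term is at least 1. *)
Lemma quotient_ge (K : R) (P : _ -> _) : 0 <= K -> (0 < m)%N ->
  (forall f, carrier (H_0 Omega Omega1) f -> carrier (H_0 Omega Omega1) (P f)) ->
  (forall f, carrier (H_0 Omega Omega1) f ->
    hnorm (H_0 Omega Omega1) (P f) <= K * hnorm (H_0 Omega Omega1) f) ->
  ((K + 1)^-1%:E <=
   (opnorm (H_0 Omega Omega1) (H_delta Omega Omega1 delta)
      (fun f w => w = connecting (P f)))^-1 *
   \sum_(i < m) (1 + (normc (lam i))%:E + (normc (lam i))%:E *
      opnorm (L2_delta Omega1 delta) (L2_delta Omega1 delta)
        (fun F U => complexified Ad U F)))%E.
Proof.
move=> K0 m0 cP HK.
have opA : (0 <= opnorm (L2_delta Omega1 delta) (L2_delta Omega1 delta)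
    (fun F U => complexified Ad U F))%E := inverse_opnorm_ge0 csd regular_thin.
set op := opnorm _ _ _ in opA *.
have t0 i : (1 <= 1 + (normc (lam i))%:E + (normc (lam i))%:E * op)%E.
  have l1 : (0 <= (normc (lam i))%:E)%E.
    by rewrite lee_fin (lamE i).1 /normc sqrtr_ge0.
  by rewrite -addeA leeDl// adde_ge0// mule_ge0.
have S1 : (1 <= \sum_(i < m) (1 + (normc (lam i))%:E + (normc (lam i))%:E * op))%E.
  rewrite (bigD1 (Ordinal m0))//=; apply: (le_trans (t0 (Ordinal m0))).
  by rewrite leeDl// sume_ge0// => i _; exact: le_trans (t0 i).
rewrite -[leLHS]mule1; apply: lee_pmul => //; first by rewrite lee_fin invr_ge0; lra.
apply: inve_ge => //.
  have c00 := carrier0 (Omega_measurable hthin)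
    (slice_volume_measurable hthin) (slice_volume_gt0 hthin) (k := n + 1).
  have cc := carrier_connecting hthin delta_gt0 (cP _ c00).
  apply: (opnorm_ge0 c00 cc erefl); last exact: sqrtr_ge0.
  rewrite (_ : hnorm _ _ = 0) ?ler01//.
  exact: (hnorm0 (Omega_measurable hthin)
    (slice_volume_measurable hthin) (slice_volume_gt0 hthin)).
apply: opnorm_le => // v w' hv ->.
rewrite (hnorm_connecting hthin delta_gt0 (cP _ hv)); exact: HK.
Qed.

End thin_estimate.

Theorem theorem6p5 (R : realType) (N d : nat)
  (hN : (2 <= N)%N) (hd : (1 <= d <= N.-1)%N)
  (Omega : set 'rV[R]_(N - d)) (Omega1 : set 'rV[R]_(N - d + d))
  (hthin : thin_domain Omega Omega1)
  (t E k sigma : R) (ht : 0 < t) (hE : 0 < E) (hk : 0 < k)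
  (hsigma : - (N.-1%:R)^-1 < sigma < 1)
  (omega : R -> R)
  (homega : forall delta, 0 < delta <= 1 -> 0 < omega delta)
  (homega0 : omega delta @[delta --> 0^'+] --> (0 : R))
  (hconv : forall delta, 0 < delta <= 1 -> forall f0 u0 U,
    carrier (H_0 Omega Omega1) f0 ->
    A_0 t E k sigma Omega Omega1 u0 f0 ->
    A_delta t E k sigma Omega1 delta U (connecting f0) ->
    hnorm (H_delta Omega Omega1 delta) (U - connecting u0) <=
      omega delta * hnorm (H_0 Omega Omega1) f0)
  (m : nat) (hm : (1 <= m)%N) (lam0 : R[i])
  (hlam0 : spectrum (H_0 Omega Omega1) (A_0 t E k sigma Omega Omega1) lam0)
  (hmult0 : has_multiplicity (H_0 Omega Omega1)
    (A_0 t E k sigma Omega Omega1) lam0 m)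
  (lam : R -> 'I_m -> R[i])
  (hlam : forall delta, 0 < delta <= 1 -> forall i,
    spectrum (L2_delta Omega1 delta) (A_delta t E k sigma Omega1 delta)
      (lam delta i))
  (hmult : \forall delta \near (0 : R)^'+, forall i,
    has_multiplicity (L2_delta Omega1 delta)
      (A_delta t E k sigma Omega1 delta) (lam delta i)
      #|[pred j | lam delta j == lam delta i]|)
  (hlamcvg : forall i,
    normc (lam delta i - lam0) @[delta --> 0^'+] --> (0 : R))
  (gam : R -> R[i]) (hgam : jordan_curve gam)
  (hin0 : inside gam lam0)
  (honly0 : forall z, inside gam z ->
    spectrum (H_0 Omega Omega1) (A_0 t E k sigma Omega Omega1) z -> z = lam0)
  (hin : \forall delta \near (0 : R)^'+, forall i, inside gam (lam delta i))
  (honly : \forall delta \near (0 : R)^'+, forall z, inside gam z ->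
    spectrum (L2_delta Omega1 delta) (A_delta t E k sigma Omega1 delta) z ->
    exists i, z = lam delta i)
  (P : ('rV[R]_(N - d) -> 'rV[R[i]]_(N - d + 1)) ->
       ('rV[R]_(N - d) -> 'rV[R[i]]_(N - d + 1)))
  (hP : is_resolvent_integral (H_0 Omega Omega1)
    (A_0 t E k sigma Omega Omega1) gam P) :
  exists2 C : R, 0 < C &
    \forall delta0 \near (0 : R)^'+, forall delta, 0 < delta < delta0 ->
      ((\sum_i normc (lam delta i - lam0))%:E <=
       (C * omega delta * normc lam0)%:E *
       ereal_sup
         [set (opnorm (H_0 Omega Omega1) (H_delta Omega Omega1 delta')
                 (fun f w => w = connecting (P f)))^-1 *
              \sum_(i < m)
                (1 + (normc (lam delta' i))%:E +
                 (normc (lam delta' i))%:E *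
                 opnorm (L2_delta Omega1 delta') (L2_delta Omega1 delta')
                   (fun F U => A_delta t E k sigma Omega1 delta' U F))
         | delta' in [set x : R | 0 < x < delta0]%R])%E.
Proof.
have [sg0 kapd kap0] := rm_parameters hN hd hsigma.
have mO := Omega_measurable hthin.
have mg := slice_volume_measurable hthin.
have g0 := slice_volume_gt0 hthin.
have [Cg hCg] := slice_volume_bounded hthin.
have cs0 := rm_coercive_symmetric ht hE hk sg0 kap0 mO mg g0 hCg.
have c0 : 0 < rm_coercivity t by case: cs0.
have [lam0E l0c] := eigenvalue_positive mO mg g0 cs0 hm hmult0.
move: lam0E l0c; set l0 := complex.Re lam0 => lam0E l0c.
have l0_gt0 : 0 < l0 := lt_le_trans c0 l0c.
rewrite lam0E in hin0 hmult0 honly0 hlamcvg *.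
clear lam0E hlam0.
have [r r0 hr] := inside_interval hgam hin0.
have r2 : 0 < r / 2 by rewrite divr_gt0.
have z0r : `|l0 + r / 2 - l0| < r.
  by rewrite addrC addKr gtr0_norm// ltr_pdivrMr// mulr_natr mulr2n ltrDl.
have reg0 : regular (L2_hilbert (Omega_measurable hthin)
    (slice_volume_measurable hthin) (slice_volume_gt0 hthin))
    (rm_operator t E k sigma ((1 - sigma) * sigma / (1 - sigma + d%:R * sigma))
      Omega (slice_volume Omega1)) (l0 + r / 2).
  (* The point lies inside the curve and differs from [l0], the only spectral point there. *)
  apply: regular_of_resolvent; apply: contrapT => /(honly0 _ (hr _ z0r)).
  move=> [] /eqP; rewrite -subr_eq0 addrC addKr; apply/negP.
  by rewrite gt_eqF.
have eta0 := eigenvalue_radius_gt0 l0_gt0 r0.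
have close : \forall delta \near (0 : R)^'+, forall i,
    normc (lam delta i - Complex l0 0) < eigenvalue_radius l0 r.
  apply: filter_forall => i.
  have /cvgrPdist_lt /(_ _ eta0) := hlamcvg i; apply: filterS => delta.
  by rewrite sub0r normrN; exact: le_lt_trans (ler_norm _).
have le1 : \forall delta \near (0 : R)^'+, delta <= 1 by exact: nbhs_right_le.
have [K K0 HK] := resolvent_integral_bounded mO mg g0
  (fun U F AU => (complexified_dom (let: And5 _ dom _ _ _ := cs0 in dom) AU).1) hP.
have [_ cP _] := hP.
have main delta : 0 < delta -> delta <= 1 ->
    (forall i, normc (lam delta i - Complex l0 0) < eigenvalue_radius l0 r) ->
    (forall i, has_multiplicity (L2_delta Omega1 delta)
      (A_delta t E k sigma Omega1 delta) (lam delta i)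
      #|[pred j | lam delta j == lam delta i]|) ->
    (forall z, inside gam z ->
      spectrum (L2_delta Omega1 delta) (A_delta t E k sigma Omega1 delta) z ->
      exists i, z = lam delta i) ->
    (forall i, normc (lam delta i - Complex l0 0) <= 2 * l0 ^+ 2 * omega delta) /\
    ((K + 1)^-1%:E <=
      (opnorm (H_0 Omega Omega1) (H_delta Omega Omega1 delta)
                 (fun f w => w = connecting (P f)))^-1 *
              \sum_(i < m)
                (1 + (normc (lam delta i))%:E +
                 (normc (lam delta i))%:E *
                 opnorm (L2_delta Omega1 delta) (L2_delta Omega1 delta)
                   (fun F U => A_delta t E k sigma Omega1 delta U F)))%E.
  move=> delta_gt0 delta1 cl mult only.
  have dle : 0 < delta <= 1 by rewrite delta_gt0.
  have om0 : 0 <= omega delta by exact: ltW (homega delta dle).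
  have csd := rm_coercive_symmetric ht hE hk sg0 kapd
    (Omega__measurable hthin delta_gt0) (@weight_measurable R (N - d) d Omega1 delta)
    (@weight_gt0 R (N - d) d Omega1 delta delta_gt0) (fun x _ => lexx _).
  have only' z (zr : `|z - l0| < r) := only _ (hr _ zr).
  split=> [i|].
    exact: (eigenvalue_estimate_thin delta_gt0 cs0 csd l0_gt0 r0 om0 reg0 hmult0 mult only'
      (hconv delta dle) cl).
  exact: (quotient_ge hthin delta_gt0 csd r0 mult only' cl K0 hm cP HK).
have K1 : 0 < K + 1 by rewrite ltr_wpDl.
have m0 : 0 < m%:R :> R by rewrite ltr0n.
(* There are [m] terms of size at most 2 l0^2 omega; one factor [l0] is left for |lambda_0|, and K +
   1 compensates the lower bound 1/(K + 1) of the supremum. [K] depends only on the limit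
   problem. *)
exists (2 * m%:R * l0 * (K + 1)); first by rewrite !mulr_gt0.
have [eps /= eps0 H] := filterI (filterI le1 close) (filterI hmult honly).
exists eps => // delta0 near0 d00 delta /andP[delta_gt0 delta_lt].
have [|[? ?] [? ?]] := H delta _ delta_gt0.
  rewrite /= sub0r normrN gtr0_norm//; apply: (lt_trans delta_lt).
  by move: near0; rewrite /= sub0r normrN gtr0_norm.
have [//|//|//|//|//|est sup_ge] := main delta.
have om0 : 0 <= omega delta by apply/ltW/homega; rewrite delta_gt0.
apply: (@le_trans _ _ ((2 * m%:R * l0 * (K + 1) * omega delta * l0)%:E *
    ((K + 1)^-1)%:E)%E).
  rewrite -EFinM lee_fin.
  have -> : 2 * m%:R * l0 * (K + 1) * omega delta * l0 / (K + 1) =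
      m%:R * (2 * l0 ^+ 2 * omega delta) by field; rewrite gt_eqF.
  by rewrite mulr_natl -[X in _ *+ X]card_ord -sumr_const; apply: ler_sum => i _.
rewrite expr0n addr0 sqrtr_sqr (gtr0_norm l0_gt0).
apply: lee_wpmul2l; first by rewrite lee_fin !mulr_ge0 ?(ltW K1) ?(ltW l0_gt0).
(* The thickness [delta] is itself one of those over which the supremum runs, so its own bracket
   suffices. *)
by apply: (le_trans sup_ge); apply: ereal_sup_ubound; exists delta => //=; rewrite delta_gt0.
Qed.
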